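(* In the setting of the context, let $p_{\mathrm{v}}:\mathcal D_{\mathscr F_{\mathrm v}}(M,L)\to\mathcal D_{\mathscr G_{\mathrm v}}(J^\circ,L)$ and $p_{\mathrm h}:\mathcal D_{\mathscr F_{\mathrm h}}(M,L)\to\mathcal D_{\mathscr G_{\mathrm h}}(J^\circ,L)$ be the pushforward maps, let $\mathcal F:\mathcal D_{\mathscr F_{\mathrm v}}(M,L)\to\mathcal D_{\mathscr F_{\mathrm h}}(M,L)$ be the integral along the leaves of $\mathscr F_{\mathrm h}$ (the Fourier transform), and let $\mathcal H_{\mathrm{Std}}:\mathcal D_{\mathscr G_{\mathrm v}}(J^\circ,L)\to\mathcal D_{\mathscr G_{\mathrm h}}(J^\circ,L)$ be the integral along the leaves of $\mathscr G_{\mathrm h}$. Then $\mathcal H_{\mathrm{Std}}\circ p_{\mathrm v}=p_{\mathrm h}\circ\mathcal F$.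
   Context: $F=\mathbb R$, $\psi(x)=e^{i\hbar x}$, $\hbar\neq0$; for a volume form $\Omega$, $|\Omega|$ is the associated measure using the $\psi$-self-dual measure on $F$. $V$ is $n$-dimensional, $M=\operatorname{End}(V)\oplus\operatorname{End}(V^* )$ (pairs $(A,B)$ of $n\times n$ matrices, $\langle A,B\rangle=\operatorname{tr}(AB)$), symplectic form $\omega_M=\sum_jdT_j\wedge dT_j^*$ for dual bases. $L$: sections are pairs $(\Phi,\Phi^* )$ of smooth functions on $M$ with $\Phi^*(A,B)=\psi(-\langle A,B\rangle)\Phi(A,B)$; connection $\nabla=(\nabla^0-i\hbar\sum_jT_j^*dT_j,\ \nabla^0+i\hbar\sum_jT_jdT_j^* )$, curvature $i\hbar\omega_M$. Foliations of $M$: $\mathscr F_{\mathrm v}:M\to\operatorname{End}(V)$ and $\mathscr F_{\mathrm h}:M\to\operatorname{End}(V^* )$. Definitions: a foliation is a smooth morphism $\mathscr F:X\to Y$ (leaves = fibers). Given $(L,\nabla)$ flat with trivial monodromy along leaves, $\mathcal D_{\mathscr F}(X,L)$ is the space of half-densities on $Y$ valued in the line bundle of sections of $L$ that are $\nabla$-flat along leaves. (So $\mathcal D_{\mathscr F_{\mathrm v}}(M,L)$ is identified with Schwartz half-densities on $\operatorname{End}(V)$, a function $h$ corresponding to $(\Phi,\Phi^* )=(h(A),h(A)\psi(-\langle A,B\rangle))$, and $\mathcal D_{\mathscr F_{\mathrm h}}(M,L)$ with Schwartz half-densities on $\operatorname{End}(V^* )$.) For two Lagrangian foliations $\mathscr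 F_1,\mathscr F_2$ of a symplectic $X$ with $(L,\nabla)$ of curvature $i\hbar\omega$, each restricting to a foliation on the leaves of the other, the integral of $\varphi\in\mathcal D_{\mathscr F_1}(X,L)$ along the leaves of $\mathscr F_2$ is the element of $\mathcal D_{\mathscr F_2}(X,L)$ with value at $x$ equal to $\int_{\mathscr F_{2,x}/\mathscr F_1}T_{x,z}\varphi(z)|\omega|^{\frac12\dim(\mathscr F_{2,x}/\mathscr F_1)}$, where $\mathscr F_{2,x}$ is the $\mathscr F_2$-leaf through $x$, $T_{x,z}$ is parallel transport, and the product of a transverse half-density for $\mathscr F_1$ with $|\omega\wedge\cdots\wedge\omega|^{1/2}$ is read as a measure on $\mathscr F_{2,x}/\mathscr F_1$ times a transverse half-density for $\mathscr F_2$ via the canonical isomorphism $\det(T/\ell_1)\otimes\det((\ell_1+\ell_2)/(\ell_1\cap\ell_2))=\det(T/\ell_2)\otimes\det(\ell_2/(\ell_1\cap\ell_2))^{\otimes2}$ of tangent data. Reduction: $N$ upper triangular unipotent, $f\in\mathfrak n^*$ the differential of $n\mapsto\sum_in_{i,i+1}$; $M_{-f,f}$ the preimage of $(-f,f)$ under the moment map for the right $N\times N$-action ($A\cdot(n_1,n_2)=n_1^{-1}An_2$, $B\cdot(n_1,n_2)=n_2^{-1}Bn_1$); $w$ the antidiagonal permutation matrix, $A$ diagonal torus, $M^\circ=NwAN\times NAwN$, $M^\circ_{-f,f}=M^\circ\cap M_{-f,f}$, $J^\circ=M^\circ_{-f,f}/(N\times N)\cong A_1\times A_2$ (with $A_1$,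 $A_2$ the images of $NwAN$, $NAwN$ in the double quotients of $\operatorname{End}(V)$, $\operatorname{End}(V^* )$), symplectic, with the descended $(L,\nabla)$ and the Lagrangian foliations $\mathscr G_{\mathrm v}:J^\circ\to A_1$, $\mathscr G_{\mathrm h}:J^\circ\to A_2$. Pushforward $p_{\mathrm v}$: fix a Haar measure $|d\underline n|$ on $N\times N$; for $\varphi\in\mathcal D_{\mathscr F_{\mathrm v}}(M,L)$, integrate $\varphi\cdot|d\underline n|^{1/2}$ over the quotients of the preimages in $M^\circ_{-f,f}$ of the leaves of $\mathscr G_{\mathrm v}$ by $\mathscr F_{\mathrm v}$ (on which $N\times N$-orbits give sections); in coordinates, for $\varphi=\Phi(dg)^{1/2}$ restricted to $\operatorname{GL}_n\subset\operatorname{End}(V)$ this gives $\delta^{1/2}(a)\,O_a(\Phi)\,(da)^{1/2}$ with $O_a(\Phi)=\int_{N\times N}\Phi(n_1wan_2)\psi^{-1}(n_1n_2)dn_1dn_2$, $\delta$ the modular character of the upper Borel; $p_{\mathrm h}$ is defined symmetrically using $\operatorname{GL}_n\subset\operatorname{End}(V^* )$ and $\mathscr G_{\mathrm h}$. All spaces are understood as the images of Schwartz half-densities under these (convergent) integral constructions.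
   Formalization: The form ω∧⋯∧ω is divided by d! (else the two sides differ by a constant for n≥2); transport between components of the disconnected leaves of J° goes through the connected leaves in M_{-f,f}; the integral H_Std over A_1 is iterated, a_n innermost. *)

(* Defs.v *)
From HB Require Import structures.
From mathcomp Require Import all_boot all_order all_algebra.
From mathcomp Require Import all_classical all_reals all_analysis.
From mathcomp Require Import complex.

Set Implicit Arguments.
Unset Strict Implicit.
Unset Printing Implicit Defensive.

Import Order.TTheory GRing.Theory Num.Theory.
Import numFieldNormedType.Exports.
Local Open Scope classical_set_scope.
Local Open Scope ring_scope.
Local Open Scope complex_scope.

Section Integration.
Variable R : realType.

(* The iterated Lebesgue integral
     \int dt_1 \int dt_2 ... \int dt_k F (x + t_1 v_1 + ... + t_k v_k)
   (v_k innermost).  For absolutely convergent integrals this is the integral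
   for the Lebesgue measure dt_1 ... dt_k, in any order of the v_i. *)
Fixpoint iter_int (V : lmodType R) (vs : seq V) (F : V -> R) (x : V) : R :=
  if vs is v :: vs' then
    \int[@lebesgue_measure R]_(t in setT) iter_int vs' F (x + t *: v)
  else F x.

Definition iter_intC (V : lmodType R) (vs : seq V) (F : V -> R[i]) (x : V) :
    R[i] :=
  iter_int vs (fun z => complex.Re (F z)) x
    +i* iter_int vs (fun z => complex.Im (F z)) x.

Definition rV_basis (d : nat) : seq 'rV[R]_d :=
  [seq delta_mx 0 i | i <- enum 'I_d].

(* \int_{Y} F(y) dy_1 ... dy_d for Y \subset R^d, as the iterated integral
   \int dy_1 (\int dy_2 ( ... \int dy_d)). *)
Definition coord_int (d : nat) (Y : set 'rV[R]_d) (F : 'rV[R]_d -> R[i]) :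
    R[i] :=
  iter_intC (rV_basis d) (fun y => if `[< Y y >] then F y else 0) 0.

End Integration.

Section Schwartz.
Variables (R : realType) (n : nat).

Definition iter_partial (s : seq ('I_n * 'I_n)) (f : 'M[R]_n -> R) :
    'M[R]_n -> R :=
  foldr (fun ij g => 'D_(delta_mx ij.1 ij.2) g) f s.

Definition schwartzR (f : 'M[R]_n -> R) : Prop :=
  forall s : seq ('I_n * 'I_n),
    (forall A i j, derivable (iter_partial s f) A (delta_mx i j)) /\
    (forall k : nat, exists K : R, forall A,
       (1 + `|A|) ^+ k * `|iter_partial s f A| <= K).

Definition schwartz (h : 'M[R]_n -> R[i]) : Prop :=
  schwartzR (fun A => complex.Re (h A)) /\
  schwartzR (fun A => complex.Im (h A)).

End Schwartz.

Section Bundle.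
Variables (R : realType) (n : nat) (hbar : R).

Definition phase_space : Type := ('M[R]_n * 'M[R]_n)%type.
Local Notation pt := phase_space.

(* With T_j = A_ij the dual coordinate is T_j^* = B_ji, since
   <A, B> = tr (A B); hence sum_j T_j^* dT_j = tr (B dA) and
   omega_M = sum_j dT_j /\ dT_j^* is the following form. *)
Definition omegaM (v v' : pt) : R :=
  \tr (v.1 *m v'.2) - \tr (v'.1 *m v.2).

(* Sections of L are represented by their component Phi in the first
   trivialization; the other one is Phi^* (A,B) = psi (- <A,B>) Phi (A,B).
   The two formulas for nabla correspond to each other under this change of
   trivialization, so that only nabla = nabla^0 - i hbar tr (B dA) is needed.
   [horizontal gamma u] says that the section u of L along the path gamma is
   nabla-flat, i.e. u' = i hbar tr (B A') u. *)
Definition horizontal (gamma : R -> pt) (u : R -> R[i]) : Prop :=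
  forall t : R,
    let du := (0 +i* (hbar * \tr ((gamma t).2 *m (derive1 gamma t).1))) * u t in
    is_derive t 1 (fun s => complex.Re (u s)) (complex.Re du) /\
    is_derive t 1 (fun s => complex.Im (u s)) (complex.Im du).

Definition C1_path (gamma : R -> pt) : Prop :=
  (forall t : R, derivable gamma t 1) /\
  continuous (derive1 gamma : R -> pt).

(* [is_transport S x z c]: parallel transport from z to x along some path
   contained in S is multiplication by c. *)
Definition is_transport (S : set pt) (x z : pt) (c : R[i]) : Prop :=
  exists gamma : R -> pt, exists u : R -> R[i],
    [/\ C1_path gamma, (forall t : R, 0 <= t <= 1 -> S (gamma t)),
        gamma 0 = z /\ gamma 1 = x, horizontal gamma u &
        u 0 = 1 /\ u 1 = c].

(* T_{x,z}.  It is independent of the path when L is flat with trivial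
   monodromy along S, which is the case for all the leaves below. *)
Definition transport (S : set pt) (x z : pt) : R[i] :=
  xget 0 [set c | is_transport S x z c].

(* [leaf x] is the leaf through x. *)
Definition flat_along (leaf : pt -> set pt) (phi : pt -> R[i]) : Prop :=
  forall x z c, is_transport (leaf x) x z c -> phi x = c * phi z.

End Bundle.

(* Half-densities on an open subset of R^d are written h |dy_1 ... dy_d|^{1/2},
   with |dy_1 ... dy_d| the Lebesgue measure, and represented by h.  Thus an
   element of D_F (X, L) is represented by a function phi : pt -> C, the
   coefficient of |dy|^{1/2}, which is a section of L flat along the leaves. *)

Section LeafIntegral.
Variables (R : realType) (n d : nat) (hbar : R).
Local Notation pt := (phase_space R n).

(* sigma realizes coordinates (y1, y2) on a 2d-dimensional symplectic
   (sub)quotient X of M, by lifting a point of X to M; its symplectic form is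
   sigma^* omega_M. *)
Variable sigma : 'rV[R]_d -> 'rV[R]_d -> pt.

Definition dsigma1 (y1 y2 : 'rV[R]_d) (i : 'I_d) : pt :=
  derive1 (fun t : R => sigma (y1 + t *: delta_mx 0 i) y2) 0.
Definition dsigma2 (y1 y2 : 'rV[R]_d) (i : 'I_d) : pt :=
  derive1 (fun t : R => sigma y1 (y2 + t *: delta_mx 0 i)) 0.

Definition omega_mx (y1 y2 : 'rV[R]_d) : 'M[R]_(d + d) :=
  let e1 := dsigma1 y1 y2 in let e2 := dsigma2 y1 y2 in
  block_mx (\matrix_(i, j) omegaM (e1 i) (e1 j))
           (\matrix_(i, j) omegaM (e1 i) (e2 j))
           (\matrix_(i, j) omegaM (e2 i) (e1 j))
           (\matrix_(i, j) omegaM (e2 i) (e2 j)).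

(* |omega^d / d!| = |Pf (omega_mx)| |dy1| |dy2|, and Pf^2 = det. *)
Definition liouville (y1 y2 : 'rV[R]_d) : R :=
  Num.sqrt `|\det (omega_mx y1 y2)|.

(* The self-dual measure on R for psi (x) = exp (i hbar x) is
   self_dual * (Lebesgue measure). *)
Definition self_dual : R := Num.sqrt (`|hbar| / (2 * pi)).

(* The foliations are F_1 = (y1 : X -> Y1) and F_2 = y2.  As F_1 and F_2 are
   transverse Lagrangian, F_{2,x} / F_1 is the leaf F_{2,x} itself, with
   coordinate y1, and for phi = h |dy1|^{1/2} one has
     phi * |omega|^{d/2}
       = h self_dual^d liouville^{1/2} |dy1|^{1/2} |dy1|^{1/2} |dy2|^{1/2}:
   a measure on the leaf times a transverse half-density for F_2.
   (|omega|^{d/2} is the square root of the measure on X attached to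
   omega^d / d!; that measure involves the self-dual measure 2d times.) *)
Definition leaf_integral (Y1 : set 'rV[R]_d) (leaf2 : pt -> set pt)
    (y2 : pt -> 'rV[R]_d) (phi : pt -> R[i]) (x : pt) :
    R[i] :=
  (self_dual ^+ d)%:C *
  coord_int Y1 (fun y1 =>
    let z := sigma y1 (y2 x) in
    transport hbar (leaf2 x) x z * phi z *
      (Num.sqrt (liouville y1 (y2 x)))%:C).

End LeafIntegral.

Section Setting.
Variables (R : realType) (n : nat) (hbar : R).
Local Notation pt := (phase_space R n).

Definition leaf_Fv (x : pt) : set pt := [set z | z.1 = x.1].
Definition leaf_Fh (x : pt) : set pt := [set z | z.2 = x.2].

Definition D_Fv (phi : pt -> R[i]) : Prop :=
  flat_along hbar leaf_Fv phi /\ schwartz (fun A => phi (A, 0)).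

Definition fourier : (pt -> R[i]) -> pt -> R[i] :=
  @leaf_integral R n (n * n) hbar
    (fun y1 y2 => (vec_mx y1, vec_mx y2)) setT leaf_Fh
    (fun x => mxvec x.2).

Definition strict_upper : set 'M[R]_n :=
  [set X | forall i j : 'I_n, (j <= i)%N -> X i j = 0].

Definition Ngroup : set 'M[R]_n := [set u | strict_upper (u - 1%:M)].

Definition fchar (X : 'M[R]_n) : R :=
  \sum_(i < n) \sum_(j < n | j == i.+1 :> nat) X i j.

Definition act (x : pt) (u : 'M[R]_n * 'M[R]_n) : pt :=
  (invmx u.1 *m x.1 *m u.2, invmx u.2 *m x.2 *m u.1).

(* Contraction of the primitive sum_j T_j^* dT_j = tr (B dA) of -omega_M with
   the vector field generated by (X1, X2), whose A-component is
   - X1 A + A X2. *)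
Definition moment (x : pt) (X1 X2 : 'M[R]_n) : R :=
  \tr (x.2 *m (x.1 *m X2 - X1 *m x.1)).

Definition M_ff : set pt :=
  [set x | forall X1 X2, strict_upper X1 -> strict_upper X2 ->
             moment x X1 X2 = - fchar X1 + fchar X2].

Definition wmx : 'M[R]_n := \matrix_(i, j) (j == rev_ord i)%:R.

Definition torus : set 'rV[R]_n := [set a | forall i, a 0 i != 0].

Definition same_orbit (A A' : 'M[R]_n) : Prop :=
  exists u1 u2, [/\ Ngroup u1, Ngroup u2 & A' = u1 *m A *m u2].

(* The elements w a of NwAN and b w of NAwN. *)
Definition slice_v (a : 'rV[R]_n) : 'M[R]_n := wmx *m diag_mx a.
Definition slice_h (b : 'rV[R]_n) : 'M[R]_n := diag_mx b *m wmx.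

Definition M_circ_ff : set pt :=
  [set x | [/\ M_ff x, (exists2 a, torus a & same_orbit (slice_v a) x.1) &
               (exists2 b, torus b & same_orbit (slice_h b) x.2)]].

(* The coordinates on A_1 and A_2 (unique by the Bruhat decomposition). *)
Definition coord_A1 (A : 'M[R]_n) : 'rV[R]_n :=
  xget 0 [set a | torus a /\ same_orbit (slice_v a) A].
Definition coord_A2 (B : 'M[R]_n) : 'rV[R]_n :=
  xget 0 [set b | torus b /\ same_orbit (slice_h b) B].

(* The lift of the point (a, b) of J^o = A_1 x A_2 to M^o_{-f,f} with first
   component w a; it is unique, as N x N acts simply transitively on
   N w a N. *)
Definition sigma_J (a b : 'rV[R]_n) : pt :=
  xget (0, 0) [set z | [/\ M_ff z, z.1 = slice_v a & same_orbit (slice_h b) z.2]].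

(* L on J^o is the quotient of L on M^o_{-f,f} by parallel transport along the
   N x N-orbits: its sections are the sections over M^o_{-f,f} flat along these
   orbits.  Hence L is treated upstairs, and the leaves of G_v and G_h are
   replaced by their inverse images.  These are taken in M_{-f,f} and not just
   in M^o_{-f,f}: the leaves of J^o have several connected components over the
   real numbers (they are isomorphic to (R^* )^n), but those of M_{-f,f}, of
   which they are dense open subsets, are connected, so that T_{x,z} is defined
   for all z. *)
Definition leaf_Gv (x : pt) : set pt :=
  [set z | M_ff z /\ same_orbit x.1 z.1].
Definition leaf_Gh (x : pt) : set pt :=
  [set z | M_ff z /\ same_orbit x.2 z.2].

Definition H_Std : (pt -> R[i]) -> pt -> R[i] :=
  @leaf_integral R n n hbar sigma_J torus leaf_Gh (fun x => coord_A2 x.2).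

(* At a point A of an orbit, the frame consisting of the vectors tangent to the
   orbit E_ij A and A E_ij (i < j), and of vectors v_i lifting the coordinate
   vectors of the orbit space. *)
Definition orbit_frame (A : 'M[R]_n) (v : 'I_n -> 'M[R]_n) (i j : 'I_n) :
    'M[R]_n :=
  if (i < j)%N then delta_mx i j *m A
  else if (j < i)%N then A *m delta_mx j i
  else v i.

(* The factor jac in |dA| = jac * |dn1 dn2| |da|, at A.  As N x N preserves
   |dA| and the Haar measures, it is enough to compute it at w a, resp. b w. *)
Definition orbit_jac (A : 'M[R]_n) (v : 'I_n -> 'M[R]_n) : R :=
  `|\det (lin_mx (fun X : 'M[R]_n =>
       \sum_(i < n) \sum_(j < n) X i j *: orbit_frame A v i j))|.

Definition jac_v (a : 'rV[R]_n) : R :=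
  orbit_jac (slice_v a) (fun i => slice_v (delta_mx 0 i)).
Definition jac_h (b : 'rV[R]_n) : R :=
  orbit_jac (slice_h b) (fun i => slice_h (delta_mx 0 i)).

(* \int_{N x N} F(n1, n2) for the Haar measure prod dn1_ij prod dn2_ij. *)
Definition upper_basis : seq 'M[R]_n :=
  [seq delta_mx ij.1 ij.2 |
     ij <- enum [pred ij : 'I_n * 'I_n | (ij.1 < ij.2)%N]].

Definition int_NN (F : 'M[R]_n * 'M[R]_n -> R[i]) : R[i] :=
  iter_intC ([seq (E, 0 : 'M[R]_n) | E <- upper_basis] ++
             [seq (0 : 'M[R]_n, E) | E <- upper_basis])
            F (1%:M, 1%:M).

(* The Haar measure on N x N is |dn| = c * prod dn1_ij prod dn2_ij; for
   phi = h |dA|^{1/2} one has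
     phi * |dn|^{1/2} = h (c * jac)^{1/2} (prod dn1_ij prod dn2_ij) |da|^{1/2}:
   a measure on the orbit of A times a half-density on A_1. *)
Variable c : R.

Definition p_v (phi : pt -> R[i]) (x : pt) : R[i] :=
  (Num.sqrt (c * jac_v (coord_A1 x.1)))%:C *
  int_NN (fun u => transport hbar (leaf_Gv x) x (act x u) * phi (act x u)).

Definition p_h (phi : pt -> R[i]) (x : pt) : R[i] :=
  (Num.sqrt (c * jac_h (coord_A2 x.2)))%:C *
  int_NN (fun u => transport hbar (leaf_Gh x) x (act x u) * phi (act x u)).

End Setting.

(* Main.v *)
(* All the parallel transports are explicit: [tr (B dA)] has the primitive [tr (B A)] on the leaves
   of F_h, [f U + f V] on the orbits [A = U w a V] and [tr (B A) - f U - f V] on the orbits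
   [B = U b w V] in M_{-f,f}, where [f] is the sum of the superdiagonal entries.  With these the
   theorem becomes an identity between two iterated integrals,
     int_a psi (- sum a_i b_i + sum 1 / (a_i b_(i+1))) prod |a_i|^(n-1-i)
       int_(U, V) psi (- f U - f V) h (V w a U)
     = sd^(n^2 - n) prod |b_i|^i int_(U, V) psi (f U + f V) hhat (U b w V),
   for the Fourier transform [hhat] of the Schwartz function [h] and the self-dual constant [sd].
   It is proved by induction on [n].  For a fixed first pivot [a], the integral over the first row
   and column defines a Schwartz function of the remaining minor, whose Fourier transform is
   computed with a linear substitution in the row variables and Fourier inversion in the column
   variables; the pivot is integrated last. *)

From HB Require Import structures.
From mathcomp Require Import all_boot all_order all_algebra.
From mathcomp Require Import all_classical all_reals all_analysis.
From mathcomp Require Import measurable_realfun complex ring lra zify.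
Require Import Defs.

Set Implicit Arguments.
Unset Strict Implicit.
Unset Printing Implicit Defensive.

Import Order.TTheory GRing.Theory Num.Theory.
Import numFieldNormedType.Exports.
Local Open Scope classical_set_scope.
Local Open Scope ring_scope.
Local Open Scope complex_scope.

(** * Lebesgue integrals on the line *)

Section DominatedConvergence.
Context d (T : measurableType d) (R : realType) (mu : {measure set T -> \bar R}).

Lemma dominated_cvg_Rintegral (D : set T) (f_ : nat -> T -> R) (f g : T -> R) :
  measurable D -> (forall n, measurable_fun D (f_ n)) ->
  mu.-integrable D (EFin \o g) ->
  (forall n x, D x -> `|f_ n x| <= g x) ->
  (forall x, D x -> f_ n x @[n --> \oo] --> f x) ->
  \int[mu]_(x in D) f_ n x @[n --> \oo] --> \int[mu]_(x in D) f x.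
Proof.
move=> mD mf_ ig f_g f_f.
have mf : measurable_fun D f by exact: measurable_fun_cvg mf_ f_f.
have fg x : D x -> `|f x| <= g x.
  move=> Dx; have cnf : `|f_ n x| @[n --> \oo] --> `|f x| by apply: cvg_norm; exact: f_f.
  rewrite -(cvg_lim (@norm_hausdorff _ _) cnf); apply: limr_le.
    by apply/cvg_ex; exists `|f x|.
  by apply: nearW => n; exact: f_g.
have intf : mu.-integrable D (EFin \o f).
  apply: le_integrable ig => //; first exact/measurable_EFinP.
  by move=> x Dx /=; rewrite lee_fin (le_trans (fg _ Dx))// ler_norm.
apply: fine_cvg; rewrite fineK; last exact: integrable_fin_num.
apply: (@dominated_cvg _ _ _ _ _ mD (fun n => EFin \o f_ n) _ (EFin \o g)) => //.
- by move=> n; exact/measurable_EFinP.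
- by move=> x Dx; apply: cvg_EFin; [exact: nearW|exact: f_f].
Qed.

End DominatedConvergence.

Lemma Rintegral_Fubini d1 d2 (T1 : measurableType d1) (T2 : measurableType d2) (R : realType)
    (m1 : {sigma_finite_measure set T1 -> \bar R})
    (m2 : {sigma_finite_measure set T2 -> \bar R}) (f : T1 -> T2 -> R) :
  (m1 \x m2)%E.-integrable setT (fun p => (f p.1 p.2)%:E) ->
  (forall x, m2.-integrable setT (EFin \o f x)) ->
  (forall y, m1.-integrable setT (EFin \o f ^~ y)) ->
  \int[m1]_x (\int[m2]_y f x y) = \int[m2]_y (\int[m1]_x f x y).
Proof.
move=> intf intf1 intf2.
have inner_r x : (\int[m2]_y f x y)%:E = (\int[m2]_y (f x y)%:E)%E.
  by rewrite /Rintegral fineK//; exact: integrable_fin_num (intf1 x).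
have inner_l y : (\int[m1]_x f x y)%:E = (\int[m1]_x (f x y)%:E)%E.
  by rewrite /Rintegral fineK//; exact: integrable_fin_num (intf2 y).
rewrite /Rintegral; congr fine.
under eq_integral do rewrite inner_r; under [RHS]eq_integral do rewrite inner_l.
exact: Fubini intf.
Qed.

Section MeasurableSeparately.
Variable R : realType.

Lemma cvg_floor_quotient (x : R) :
  (Num.floor (x * m.+1%:R))%:~R / m.+1%:R @[m --> \oo] --> x.
Proof.
apply/cvgrPdist_le => e e0; near=> m.
have m0 : 0 < m.+1%:R :> R by [].
apply: (@le_trans _ _ m.+1%:R^-1).
  rewrite -(ler_pM2r m0) mulVf ?gt_eqF// -[X in _ * X](gtr0_norm m0) -normrM.
  rewrite mulrBl divfK ?gt_eqF//.
  have := floor_itv (x * m.+1%:R); rewrite intrD => /andP[floor_le lt_floor].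
  by rewrite ger0_norm ?subr_ge0// lerBlDl ltW.
by apply/ltW; near: m; exact: near_infty_natSinv_lt (PosNum e0).
Unshelve. all: by end_near. Qed.

Lemma measurable_fun_caratheodory d (T : measurableType d) (f : R -> T -> R) :
  (forall y, continuous (f ^~ y)) -> (forall x, measurable_fun setT (f x)) ->
  measurable_fun setT (fun p : R * T => f p.1 p.2).
Proof.
move=> cf mf; pose q (m : nat) (x : R) : R := (Num.floor (x * m.+1%:R))%:~R / m.+1%:R.
apply: (@measurable_fun_cvg _ _ _ _ (fun m p => f (q m p.1) p.2)); last first.
  move=> [x y] _ /=; apply: (@continuous_cvg _ _ _ _ _ _ (f ^~ y)); first exact: cf.
  exact: cvg_floor_quotient.
move=> m _ Y mY; rewrite setTI.
have -> : (fun p : R * T => f (q m p.1) p.2) @^-1` Y =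
    \bigcup_(k : int) (((fun x : R => Num.floor (x * m.+1%:R)) @^-1` [set k]) `*`
        (f (k%:~R / m.+1%:R) @^-1` Y)).
  apply/seteqP; split=> [[x y] /= fY|[x y] [k _ /= [<- //]]].
  by exists (Num.floor (x * m.+1%:R)).
apply: countable_bigcupT_measurable => // k; apply: measurableX; last first.
  by rewrite -[_ @^-1` _]setTI; exact: mf.
have -> : (fun x : R => Num.floor (x * m.+1%:R)) @^-1` [set k] =
    `[k%:~R / m.+1%:R, (k + 1)%:~R / m.+1%:R[%classic.
  apply/seteqP; split=> x /=; rewrite in_itv /= ler_pdivrMr// ltr_pdivlMr//.
    by move=> <-; exact: floor_itv.
  by move=> xk; exact: floor_def.
exact: measurable_itv.
Qed.

End MeasurableSeparately.

Section LebesgueIntegral.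
Variable R : realType.
Local Notation mu := (@lebesgue_measure R).
Implicit Types (f g F : R -> R) (a c d t : R).

Lemma continuous_affine c d : continuous (fun t => c * t + d).
Proof.
by move=> t; apply: cvgD; [apply: cvgM; [exact: cvg_cst|exact: cvg_id]|exact: cvg_cst].
Qed.

Lemma measurable_affine c d : measurable_fun setT (fun t => c * t + d).
Proof. by apply: continuous_measurable_fun; exact: continuous_affine. Qed.

Lemma lebesgue_measure_affine c d (A : set R) : c != 0 -> measurable A ->
  (`|c|%:E * mu ((fun t => (c * t + d)%R) @^-1` A) = mu A)%E.
Proof.
move=> c0 mA.
pose phi : measurableTypeR R -> measurableTypeR R := fun t => c * t + d.
have mphi : measurable_fun setT phi by exact: measurable_affine.
pose phi_mfun : {mfun measurableTypeR R >-> measurableTypeR R} :=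
  HB.pack phi (isMeasurableFun.Build _ _ _ _ phi mphi).
rewrite [RHS](@lebesgue_measure_unique R
  (mscale (NngNum (normr_ge0 c)) (pushforward mu phi_mfun)))//= => _ [[a b] _ <-].
rewrite /mscale/= /pushforward/=.
have cV t : c * (t / c) = t by rewrite mulrC divfK.
have [c_gt0|c_lt0] := ltrP 0 c.
  have -> : phi @^-1` `]a, b]%classic = `](a - d) / c, (b - d) / c]%classic.
    apply/seteqP; split=> t /=; rewrite !in_itv /= /phi.
      by rewrite ltr_pdivrMr// ler_pdivlMr// ltrBlDr lerBrDr mulrC.
    by rewrite ltr_pdivrMr// ler_pdivlMr// ltrBlDr lerBrDr mulrC.
  rewrite !lebesgue_measure_itv/= !lte_fin ltr_pM2r ?invr_gt0// ltrD2r.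
  case: ifP => _; last by rewrite mule0.
  by rewrite gtr0_norm// -EFinB -EFinM -mulrBl cV opprB addrA subrK.
have {c_lt0}c_lt0 : c < 0 by rewrite lt_neqAle c0.
have -> : phi @^-1` `]a, b]%classic = `[(b - d) / c, (a - d) / c[%classic.
  apply/seteqP; split=> t /=; rewrite !in_itv /= /phi => /andP[].
    by rewrite ler_ndivrMr// ltr_ndivlMr// ltrBlDr lerBrDr mulrC => -> ->.
  by rewrite ler_ndivrMr// ltr_ndivlMr// ltrBlDr lerBrDr mulrC => -> ->.
rewrite !lebesgue_measure_itv/= !lte_fin ltr_nM2r ?invr_lt0// ltrD2r.
case: ifP => _; last by rewrite mule0.
by rewrite ltr0_norm// -EFinB -EFinM -mulrBl mulNr cV !opprB addrA subrK.
Qed.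

Lemma ge0_integral_affine c d (f : R -> \bar R) : c != 0 -> measurable_fun setT f ->
  (forall t, (0 <= f t)%E) ->
  (`|c|%:E * \int[mu]_t f (c * t + d)%R = \int[mu]_t f t)%E.
Proof.
move=> c0 mf f0.
pose phi : measurableTypeR R -> measurableTypeR R := fun t => c * t + d.
have mphi : measurable_fun setT phi by exact: measurable_affine.
pose phi_mfun : {mfun measurableTypeR R >-> measurableTypeR R} :=
  HB.pack phi (isMeasurableFun.Build _ _ _ _ phi mphi).
rewrite [RHS](eq_measure_integral (mscale (NngNum (normr_ge0 c)) (pushforward mu phi_mfun))).
  by rewrite ge0_integral_mscale//= ge0_integral_pushforward.
by move=> A mA _; rewrite /mscale/= -(lebesgue_measure_affine d c0 mA).
Qed.

Lemma Rintegral_affine c d f : c != 0 -> mu.-integrable setT (EFin \o f) ->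
  `|c| * \int[mu]_t f (c * t + d) = \int[mu]_t f t.
Proof.
move=> c0 intf; have /integrableP[mf _] := intf; rewrite /Rintegral.
have nc0 : (0 < `|c|%:E)%E by rewrite lte_fin normr_gt0.
have affineE (g : R -> \bar R) : mu.-integrable setT g -> measurable_fun setT g ->
    (forall t, (0 <= g t)%E) -> (\int[mu]_t g (c * t + d)%R)%E \is a fin_num /\
    `|c| * fine (\int[mu]_t g (c * t + d)%R)%E = fine (\int[mu]_t g t)%E.
  move=> ig mg g0; have affine_g := ge0_integral_affine d c0 mg g0.
  have gfin : (\int[mu]_t g (c * t + d)%R)%E \is a fin_num.
    move: (integrable_fin_num measurableT ig); rewrite -affine_g.
    by case: (\int[mu]_t _)%E => //; rewrite ?(gt0_muley nc0) ?(gt0_muleNy nc0).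
  by split=> //; rewrite -affine_g fineM.
have [intp intn] := (integrable_funepos measurableT intf, integrable_funeneg measurableT intf).
have [pfin pE] := affineE _ intp (measurable_funepos mf) (funepos_ge0 _).
have [nfin nE] := affineE _ intn (measurable_funeneg mf) (funeneg_ge0 _).
rewrite integralE [in RHS]integralE [in RHS]fineB ?integrable_fin_num//.
rewrite -pE -nE -mulrBr -fineB//; congr (_ * fine (_ - _)); apply: eq_integral => t _.
  by rewrite !funeposE.
by rewrite !funenegE.
Qed.

Lemma Rintegral_split0 f : mu.-integrable setT (EFin \o f) ->
  \int[mu]_t f t = \int[mu]_(t in `[0, +oo[) f t + \int[mu]_(t in `[0, +oo[) f (- t).
Proof.
move=> intf.
have intfS (A : set R) : measurable A -> mu.-integrable A (EFin \o f).
  by move=> mA; exact: integrableS intf.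
have -> : \int[mu]_(t in `[0, +oo[) f (- t) = \int[mu]_(t in `]-oo, 0]) f t.
  rewrite [LHS]Rintegral_mkcond [RHS]Rintegral_mkcond.
  rewrite -[RHS](@Rintegral_affine (-1) 0) ?oppr_eq0 ?oner_eq0//.
    rewrite normrN1 mul1r; apply: eq_Rintegral => t _; rewrite !patchE mulN1r addr0.
    by rewrite !mem_setE !in_itv /= oppr_le0 andbT.
  have := intfS _ (measurable_itv `]-oo, 0]); rewrite integrable_mkcond//.
  by rewrite restrict_EFin.
rewrite -Rintegral_itv_obnd_cbnd; last exact: intfS.
have := @Rintegral_itvB R f -oo%O +oo%O 0; rewrite set_itvNyy => /(_ intf isT isT) <-.
by rewrite subrK.
Qed.

Lemma Rintegral_even f : mu.-integrable setT (EFin \o f) -> (forall t, f (- t) = f t) ->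
  \int[mu]_t f t = 2 * \int[mu]_(t in `[0, +oo[) f t.
Proof.
move=> intf evenf; rewrite Rintegral_split0// mulr_natl mulr2n; congr (_ + _).
by apply: eq_Rintegral => t _.
Qed.

Lemma Rintegral_odd f : mu.-integrable setT (EFin \o f) -> (forall t, f (- t) = - f t) ->
  \int[mu]_t f t = 0.
Proof.
move=> intf oddf; have := @Rintegral_affine (-1) 0 f.
rewrite oppr_eq0 oner_eq0 normrN1 mul1r => /(_ isT intf).
under eq_Rintegral do rewrite mulN1r addr0 oddf -mulN1r.
rewrite RintegralZl// mulN1r => /eqP.
by rewrite eq_sym -addr_eq0 -mulr2n mulrn_eq0 /= => /eqP.
Qed.

Lemma Rintegral_FTC2 f F a b : a <= b -> continuous f ->
  (forall t, is_derive t 1 F (f t)) -> \int[mu]_(t in `[a, b]) f t = F b - F a.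
Proof.
rewrite le_eqVlt => /predU1P[-> _ _|ab cf dF]; first by rewrite set_itv1 Rintegral_set1 subrr.
have cF : continuous F.
  by move=> t; apply/differentiable_continuous/derivable1_diffP; case: (dF t).
rewrite /Rintegral (@continuous_FTC2 _ f F)//.
- exact: continuous_subspaceT.
- split; first by move=> t _; case: (dF t).
  + by apply: cvg_at_right_filter; exact: cF.
  + by apply: cvg_at_left_filter; exact: cF.
- by move=> t _; rewrite derive1E; exact: derive_val.
Qed.

Lemma Rintegral_FTC2y f F l : mu.-integrable `[0, +oo[ (EFin \o f) -> continuous f ->
  (forall t, is_derive t 1 F (f t)) -> F t @[t --> +oo] --> l ->
  \int[mu]_(t in `[0, +oo[) f t = l - F 0.
Proof.
move=> intf cf dF Fl.
pose f_ (m : nat) := f \_ `[0, m%:R].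
have f_cvg : \int[mu]_(t in `[0, +oo[) f_ m t @[m --> \oo] --> \int[mu]_(t in `[0, +oo[) f t.
  apply: (@dominated_cvg_Rintegral _ _ _ mu _ f_ f (fun t => `|f t|)) => //.
  - move=> m; apply: measurable_funTS; apply/(measurable_restrict _ _ _).1 => //.
    by apply: measurable_funTS; exact: continuous_measurable_fun.
  - exact: integrable_norm intf.
  - by move=> m t _; rewrite /f_ patchE; case: ifPn => _; rewrite ?normr0.
  - move=> t /=; rewrite in_itv/= andbT => t0; apply: cvg_near_cst.
    apply: filterS (nbhs_infty_ger t) => m tm; rewrite /f_ patchE ifT//.
    by rewrite inE/= in_itv/= t0.
have f_E m : \int[mu]_(t in `[0, +oo[) f_ m t = F m%:R - F 0.
  rewrite -(Rintegral_FTC2 _ cf dF)// -Rintegral_mkcondr; congr (Rintegral _ _ _).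
  apply/seteqP; split=> t /=; rewrite !in_itv/= ?andbT; first by case.
  by move=> /andP[-> ->].
apply: (cvg_unique _ f_cvg) => /=; first exact: norm_hausdorff.
rewrite (eq_cvg _ _ f_E); apply: cvgB; last exact: cvg_cst.
exact: cvg_comp cvgr_idn Fl.
Qed.

End LebesgueIntegral.

Section QuadraticDecay.
Variable R : realType.
Local Notation mu := (@lebesgue_measure R).
Implicit Types (f : R -> R) (K t : R).

Definition quad_decay K f :=
  continuous f /\ forall t, `|f t| <= K * (oneDsqr t)^-1.

Lemma oneDsqr_gt0 t : 0 < oneDsqr t.
Proof. exact: lt_le_trans (oneDsqr_ge1 t). Qed.

Lemma oneDsqrV_ge0 t : 0 <= (oneDsqr t)^-1.
Proof. by rewrite invr_ge0 ltW// oneDsqr_gt0. Qed.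

Lemma integral_oneDsqrV : (\int[mu]_t ((oneDsqr t)^-1)%:E = (pi : R)%:E)%E.
Proof.
rewrite ge0_symfun_integralT; last 3 first.
- by move=> t; exact: oneDsqrV_ge0.
- by move=> t; exact: continuous_oneDsqrV.
- by move=> t /=; rewrite /oneDsqr sqrrN.
by rewrite -set_itvcy integral0y_oneDsqr -EFinM mulrC divfK.
Qed.

Lemma integrable_oneDsqrV K : mu.-integrable setT (EFin \o (fun t => K * (oneDsqr t)^-1)).
Proof.
have -> : EFin \o (fun t : R => K * (oneDsqr t)^-1) =
    (fun t => K%:E * ((oneDsqr t)^-1)%:E)%E by apply/funext => t; rewrite /= EFinM.
apply: integrableZl => //; apply/integrableP; split.
  apply/measurable_EFinP; apply: continuous_measurable_fun => t.
  exact: continuous_oneDsqrV.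
under eq_integral do rewrite gee0_abs ?lee_fin ?oneDsqrV_ge0//.
by rewrite integral_oneDsqrV ltry.
Qed.

Lemma Rintegral_oneDsqrV K : \int[mu]_t (K * (oneDsqr t)^-1) = K * pi.
Proof.
rewrite RintegralZl//; first by rewrite /Rintegral integral_oneDsqrV.
have := integrable_oneDsqrV 1; apply: eq_integrable => // t _ /=.
by rewrite mul1r.
Qed.

Lemma integrable_quad_decay K f : quad_decay K f -> mu.-integrable setT (EFin \o f).
Proof.
move=> [cf fK]; apply: (le_integrable measurableT _ _ (integrable_oneDsqrV K)).
  by apply/measurable_EFinP; exact: continuous_measurable_fun.
by move=> t _ /=; rewrite lee_fin (le_trans (fK t))// ler_norm.
Qed.

Lemma normr_Rintegral_quad_decay K f : quad_decay K f -> `|\int[mu]_t f t| <= K * pi.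
Proof.
move=> Kf; have intf := integrable_quad_decay Kf.
apply: le_trans (le_normr_Rintegral measurableT intf) _.
rewrite -Rintegral_oneDsqrV; apply: le_Rintegral => //.
- exact: integrable_norm intf.
- exact: integrable_oneDsqrV.
- by move=> t _; exact: Kf.2.
Qed.

Lemma cvg_Rintegral_quad_decay K (f_ : nat -> R -> R) f :
  (forall n, quad_decay K (f_ n)) -> (forall t, f_ n t @[n --> \oo] --> f t) ->
  \int[mu]_t f_ n t @[n --> \oo] --> \int[mu]_t f t.
Proof.
move=> Kf f_f; apply: (@dominated_cvg_Rintegral _ _ _ mu _ f_ f _ measurableT) => //.
- by move=> n; apply: continuous_measurable_fun; exact: (Kf n).1.
- exact: integrable_oneDsqrV K.
- by move=> n t _; exact: (Kf n).2.
Qed.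

Lemma Rintegral_Fubini_quad_decay (f : R -> R -> R) K :
  (forall y, continuous (f ^~ y)) -> (forall x, continuous (f x)) ->
  (forall x y, `|f x y| <= K * (oneDsqr x)^-1 * (oneDsqr y)^-1) ->
  \int[mu]_x (\int[mu]_y f x y) = \int[mu]_y (\int[mu]_x f x y).
Proof.
move=> cx cy fK.
have decay_l x : quad_decay (K * (oneDsqr x)^-1) (f x) by split.
have decay_r y : quad_decay (K * (oneDsqr y)^-1) (f ^~ y).
  by split=> // x; rewrite mulrAC.
apply: (@Rintegral_Fubini _ _ _ _ R mu mu f); last 2 first.
- by move=> x; exact: integrable_quad_decay (decay_l x).
- by move=> y; exact: integrable_quad_decay (decay_r y).
have mf : measurable_fun setT (fun p : R * R => f p.1 p.2).
  by apply: measurable_fun_caratheodory => // x; exact: continuous_measurable_fun.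
apply/integrable12ltyP; first exact/measurable_EFinP.
apply: le_lt_trans (integrable_lty measurableT (integrable_oneDsqrV (K * pi))).
apply: ge0_le_integral => //.
- by move=> x _; apply: integral_ge0.
- apply: (@measurable_fun_fubini_tonelli_F _ _ _ _ R mu
     (fun p : R * R => (`|f p.1 p.2|)%:E)) => //.
  by apply/measurable_EFinP; apply: measurableT_comp.
- exact: measurable_int (integrable_oneDsqrV (K * pi)).
move=> x _ /=; have decay_norm : quad_decay (K * (oneDsqr x)^-1) (fun y => `|f x y|).
  by split=> [y|t]; [apply: cvg_norm; exact: cy|rewrite normr_id].
rewrite [leLHS](_ : _ = (\int[mu]_y `|f x y|)%:E); last first.
  by rewrite /Rintegral fineK// integrable_fin_num//; exact: integrable_quad_decay decay_norm.
rewrite lee_fin mulrAC (le_trans (ler_norm _))//.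
exact: normr_Rintegral_quad_decay decay_norm.
Qed.

Lemma quad_decay_cvg0_pinfty K f :
  (forall t, 0 <= t -> `|f t| <= K * (oneDsqr t)^-1) -> f t @[t --> +oo] --> 0.
Proof.
move=> fK; apply/cvgrPdist_le => e e0.
apply: filterS2 (nbhs_pinfty_ge (num_real 1)) (nbhs_pinfty_ge (num_real (K / e))).
move=> t t1 tK; rewrite sub0r normrN (le_trans (fK _ _))//; first exact: le_trans t1.
rewrite ler_pdivrMr ?oneDsqr_gt0//; move: tK; rewrite ler_pdivrMr// => tK.
apply: le_trans tK _; rewrite mulrC ler_wpM2l ?(ltW e0)// /oneDsqr.
nra.
Qed.

Lemma Rintegral_derive_quad_decay K L f F : quad_decay K f ->
  (forall t, is_derive t 1 F (f t)) -> (forall t, `|F t| <= L * (oneDsqr t)^-1) ->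
  \int[mu]_t f t = 0.
Proof.
move=> Kf dF FL; have intf := integrable_quad_decay Kf.
have Nf : quad_decay K (fun t => f (- t)).
  split=> t; last by have := Kf.2 (- t); rewrite /oneDsqr sqrrN.
  by apply: continuous_comp; [exact: opp_continuous|exact: Kf.1].
have dNF (t : R) : is_derive t 1 (fun t => - F (- t)) (f (- t)).
  have ? := dF (- t).
  apply: (is_derive_eq (is_deriveN (is_derive1_comp (dF (- t)) (is_deriveN (is_derive_id _ _))))).
  by rewrite mulrN1 opprK.
rewrite Rintegral_split0// (Rintegral_FTC2y _ Kf.1 dF (l := 0)); last 2 first.
- exact: integrableS intf.
- by apply: (@quad_decay_cvg0_pinfty L) => t _.
rewrite (Rintegral_FTC2y _ Nf.1 dNF (l := 0)).
- by rewrite oppr0 !sub0r opprK addNr.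
- exact: integrableS (integrable_quad_decay Nf).
apply: (@quad_decay_cvg0_pinfty L) => t _.
by rewrite normrN; have := FL (- t); rewrite /oneDsqr sqrrN.
Qed.

End QuadraticDecay.

(** * Complex integrals and one-dimensional Fourier inversion *)

Section ComplexIntegral.
Variable R : realType.
Local Notation mu := (@lebesgue_measure R).
Local Notation C := R[i].
Local Notation Re := complex.Re.
Local Notation Im := complex.Im.

Lemma ReM (x y : C) : Re (x * y) = Re x * Re y - Im x * Im y.
Proof. by case: x y => [a b] [c d]. Qed.

Lemma ImM (x y : C) : Im (x * y) = Re x * Im y + Im x * Re y.
Proof. by case: x y => [a b] [c d]. Qed.

Lemma ReD (x y : C) : Re (x + y) = Re x + Re y.
Proof. by case: x y => [a b] [c d]. Qed.

Lemma ImD (x y : C) : Im (x + y) = Im x + Im y.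
Proof. by case: x y => [a b] [c d]. Qed.

Lemma eq_ReIm (x y : C) : Re x = Re y -> Im x = Im y -> x = y.
Proof. by case: x y => [a b] [c d] /= -> ->. Qed.

Definition norm1 (z : C) : R := `|Re z| + `|Im z|.

Lemma norm1_ge0 z : 0 <= norm1 z. Proof. by rewrite addr_ge0. Qed.

Lemma Re_le_norm1 z : `|Re z| <= norm1 z. Proof. by rewrite lerDl. Qed.

Lemma Im_le_norm1 z : `|Im z| <= norm1 z. Proof. by rewrite lerDr. Qed.

Lemma norm1M_le x y : norm1 (x * y) <= norm1 x * norm1 y.
Proof.
rewrite /norm1 ReM ImM mulrDl !mulrDr -!normrM.
apply: le_trans (lerD (ler_normB _ _) (ler_normD _ _)) _.
by rewrite le_eqVlt; apply/orP; left; apply/eqP; ring.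
Qed.

Lemma norm1_real (x : R) : norm1 x%:C = `|x|.
Proof. by rewrite /norm1 /= normr0 addr0. Qed.

Definition ccvg (u : nat -> C) (z : C) : Prop :=
  (Re (u n) @[n --> \oo] --> Re z) /\ (Im (u n) @[n --> \oo] --> Im z).

Lemma ccvg_cst z : ccvg (fun=> z) z.
Proof. by split; exact: cvg_cst. Qed.

Lemma ccvg_unique u z z' : ccvg u z -> ccvg u z' -> z = z'.
Proof.
by move=> [r i] [r' i']; apply: eq_ReIm;
  [apply: cvg_unique r r'|apply: cvg_unique i i']; exact: norm_hausdorff.
Qed.

Lemma ccvgM u v z z' : ccvg u z -> ccvg v z' -> ccvg (fun n => u n * v n) (z * z').
Proof.
move=> [r i] [r' i']; split; rewrite ?ReM ?ImM.
  by under eq_cvg do rewrite ReM; apply: cvgB; apply: cvgM.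
by under eq_cvg do rewrite ImM; apply: cvgD; apply: cvgM.
Qed.

Lemma ccvg_real (u : nat -> R) (l : R) : u n @[n --> \oo] --> l ->
  ccvg (fun n => (u n)%:C) l%:C.
Proof. by move=> ul; split => //=; exact: cvg_cst. Qed.

Definition ccontinuous (f : R -> C) : Prop :=
  continuous (fun t => Re (f t)) /\ continuous (fun t => Im (f t)).

Lemma ccontinuous_cst z : ccontinuous (fun=> z).
Proof. by split=> t; exact: cvg_cst. Qed.

Lemma ccontinuous_real (g : R -> R) : continuous g -> ccontinuous (fun t => (g t)%:C).
Proof. by move=> cg; split=> //= t; exact: cvg_cst. Qed.

Lemma ccontinuousM f g : ccontinuous f -> ccontinuous g -> ccontinuous (fun t => f t * g t).
Proof.
move=> [fr fi] [gr gi]; split.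
  under [X in continuous X]eq_fun do rewrite ReM.
  by move=> t; apply: cvgB; apply: cvgM; [apply: fr|apply: gr|apply: fi|apply: gi].
under [X in continuous X]eq_fun do rewrite ImM.
by move=> t; apply: cvgD; apply: cvgM; [apply: fr|apply: gi|apply: fi|apply: gr].
Qed.

Lemma ccontinuousD f g : ccontinuous f -> ccontinuous g -> ccontinuous (fun t => f t + g t).
Proof.
move=> [fr fi] [gr gi]; split.
  under [X in continuous X]eq_fun do rewrite ReD.
  by move=> t; apply: cvgD; [apply: fr|apply: gr].
under [X in continuous X]eq_fun do rewrite ImD.
by move=> t; apply: cvgD; [apply: fi|apply: gi].
Qed.

Lemma ccontinuous_comp f (g : R -> R) : ccontinuous f -> continuous g ->
  ccontinuous (fun t => f (g t)).
Proof.
move=> [fr fi] cg; split=> t; first exact: (continuous_comp (cg t) (fr (g t))).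
exact: (continuous_comp (cg t) (fi (g t))).
Qed.

Lemma ccontinuous_ccvg f (u : nat -> R) (l : R) : ccontinuous f ->
  u n @[n --> \oo] --> l -> ccvg (fun n => f (u n)) (f l).
Proof.
move=> [fr fi] ul; split.
  by apply: (@continuous_cvg _ _ _ _ _ _ (fun t => Re (f t))) => //; exact: fr.
by apply: (@continuous_cvg _ _ _ _ _ _ (fun t => Im (f t))) => //; exact: fi.
Qed.

Definition cquad_decay (K : R) (f : R -> C) :=
  ccontinuous f /\ forall t, norm1 (f t) <= K * (oneDsqr t)^-1.

Lemma cquad_decay_Re K f : cquad_decay K f -> quad_decay K (fun t => Re (f t)).
Proof. by move=> [[cr _] fK]; split=> // t; exact: le_trans (Re_le_norm1 _) (fK t). Qed.

Lemma cquad_decay_Im K f : cquad_decay K f -> quad_decay K (fun t => Im (f t)).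
Proof. by move=> [[_ ci] fK]; split=> // t; exact: le_trans (Im_le_norm1 _) (fK t). Qed.

Lemma cquad_decay_ge0 K f : cquad_decay K f -> 0 <= K.
Proof.
move=> [_ fK]; have := le_trans (norm1_ge0 _) (fK 0).
by rewrite /oneDsqr expr0n/= addr0 invr1 mulr1.
Qed.

Lemma norm1_cquad_decay_le K f t : cquad_decay K f -> norm1 (f t) <= K.
Proof.
move=> Kf; have K0 := cquad_decay_ge0 Kf; case: Kf => _ fK.
by apply: le_trans (fK t) _; rewrite ler_piMr// oneDsqrV_le1.
Qed.

Lemma cquad_decayM K (f g : R -> C) (B : R) : cquad_decay K f -> ccontinuous g ->
  (forall t, norm1 (g t) <= B) -> cquad_decay (B * K) (fun t => g t * f t).
Proof.
move=> [cf fK] cg gB; split=> [|t]; first exact: ccontinuousM.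
by apply: le_trans (norm1M_le _ _) _; rewrite -mulrA ler_pM// norm1_ge0.
Qed.

Lemma cquad_decayZ K (c : C) f : cquad_decay K f ->
  cquad_decay (norm1 c * K) (fun t => c * f t).
Proof. by move=> Kf; apply: cquad_decayM => //; exact: ccontinuous_cst. Qed.

Lemma cquad_decayD K L f g : cquad_decay K f -> cquad_decay L g ->
  cquad_decay (K + L) (fun t => f t + g t).
Proof.
move=> [cf fK] [cg gL]; split=> [|t]; first exact: ccontinuousD.
rewrite mulrDl; apply: le_trans (lerD (fK t) (gL t)).
by rewrite /norm1 ReD ImD addrACA lerD// ler_normD.
Qed.

Definition cint (f : R -> C) : C :=
  (\int[mu]_t Re (f t)) +i* (\int[mu]_t Im (f t)).

Lemma eq_cint f g : f =1 g -> cint f = cint g.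
Proof. by move=> /funext ->. Qed.

Lemma norm1_cint_le K f : cquad_decay K f -> norm1 (cint f) <= K * (2 * pi).
Proof.
move=> Kf; rewrite /norm1 /= mulrCA mulr2n mulrDl mul1r.
by apply: lerD; apply: normr_Rintegral_quad_decay; [exact: cquad_decay_Re|exact: cquad_decay_Im].
Qed.

Lemma ccvg_cint K (f_ : nat -> R -> C) f : (forall n, cquad_decay K (f_ n)) ->
  (forall t, ccvg (f_ ^~ t) (f t)) -> ccvg (fun n => cint (f_ n)) (cint f).
Proof.
move=> Kf_ f_f; split; apply: (@cvg_Rintegral_quad_decay _ K) => [n|t].
- exact: cquad_decay_Re.
- exact: (f_f t).1.
- exact: cquad_decay_Im.
- exact: (f_f t).2.
Qed.

Lemma cintD K L f g : cquad_decay K f -> cquad_decay L g ->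
  cint (fun t => f t + g t) = cint f + cint g.
Proof.
move=> Kf Lg; apply: eq_ReIm; rewrite ?ReD ?ImD /=.
  under eq_Rintegral do rewrite ReD.
  by rewrite RintegralD//; [exact: integrable_quad_decay (cquad_decay_Re Kf)|
    exact: integrable_quad_decay (cquad_decay_Re Lg)].
under eq_Rintegral do rewrite ImD.
by rewrite RintegralD//; [exact: integrable_quad_decay (cquad_decay_Im Kf)|
  exact: integrable_quad_decay (cquad_decay_Im Lg)].
Qed.

Lemma cintZ K (c : C) f : cquad_decay K f -> cint (fun t => c * f t) = c * cint f.
Proof.
move=> Kf; have intr := integrable_quad_decay (cquad_decay_Re Kf).
have inti := integrable_quad_decay (cquad_decay_Im Kf).
have intZ (k : R) (g : R -> R) : mu.-integrable setT (EFin \o g) ->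
    mu.-integrable setT (EFin \o (fun t => k * g t)).
  move=> ig; have := integrableZl measurableT k ig.
  by apply: eq_integrable => // t _ /=; rewrite EFinM.
apply: eq_ReIm; rewrite ?ReM ?ImM /=.
  under eq_Rintegral do rewrite ReM.
  by rewrite RintegralB ?RintegralZl//; exact: intZ.
under eq_Rintegral do rewrite ImM.
by rewrite RintegralD ?RintegralZl//; exact: intZ.
Qed.

Lemma cint_affine K f (c d : R) : c != 0 -> cquad_decay K f ->
  `|c|%:C * cint (fun t => f (c * t + d)) = cint f.
Proof.
move=> c0 Kf; apply: eq_ReIm; rewrite ?ReM ?ImM /= mul0r ?subr0 ?addr0.
  apply: (Rintegral_affine (f := fun t => Re (f t)) d c0).
  exact: integrable_quad_decay (cquad_decay_Re Kf).
apply: (Rintegral_affine (f := fun t => Im (f t)) d c0).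
exact: integrable_quad_decay (cquad_decay_Im Kf).
Qed.

Lemma cint_Fubini (f : R -> R -> C) K :
  (forall y, ccontinuous (f ^~ y)) -> (forall x, ccontinuous (f x)) ->
  (forall x y, norm1 (f x y) <= K * (oneDsqr x)^-1 * (oneDsqr y)^-1) ->
  cint (fun x => cint (f x)) = cint (fun y => cint (f ^~ y)).
Proof.
move=> cx cy fK; apply: eq_ReIm => /=.
  apply: (@Rintegral_Fubini_quad_decay _ (fun x y => Re (f x y)) K) => [y|x|x y].
  - by case: (cx y).
  - by case: (cy x).
  - exact: le_trans (Re_le_norm1 _) (fK x y).
apply: (@Rintegral_Fubini_quad_decay _ (fun x y => Im (f x y)) K) => [y|x|x y].
- by case: (cx y).
- by case: (cy x).
- exact: le_trans (Im_le_norm1 _) (fK x y).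
Qed.

Lemma eq_Rintegral_neq (a : R) (f g : R -> R) : continuous g ->
  (forall t, t != a -> f t = g t) -> \int[mu]_t f t = \int[mu]_t g t.
Proof.
move=> cg fg; rewrite /Rintegral; congr fine.
have mg : measurable_fun setT g by exact: continuous_measurable_fun.
have fE : f = (fun t => if t == a then f a else g t).
  by apply/funext => t; case: eqP => [->//|/eqP ta]; exact: fg.
apply: ae_eq_integral => //.
- apply/measurable_EFinP; rewrite fE; apply: measurable_fun_if => //.
    apply: (measurable_fun_bool true); rewrite setTI.
    rewrite [X in measurable X](_ : _ = [set a]) ?measurable_set1//.
    by apply/seteqP; split => t /= /eqP.
  exact: measurable_funTS.
- exact/measurable_EFinP.
exists [set a]; split; [exact: measurable_set1|exact: lebesgue_measure_set1|].
move=> t /= ft; apply: contrapT => /eqP ta; apply: ft => _.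
by rewrite /= fg.
Qed.

Lemma eq_cint_neq (a : R) (f g : R -> C) : ccontinuous g ->
  (forall t, t != a -> f t = g t) -> cint f = cint g.
Proof.
by move=> [cr ci] fg; apply: eq_ReIm => /=; apply: (@eq_Rintegral_neq a) => // t ta; rewrite fg.
Qed.

Lemma cint_oneDsqrV (z : C) :
  cint (fun t => z * ((oneDsqr t)^-1)%:C) = z * (pi : R)%:C.
Proof.
apply: eq_ReIm; rewrite ?ReM ?ImM /= mulr0 ?subr0 ?add0r.
  by under eq_Rintegral do rewrite ReM /= mulr0 subr0; exact: Rintegral_oneDsqrV.
by under eq_Rintegral do rewrite ImM /= mulr0 add0r; exact: Rintegral_oneDsqrV.
Qed.

End ComplexIntegral.

Section FourierInversion.
Variables (R : realType) (hbar : R).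
Local Notation mu := (@lebesgue_measure R).
Local Notation C := R[i].

Definition psi (x : R) : C := cos (hbar * x) +i* sin (hbar * x).

Lemma psiD x y : psi (x + y) = psi x * psi y.
Proof. by apply: eq_ReIm; rewrite ?ReM ?ImM /= mulrDr ?cosD// sinD; ring. Qed.

Lemma psi0 : psi 0 = 1.
Proof. by rewrite /psi mulr0 cos0 sin0. Qed.

Lemma psi_mulN x : psi x * psi (- x) = 1.
Proof. by rewrite -psiD subrr psi0. Qed.

Lemma norm1_psi_le2 x : norm1 (psi x) <= 2.
Proof. by rewrite lerD ?cos_max ?sin_max. Qed.

Lemma ccontinuous_psi (c : R) : ccontinuous (fun t => psi (c * t)).
Proof.
have ch (t : R) : {for t, continuous (fun t => hbar * (c * t))}.
  by apply: cvgM; [exact: cvg_cst|apply: cvgM; [exact: cvg_cst|exact: cvg_id]].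
split=> t /=; apply: continuous_comp; [exact: ch|exact: continuous_cos|exact: ch|].
exact: continuous_sin.
Qed.

Lemma cquad_decay_dilate K (f : R -> C) (c d : R) : cquad_decay K f ->
  cquad_decay K (fun v => f (c * v + d) * ((oneDsqr v)^-1)%:C).
Proof.
move=> Kf; split=> [|v].
  apply: ccontinuousM; last by apply: ccontinuous_real; exact: continuous_oneDsqrV.
  by apply: ccontinuous_comp; [case: Kf|exact: continuous_affine].
apply: le_trans (norm1M_le _ _) _; rewrite norm1_real ger0_norm ?oneDsqrV_ge0//.
by rewrite ler_wpM2r ?oneDsqrV_ge0//; exact: norm1_cquad_decay_le.
Qed.

Lemma cquad_decay_psiM K (f : R -> C) (c : R) : cquad_decay K f ->
  cquad_decay (2 * K) (fun t => psi (c * t) * f t).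
Proof.
move=> Kf; apply: cquad_decayM => //; first exact: ccontinuous_psi.
by move=> t; exact: norm1_psi_le2.
Qed.

Lemma fourier_translate K (f : R -> C) (z c e : R) : cquad_decay K f ->
  cint (fun t => psi (e - z * t) * f (t + c)) =
  psi (e + z * c) * cint (fun t => psi (- z * t) * f t).
Proof.
move=> Kf; have Kpf := cquad_decay_psiM (- z) Kf.
rewrite -(cintZ _ Kpf) -[RHS](cint_affine c (oner_neq0 _) (cquad_decayZ _ Kpf)) normr1 mul1r.
by apply: eq_cint => t; rewrite mul1r mulrA -psiD; congr (psi _ * _); ring.
Qed.

Definition abel (e z : R) : R := expR (- (e * `|z|)).

Lemma abel_continuous e : continuous (abel e).
Proof.
move=> z; apply: continuous_comp; last exact: continuous_expR.
by apply: cvgN; apply: cvgM; [exact: cvg_cst|apply: cvg_norm; exact: cvg_id].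
Qed.

Lemma abel_le1 e z : 0 < e -> 0 <= abel e z <= 1.
Proof. by move=> e0; rewrite expR_ge0/= -expR0 ler_expR oppr_le0 mulr_ge0// ltW. Qed.

Lemma abel_le_oneDsqrV e z : 0 < e -> abel e z <= (1 + 4 / e ^+ 2) * (oneDsqr z)^-1.
Proof.
move=> e0; rewrite /abel expRN ler_pdivlMr ?oneDsqr_gt0// mulrC ler_pdivrMr ?expR_gt0//.
set y := e * `|z|; have y0 : 0 <= y by rewrite mulr_ge0// ltW.
have expR_sqr : 1 + y ^+ 2 / 4 <= expR y.
  have -> : expR y = expR (y / 2) ^+ 2 by rewrite expr2 -expRD -splitr.
  have := expR_ge1Dx (y / 2) => y2_le.
  apply: (@le_trans _ _ ((1 + y / 2) ^+ 2)); first nra.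
  by rewrite lerXn2r// nnegrE ?addr_ge0 ?divr_ge0 ?expR_ge0.
apply: le_trans (ler_wpM2l _ expR_sqr); last by rewrite addr_ge0// divr_ge0// sqr_ge0.
have -> : (1 + 4 / e ^+ 2) * (1 + y ^+ 2 / 4) = 1 + `|z| ^+ 2 + (4 / e ^+ 2 + y ^+ 2 / 4).
  by rewrite /y; field; exact: lt0r_neq0.
by rewrite /oneDsqr real_normK ?num_real// lerDl addr_ge0// divr_ge0// sqr_ge0.
Qed.

Lemma quad_decay_abelM e (g : R -> R) : 0 < e -> continuous g -> (forall z, `|g z| <= 1) ->
  quad_decay (1 + 4 / e ^+ 2) (fun z => abel e z * g z).
Proof.
move=> e0 cg g1; split=> z; first by apply: cvgM; [exact: abel_continuous|exact: cg].
rewrite normrM; apply: le_trans (abel_le_oneDsqrV z e0).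
by rewrite ger0_norm ?expR_ge0// ler_piMr// expR_ge0.
Qed.

Lemma continuous_cosM (k : R) : continuous (fun z => cos (k * z)).
Proof.
move=> z; apply: continuous_comp; last exact: continuous_cos.
by apply: cvgM; [exact: cvg_cst|exact: cvg_id].
Qed.

Lemma continuous_sinM (k : R) : continuous (fun z => sin (k * z)).
Proof.
move=> z; apply: continuous_comp; last exact: continuous_sin.
by apply: cvgM; [exact: cvg_cst|exact: cvg_id].
Qed.

Definition damped_cos_primitive (e k z : R) : R :=
  expR (- (e * z)) * (- e * cos (k * z) + k * sin (k * z)) / (e ^+ 2 + k ^+ 2).

Lemma is_derive_damped_cos (e k z : R) : 0 < e ->
  is_derive z 1 (damped_cos_primitive e k) (expR (- (e * z)) * cos (k * z)).
Proof.
move=> e0; rewrite /damped_cos_primitive; apply: is_derive_eq; rewrite /GRing.scale /=.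
by field; rewrite gt_eqF// ltr_wpDr ?sqr_ge0// exprn_gt0.
Qed.

Lemma cvg_damped_cos_primitive (e k : R) : 0 < e -> damped_cos_primitive e k z @[z --> +oo] --> 0.
Proof.
move=> e0; have D0 : 0 < e ^+ 2 + k ^+ 2 by rewrite ltr_wpDr ?sqr_ge0// exprn_gt0.
apply: (@quad_decay_cvg0_pinfty _ ((e + `|k|) / (e ^+ 2 + k ^+ 2) * (1 + 4 / e ^+ 2))) => z z0.
have := abel_le_oneDsqrV z e0; rewrite /abel (ger0_norm z0) => exp_le.
rewrite /damped_cos_primitive !normrM normfV (gtr0_norm D0) (gtr0_norm (expR_gt0 _)).
rewrite mulrAC -mulrA mulrC -[leRHS]mulrA; apply: ler_pM => //.
- by rewrite mulr_ge0// invr_ge0 ltW.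
rewrite mulrC ler_wpM2r ?invr_ge0 ?(ltW D0)//; apply: le_trans (ler_normD _ _) _.
rewrite !normrM normrN (gtr0_norm e0).
by apply: lerD; apply: ler_piMr; rewrite ?cos_max ?sin_max// ltW.
Qed.

Lemma Rintegral_abel_cos e k : 0 < e ->
  \int[mu]_z (abel e z * cos (k * z)) = 2 * e / (e ^+ 2 + k ^+ 2).
Proof.
move=> e0; have D0 : 0 < e ^+ 2 + k ^+ 2 by rewrite ltr_wpDr ?sqr_ge0// exprn_gt0.
have intf : mu.-integrable setT (EFin \o (fun z => abel e z * cos (k * z))).
  by apply: integrable_quad_decay (quad_decay_abelM e0 (@continuous_cosM k) _) => z; exact: cos_max.
have halfE (z : R) : z \in `[0, +oo[%classic ->
    abel e z * cos (k * z) = expR (- (e * z)) * cos (k * z).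
  by rewrite inE/= in_itv/= andbT /abel => z0; rewrite ger0_norm.
rewrite Rintegral_even//; last by move=> z; rewrite /abel normrN mulrN cosN.
have -> : \int[mu]_(z in `[0, +oo[) (abel e z * cos (k * z)) =
    \int[mu]_(z in `[0, +oo[) (expR (- (e * z)) * cos (k * z)).
  by apply: eq_Rintegral => z /halfE.
rewrite (Rintegral_FTC2y _ _ (fun z => is_derive_damped_cos k z e0)
  (cvg_damped_cos_primitive k e0)).
- rewrite /damped_cos_primitive !mulr0 oppr0 expR0 cos0 sin0.
  by field; rewrite gt_eqF.
- have : mu.-integrable `[0, +oo[ (EFin \o (fun z => abel e z * cos (k * z))).
    exact: integrableS intf.
  by apply: eq_integrable => // z /halfE zE; rewrite /= zE.
move=> z; apply: cvgM; last exact: continuous_cosM.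
apply: continuous_comp; last exact: continuous_expR.
by apply: cvgN; apply: cvgM; [exact: cvg_cst|exact: cvg_id].
Qed.

Lemma Rintegral_abel_sin e k : 0 < e -> \int[mu]_z (abel e z * sin (k * z)) = 0.
Proof.
move=> e0; apply: Rintegral_odd; last by move=> z; rewrite /abel normrN mulrN sinN mulrN.
by apply: integrable_quad_decay (quad_decay_abelM e0 (@continuous_sinM k) _) => z; exact: sin_max.
Qed.

Definition poisson (e s : R) : R := 2 * e / (e ^+ 2 + (hbar * s) ^+ 2).

Lemma cint_abel_psi e s : 0 < e -> cint (fun z => (abel e z)%:C * psi (s * z)) = (poisson e s)%:C.
Proof.
move=> e0; apply: eq_ReIm => /=.
  by under eq_Rintegral do rewrite mul0r subr0 mulrA; exact: Rintegral_abel_cos.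
by under eq_Rintegral do rewrite mul0r addr0 mulrA; exact: Rintegral_abel_sin.
Qed.

Lemma cint_abel_fourier e K (f : R -> C) (x : R) : 0 < e -> cquad_decay K f ->
  cint (fun z => (abel e z)%:C * (psi (x * z) * cint (fun t => psi (- z * t) * f t))) =
  cint (fun t => (poisson e (x - t))%:C * f t).
Proof.
move=> e0 Kf.
pose kern z t : C := (abel e z)%:C * psi ((x - t) * z).
have kernE z t : kern z t = (abel e z)%:C * (psi (x * z) * psi (- z * t)).
  by rewrite -psiD; congr (_ * psi _); ring.
have decay_kern t : cquad_decay ((1 + 4 / e ^+ 2) * 2) (kern ^~ t).
  split=> [|z].
    exact: ccontinuousM (ccontinuous_real (@abel_continuous e)) (ccontinuous_psi _).
  apply: le_trans (norm1M_le _ _) _; rewrite norm1_real mulrAC ger0_norm ?expR_ge0//.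
  by apply: ler_pM; rewrite ?norm1_ge0 ?expR_ge0 ?norm1_psi_le2// abel_le_oneDsqrV.
transitivity (cint (fun z => cint (fun t => kern z t * f t))).
  apply: eq_cint => z; rewrite mulrA -(cintZ _ (cquad_decay_psiM (- z) Kf)).
  by apply: eq_cint => t; rewrite kernE !mulrA.
rewrite (@cint_Fubini _ _ ((1 + 4 / e ^+ 2) * 2 * K)).
- apply: eq_cint => t; rewrite [RHS]mulrC -(cint_abel_psi _ e0) -(cintZ _ (decay_kern t)).
  by apply: eq_cint => z; rewrite mulrC.
- by move=> t; apply: ccontinuousM; [case: (decay_kern t)|exact: ccontinuous_cst].
- move=> z; apply: ccontinuousM; last by case: Kf.
  have := ccontinuousM (ccontinuous_cst ((abel e z)%:C * psi (x * z))) (ccontinuous_psi (- z)).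
  by congr ccontinuous; apply/funext => t; rewrite kernE mulrA.
move=> z t; apply: le_trans (norm1M_le _ _) _; rewrite -mulrA mulrACA.
by apply: ler_pM; rewrite ?norm1_ge0//; [case: (decay_kern t)|case: Kf].
Qed.

Hypothesis hbar0 : hbar != 0.

Lemma poissonN e s : poisson e (- s) = poisson e s.
Proof. by rewrite /poisson mulrN sqrrN. Qed.

Lemma poisson_scale e v : 0 < e -> poisson e (e / hbar * v) = 2 / e * (oneDsqr v)^-1.
Proof.
move=> e0; have e_n0 : e != 0 by rewrite gt_eqF.
rewrite /poisson /oneDsqr (_ : hbar * (e / hbar * v) = e * v); last by field.
have v0 : 1 + v ^+ 2 != 0 by rewrite gt_eqF// (oneDsqr_gt0 v).
have -> : e ^+ 2 + (e * v) ^+ 2 = e ^+ 2 * (1 + v ^+ 2) by ring.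
by field; rewrite v0 e_n0.
Qed.

Lemma cquad_decay_poissonM e K (f : R -> C) (x : R) : 0 < e -> cquad_decay K f ->
  cquad_decay (2 / e * K) (fun t => (poisson e (x - t))%:C * f t).
Proof.
move=> e0 Kf; have D0 s : 0 < e ^+ 2 + (hbar * s) ^+ 2.
  by rewrite ltr_wpDr ?sqr_ge0// exprn_gt0.
apply: cquad_decayM => // [|t].
  apply: ccontinuous_real => t; apply: cvgM; first exact: cvg_cst.
  apply: cvgV; first by rewrite gt_eqF.
  apply: cvgD; first exact: cvg_cst.
  have ch : hbar * (x - s) @[s --> t] --> hbar * (x - t).
    by apply: cvgM; [exact: cvg_cst|apply: cvgB; [exact: cvg_cst|exact: cvg_id]].
  by rewrite expr2; apply: cvgM; exact: ch.
rewrite norm1_real ger0_norm; last by rewrite divr_ge0 ?mulr_ge0// ltW.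
rewrite ler_pdivrMr// mulrDr.
have -> : 2 / e * e ^+ 2 = 2 * e by field; rewrite gt_eqF.
by rewrite lerDl mulr_ge0 ?sqr_ge0// divr_ge0// ltW.
Qed.

(* The substitution [t = e / hbar * v + x] turns the Poisson kernel into
   [2 / |hbar| / (1 + v ^+ 2)]. *)
Lemma cint_poisson e K (f : R -> C) (x : R) : 0 < e -> cquad_decay K f ->
  cint (fun t => (poisson e (x - t))%:C * f t) =
  (2 / `|hbar|)%:C * cint (fun v => f (e / hbar * v + x) * ((oneDsqr v)^-1)%:C).
Proof.
move=> e0 Kf; have eh0 : e / hbar != 0 by rewrite mulf_neq0 ?invr_eq0// gt_eqF.
rewrite -(cint_affine x eh0 (cquad_decay_poissonM x e0 Kf)).
have -> : (2 / `|hbar|)%:C = `|e / hbar|%:C * (2 / e)%:C :> C.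
  rewrite -rmorphM normrM normfV (gtr0_norm e0); congr (_%:C).
  by field; rewrite normr_eq0 hbar0 gt_eqF.
rewrite -mulrA -(cintZ _ (cquad_decay_dilate (e / hbar) x Kf)).
congr (_ * _); apply: eq_cint => v.
by rewrite opprD addrCA subrr addr0 poissonN poisson_scale// rmorphM/= mulrAC -mulrA.
Qed.

Lemma cvg_cint_dilate K (f : R -> C) (e : nat -> R) (x : R) : cquad_decay K f ->
  e m @[m --> \oo] --> 0 ->
  ccvg (fun m => cint (fun v => f (e m * v + x) * ((oneDsqr v)^-1)%:C)) (f x * (pi : R)%:C).
Proof.
move=> Kf e_0; rewrite -cint_oneDsqrV.
apply: (@ccvg_cint _ K) => [m|v]; first exact: cquad_decay_dilate.
apply: ccvgM; last exact: ccvg_cst.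
have arg_cvg : (e m * v + x) @[m --> \oo] --> x.
  rewrite -[X in _ --> X]add0r -[X in _ --> X + _](mul0r v).
  by apply: cvgD; [apply: cvgM; [exact: e_0|exact: cvg_cst]|exact: cvg_cst].
by apply: ccontinuous_ccvg arg_cvg; case: Kf.
Qed.

Lemma ccvg_cint_abel K (g : R -> C) (e : nat -> R) : cquad_decay K g ->
  (forall m, 0 < e m) -> e m @[m --> \oo] --> 0 ->
  ccvg (fun m => cint (fun z => (abel (e m) z)%:C * g z)) (cint g).
Proof.
move=> Kg e0 e_0; apply: (@ccvg_cint _ (1 * K)) => [m|z].
  apply: cquad_decayM => //; first by apply: ccontinuous_real; exact: abel_continuous.
  by move=> z; rewrite norm1_real; have /andP[? ?] := abel_le1 z (e0 m); rewrite ger0_norm.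
rewrite -[X in ccvg _ X]mul1r; apply: ccvgM; last exact: ccvg_cst.
apply: ccvg_real; rewrite /abel -[X in _ --> X]expR0.
apply: continuous_cvg; first exact: continuous_expR.
rewrite -oppr0 -[X in - X](mul0r `|z|); apply: cvgN.
by apply: cvgM; [exact: e_0|exact: cvg_cst].
Qed.

(* Abel summation: the damped inversion integrals are both the damping of the integral to be
   computed and the convolution of [f] with the Poisson kernel. *)
Lemma fourier_inversion K K' (f : R -> C) (x : R) : cquad_decay K f ->
  cquad_decay K' (fun z => cint (fun t => psi (- z * t) * f t)) ->
  (`|hbar| / (2 * pi))%:C *
    cint (fun z => psi (x * z) * cint (fun t => psi (- z * t) * f t)) = f x.
Proof.
move=> Kf Kfh; set fh := (fun z => cint _) in Kfh *.
pose e (m : nat) : R := m.+1%:R^-1.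
have e0 m : 0 < e m by rewrite invr_gt0.
have e_0 : e m @[m --> \oo] --> 0 by exact: cvg_harmonic.
have cvg_lhs := ccvg_cint_abel (cquad_decay_psiM x Kfh) e0 e_0.
have cvg_rhs : ccvg (fun m => cint (fun z => (abel (e m) z)%:C * (psi (x * z) * fh z)))
    ((2 / `|hbar|)%:C * (f x * (pi : R)%:C)).
  have -> : (fun m => cint (fun z => (abel (e m) z)%:C * (psi (x * z) * fh z))) =
      (fun m => (2 / `|hbar|)%:C * cint (fun v => f (e m / hbar * v + x) * ((oneDsqr v)^-1)%:C)).
    by apply/funext => m; rewrite (cint_abel_fourier x (e0 m) Kf) (cint_poisson x (e0 m) Kf).
  apply: ccvgM; first exact: ccvg_cst.
  apply: (cvg_cint_dilate (e := fun m => e m / hbar) x Kf).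
  by rewrite -[X in _ --> X](mul0r hbar^-1); apply: cvgM; [exact: e_0|exact: cvg_cst].
rewrite (ccvg_unique cvg_lhs cvg_rhs).
have -> : (`|hbar| / (2 * pi))%:C * ((2 / `|hbar|)%:C * (f x * (pi : R)%:C)) =
    f x * (`|hbar| / (2 * pi) * (2 / `|hbar|) * (pi : R))%:C by rewrite !rmorphM/=; ring.
have cancel (p q : R) : p != 0 -> q != 0 -> q / (2 * p) * (2 / q) * p = 1.
  by move=> p0 q0; field; rewrite p0 q0.
by rewrite cancel ?mulr1 ?normr_eq0// gt_eqF ?pi_gt0.
Qed.

End FourierInversion.

Section FourierDerivative.
Variables (R : realType) (hbar : R).
Local Notation C := R[i].
Local Notation Re := complex.Re.
Local Notation Im := complex.Im.

Definition is_derivec (t : R) (f : R -> C) (df : C) : Prop :=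
  is_derive t 1 (fun s => Re (f s)) (Re df) /\ is_derive t 1 (fun s => Im (f s)) (Im df).

Lemma is_derivecM (t : R) f g df dg : is_derivec t f df -> is_derivec t g dg ->
  is_derivec t (fun s => f s * g s) (df * g t + f t * dg).
Proof.
move=> [fr fi] [gr gi]; split.
  under [X in is_derive _ _ X _]eq_fun do rewrite ReM.
  by apply: is_derive_eq; rewrite /GRing.scale /= !ReD !ReM; ring.
under [X in is_derive _ _ X _]eq_fun do rewrite ImM.
by apply: is_derive_eq; rewrite /GRing.scale /= !ImD !ImM; ring.
Qed.

Lemma is_derivec_psi (g : R -> R) (t dg : R) : is_derive t 1 g dg ->
  is_derivec t (fun s => psi hbar (g s)) ((0 +i* (hbar * dg)) * psi hbar (g t)).
Proof.
by move=> ?; split; rewrite ?ReM ?ImM /=; apply: is_derive_eq; rewrite /GRing.scale /=; ring.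
Qed.

Lemma cint_is_derivec K L f F : cquad_decay K f -> (forall t, is_derivec t F (f t)) ->
  cquad_decay L F -> cint f = 0.
Proof.
move=> Kf dF [_ FL]; apply: eq_ReIm => /=.
  apply: (Rintegral_derive_quad_decay (cquad_decay_Re Kf) (fun t => (dF t).1)) => t.
  exact: le_trans (Re_le_norm1 _) (FL t).
apply: (Rintegral_derive_quad_decay (cquad_decay_Im Kf) (fun t => (dF t).2)) => t.
exact: le_trans (Im_le_norm1 _) (FL t).
Qed.

Lemma fourier_derive K K' (f f' : R -> C) (z : R) : cquad_decay K f -> cquad_decay K' f' ->
  (forall t : R, is_derivec t f (f' t)) ->
  cint (fun t => psi hbar (- z * t) * f' t) =
  (0 +i* (hbar * z)) * cint (fun t => psi hbar (- z * t) * f t).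
Proof.
move=> Kf Kf' df.
have Kpf := cquad_decay_psiM hbar (- z) Kf; have Kpf' := cquad_decay_psiM hbar (- z) Kf'.
have Kzpf := cquad_decayZ (0 +i* (hbar * - z)) Kpf.
have dpf t : is_derivec t (fun s => psi hbar (- z * s) * f s)
    ((0 +i* (hbar * - z)) * (psi hbar (- z * t) * f t) + psi hbar (- z * t) * f' t).
  rewrite mulrA; apply: is_derivecM (df t); apply: is_derivec_psi.
  by apply: is_derive_eq; rewrite /GRing.scale /=; ring.
have := cint_is_derivec (cquad_decayD Kzpf Kpf') dpf Kpf.
rewrite (cintD Kzpf Kpf') (cintZ _ Kpf) => /eqP; rewrite addrC addr_eq0 => /eqP ->.
by rewrite -mulNr; congr (_ * _); apply: eq_ReIm => /=; rewrite ?oppr0 ?mulrN ?opprK.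
Qed.

End FourierDerivative.
(** * Iterated integrals and partial Fourier transforms *)

Section Update.
Variables (I : eqType) (T : Type).
Implicit Types (x y : I -> T) (i j : I) (s : seq I) (t u : T) (ts : seq T).

Definition upd x i t : I -> T := fun j => if j == i then t else x j.

Lemma upd_same x i t : upd x i t i = t. Proof. by rewrite /upd eqxx. Qed.

Lemma upd_other x i t j : j != i -> upd x i t j = x j.
Proof. by rewrite /upd => /negPf ->. Qed.

Lemma updC x i j t u : i != j -> upd (upd x i t) j u = upd (upd x j u) i t.
Proof.
move=> ij; apply/funext => k; rewrite /upd; case: eqP => [->|//].
by rewrite eq_sym (negPf ij).
Qed.

Lemma upd_upd x i t u : upd (upd x i t) i u = upd x i u.
Proof. by apply/funext => k; rewrite /upd; case: eqP. Qed.

Lemma upd_id x i : upd x i (x i) = x.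
Proof. by apply/funext => k; rewrite /upd; case: eqP => [->|]. Qed.

Fixpoint upds x s ts : I -> T :=
  match s, ts with i :: s', t :: ts' => upds (upd x i t) s' ts' | _, _ => x end.

Lemma upds_notin x s ts j : j \notin s -> upds x s ts j = x j.
Proof.
elim: s x ts => [|i s IH] x [|t ts] //=; rewrite inE negb_or => /andP[ji js].
by rewrite IH// upd_other.
Qed.

Lemma eq_upds x y s ts i : size ts = size s -> i \in s -> upds x s ts i = upds y s ts i.
Proof.
elim: s x y ts => [//|j s IH] x y [//|t ts] /= [sts]; rewrite inE.
have [is_ _|is_] := boolP (i \in s); first exact: IH.
by rewrite orbF => /eqP ij; rewrite !upds_notin// ij !upd_same.
Qed.

Lemma upds_map (J : eqType) (f : J -> I) (r : seq J) x ts t0 (l : J) :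
  injective f -> uniq r -> size ts = size r -> l \in r ->
  upds x (map f r) ts (f l) = nth t0 ts (index l r).
Proof.
move=> fi; elim: r x ts => [//|i r IH] x [//|t ts] /= /andP[ir ur] [sr].
rewrite inE eq_sym; have [<- _|il /= lr] := eqVneq i l; last by rewrite IH.
rewrite upds_notin ?upd_same//; apply/negP => /mapP[k kr /fi ik].
by move: ir; rewrite ik kr.
Qed.

Lemma upds_map_comm (Phi : (I -> T) -> I -> T) s x ts :
  (forall x p t, p \in s -> Phi (upd x p t) = upd (Phi x) p t) ->
  Phi (upds x s ts) = upds (Phi x) s ts.
Proof.
move=> Phi_upd; elim: s x ts Phi_upd => [|p s IH] x [|t ts] Phi_upd //=.
by rewrite IH ?Phi_upd ?mem_head// => y q u qs; apply: Phi_upd; rewrite inE qs orbT.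
Qed.

Lemma invariant_eq (A : Type) s (g : (I -> T) -> A) x y :
  (forall j z t, j \in s -> g (upd z j t) = g z) ->
  (forall j, j \notin s -> x j = y j) -> g x = g y.
Proof.
elim: s x => [|i s IH] x inv agr; first by congr g; apply/funext => j; exact: agr.
rewrite -(inv i x (y i) (mem_head _ _)); apply: IH.
  by move=> j z t js; apply: inv; rewrite inE js orbT.
move=> j js; rewrite /upd; case: eqP => [->//|/eqP ji]; apply: agr.
by rewrite inE negb_or ji.
Qed.

End Update.

Section SequentialContinuity.
Variables (R : realType) (hbar : R) (I : eqType).
Local Notation C := R[i].
Local Notation pt := (I -> R).
Local Notation psi := (@psi R hbar).
Implicit Types (x : pt) (F G : pt -> C) (g h : pt -> R).

Definition pcvg (x_ : nat -> pt) (x : pt) : Prop := forall j, x_ n j @[n --> \oo] --> x j.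
Definition cseqcont F : Prop :=
  forall (x_ : nat -> pt) x, pcvg x_ x -> ccvg (fun n => F (x_ n)) (F x).
Definition seqcont (g : pt -> R) : Prop :=
  forall (x_ : nat -> pt) x, pcvg x_ x -> g (x_ n) @[n --> \oo] --> g x.

Lemma pcvg_upd (x_ : nat -> pt) x (t_ : nat -> R) t i : pcvg x_ x -> t_ n @[n --> \oo] --> t ->
  pcvg (fun n => upd (x_ n) i (t_ n)) (upd x i t).
Proof. by move=> xx tt j; rewrite /upd; case: (j == i) => //; exact: xx. Qed.

Lemma seqcont_cst c : seqcont (fun=> c). Proof. by move=> *; exact: cvg_cst. Qed.

Lemma seqcont_coord i : seqcont (fun x => x i). Proof. by move=> x_ x; exact. Qed.

Lemma seqcontD g h : seqcont g -> seqcont h -> seqcont (fun x => g x + h x).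
Proof. by move=> cg ch x_ x xx; apply: cvgD; [exact: cg|exact: ch]. Qed.

Lemma seqcontM g h : seqcont g -> seqcont h -> seqcont (fun x => g x * h x).
Proof. by move=> cg ch x_ x xx; apply: cvgM; [exact: cg|exact: ch]. Qed.

Lemma seqcontN g : seqcont g -> seqcont (fun x => - g x).
Proof. by move=> cg x_ x xx; apply: cvgN; exact: cg. Qed.

Lemma seqcont_sum (J : Type) (r : seq J) (P : pred J) (g : J -> pt -> R) :
  (forall j, P j -> seqcont (g j)) -> seqcont (fun x => \sum_(j <- r | P j) g j x).
Proof.
move=> cg; elim: r => [|j r IH].
  by under eq_fun do rewrite big_nil; exact: seqcont_cst.
under eq_fun do rewrite big_cons.
case: (boolP (P j)) => Pj //; apply: seqcontD => //; exact: cg.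
Qed.

Lemma cseqcontM F G : cseqcont F -> cseqcont G -> cseqcont (fun x => F x * G x).
Proof. by move=> cF cG x_ x xx; apply: ccvgM; [exact: cF|exact: cG]. Qed.

Lemma cseqcont_cst (c : C) : cseqcont (fun=> c).
Proof. by move=> x_ x xx; exact: ccvg_cst. Qed.

Lemma cseqcont_psi g : seqcont g -> cseqcont (fun x => psi (g x)).
Proof.
move=> cg x_ x xx; have cgh : hbar * g (x_ n) @[n --> \oo] --> hbar * g x.
  by apply: cvgM; [exact: cvg_cst|exact: cg].
split => /=.
  by apply: continuous_cvg cgh; exact: continuous_cos.
by apply: continuous_cvg cgh; exact: continuous_sin.
Qed.

Lemma cseqcont_comp F (Phi : pt -> pt) : (forall j, seqcont (fun x => Phi x j)) -> cseqcont F ->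
  cseqcont (fun x => F (Phi x)).
Proof. by move=> cP cF x_ x xx; apply: cF => j; exact: cP. Qed.

Lemma seqcont_comp (g : pt -> R) (Phi : pt -> pt) : (forall j, seqcont (fun x => Phi x j)) ->
  seqcont g -> seqcont (fun x => g (Phi x)).
Proof. by move=> cP cF x_ x xx; apply: cF => j; exact: cP. Qed.

Lemma cseqcont_slice F x i : cseqcont F -> ccontinuous (fun t => F (upd x i t)).
Proof.
move=> cF.
have slice (t : R) (u : nat -> R) : u n @[n --> \oo] --> t ->
    ccvg (fun n => F (upd x i (u n))) (F (upd x i t)).
  by move=> ut; apply: cF; apply: pcvg_upd => // j; exact: cvg_cst.
by split=> t; apply/(@cvg_nbhsP _ R^o) => u ut; case: (slice _ _ ut).
Qed.

End SequentialContinuity.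

Section PolynomialFunctions.
Variables (R : realType) (I : eqType).
Local Notation pt := (I -> R).
Implicit Types (A B : {pred I}) (p q : pt -> R) (x y : pt).

Inductive poly_fun A : (pt -> R) -> Prop :=
| poly_fun_cst c : poly_fun A (fun=> c)
| poly_fun_coord i of i \in A : poly_fun A (fun x => x i)
| poly_funD p q of poly_fun A p & poly_fun A q : poly_fun A (fun x => p x + q x)
| poly_funM p q of poly_fun A p & poly_fun A q : poly_fun A (fun x => p x * q x).

Lemma poly_funN A p : poly_fun A p -> poly_fun A (fun x => - p x).
Proof.
move=> Ap; have := poly_funM (poly_fun_cst A (-1)) Ap; congr poly_fun.
by apply/funext => x; rewrite mulN1r.
Qed.

Lemma poly_fun_sum (J : eqType) (r : seq J) A (g : J -> pt -> R) :
  (forall j, j \in r -> poly_fun A (g j)) -> poly_fun A (fun x => \sum_(j <- r) g j x).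
Proof.
elim: r => [|j r IH] Ag; first by under eq_fun do rewrite big_nil; exact: poly_fun_cst.
under eq_fun do rewrite big_cons; apply: poly_funD; first exact/Ag/mem_head.
by apply: IH => i ir; apply: Ag; rewrite inE ir orbT.
Qed.

Lemma poly_fun_prod (J : eqType) (r : seq J) A (g : J -> pt -> R) :
  (forall j, j \in r -> poly_fun A (g j)) -> poly_fun A (fun x => \prod_(j <- r) g j x).
Proof.
elim: r => [|j r IH] Ag; first by under eq_fun do rewrite big_nil; exact: poly_fun_cst.
under eq_fun do rewrite big_cons; apply: poly_funM; first exact/Ag/mem_head.
by apply: IH => i ir; apply: Ag; rewrite inE ir orbT.
Qed.

Lemma poly_funW A B p : {subset A <= B} -> poly_fun A p -> poly_fun B p.
Proof.
move=> AB; elim=> [c|i /AB|q r _ Bq _ Br|q r _ Bq _ Br].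
- exact: poly_fun_cst.
- exact: poly_fun_coord.
- exact: poly_funD.
- exact: poly_funM.
Qed.

Lemma eq_poly_fun A p x y : poly_fun A p -> {in A, x =1 y} -> p x = p y.
Proof. by move=> Ap xy; elim: Ap => [c|i /xy|q r _ -> _ ->|q r _ -> _ ->]. Qed.

Lemma poly_fun_seqcont A p : poly_fun A p -> seqcont p.
Proof.
by elim=> *; [exact: seqcont_cst|exact: seqcont_coord|exact: seqcontD|exact: seqcontM].
Qed.

Lemma poly_fun_derivable A p (c : R -> pt) (t : R) : poly_fun A p ->
  (forall i, i \in A -> derivable (fun u : R => c u i) t 1) ->
  derivable (fun u : R => p (c u)) t 1.
Proof.
move=> Ap dc; elim: Ap => [k|i /dc//|q r _ dq _ dr|q r _ dq _ dr].
- exact: derivable_cst.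
- exact: (derivableD dq dr).
- exact: (derivableM dq dr).
Qed.

Definition poly_recovers A (Phi : pt -> pt) (i : I) : Prop :=
  exists2 p, poly_fun A p & forall x, x i = p (Phi x).

Lemma poly_recovers_coord A (Phi : pt -> pt) i : i \in A -> (forall x, Phi x i = x i) ->
  poly_recovers A Phi i.
Proof. by move=> iA Phii; exists (fun x => x i) => //; exact: poly_fun_coord. Qed.

Lemma poly_recoversW A B (Phi : pt -> pt) i : {subset A <= B} ->
  poly_recovers A Phi i -> poly_recovers B Phi i.
Proof. by move=> AB [p Ap pE]; exists p => //; exact: poly_funW Ap. Qed.

(* Back substitution in a system of quadratic equations. *)
Lemma poly_recovers_rec A B (Phi : pt -> pt) (rank : I -> nat) :
  (forall i, i \in A -> exists c, exists2 j, j \in B & exists2 s : seq (R * (I * I)),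
     forall t, t \in s -> [/\ t.2.1 \in A, t.2.2 \in A, (rank t.2.1 < rank i)%N &
                             (rank t.2.2 < rank i)%N] &
     forall x, x i = c * (Phi x j - \sum_(t <- s) t.1 * (x t.2.1 * x t.2.2))) ->
  {in A, forall i, poly_recovers B Phi i}.
Proof.
move=> rec i; have [m] := ubnP (rank i); elim: m i => // m IH i; rewrite ltnS => im iA.
have [c [j jB [s s_rank xE]]] := rec i iA.
have /choice[f fP] : forall l, exists p : pt -> R, l \in A -> (rank l < rank i)%N ->
    poly_fun B p /\ forall x, x l = p (Phi x).
  move=> l; have [/andP[lA li]|li] := boolP ((l \in A) && (rank l < rank i)%N).
    by have [p Bp pE] := IH l (leq_trans li im) lA; exists p.
  by exists (fun=> 0) => lA li'; rewrite lA li' in li.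
exists (fun y => c * (y j - \sum_(t <- s) t.1 * (f t.2.1 y * f t.2.2 y))); last first.
  move=> x; rewrite {1}xE; congr (_ * (_ - _)); apply: eq_big_seq => t /s_rank[t1 t2 r1 r2].
  by rewrite -(fP _ t1 r1).2 -(fP _ t2 r2).2.
apply: poly_funM; first exact: poly_fun_cst.
apply: poly_funD; first exact: poly_fun_coord.
apply: poly_funN; apply: poly_fun_sum => t /s_rank[t1 t2 r1 r2].
apply: poly_funM; first exact: poly_fun_cst.
by apply: poly_funM; [exact: (fP _ t1 r1).1|exact: (fP _ t2 r2).1].
Qed.

End PolynomialFunctions.

Section RapidDecay.
Variables (R : realType) (hbar : R) (I : eqType).
Local Notation C := R[i].
Local Notation pt := (I -> R).
Local Notation psi := (@psi R hbar).
Implicit Types (x : pt) (F G : pt -> C) (g : pt -> R) (Phi : pt -> pt) (S : seq I).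

Definition bracket S x : R := 1 + \sum_(i <- S) `|x i|.

Lemma bracket_ge1 S x : 1 <= bracket S x.
Proof. by rewrite lerDl sumr_ge0. Qed.

Lemma bracket_gt0 S x : 0 < bracket S x.
Proof. exact: lt_le_trans (bracket_ge1 S x). Qed.

Lemma le_bracket S x i : i \in S -> `|x i| <= bracket S x.
Proof.
move=> iS; rewrite /bracket (perm_big _ (perm_to_rem iS)) /= big_cons addrCA lerDl.
by rewrite addr_ge0// sumr_ge0.
Qed.

Lemma bracketX_le S x k :
  bracket S x ^+ k <= (1 + \sum_(i <- S) `|x i| ^+ k) * (1 + size S)%:R ^+ k.
Proof.
have [M [M1 xM MX]] : exists M, [/\ 1 <= M, forall i, i \in S -> `|x i| <= M &
    M ^+ k <= 1 + \sum_(i <- S) `|x i| ^+ k].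
  elim: S => [|i S [M [M1 HM MS]]].
    by exists 1; split => //; rewrite expr1n big_nil addr0.
  exists (Num.max M `|x i|); split; first by rewrite le_max M1.
    move=> j; rewrite inE => /orP[/eqP ->|jS]; first by rewrite le_max lexx orbT.
    by rewrite le_max HM.
  rewrite big_cons; have [xM|xM] := leP `|x i| M.
    by apply: le_trans MS _; rewrite lerD2l lerDr exprn_ge0.
  by rewrite addrCA lerDl addr_ge0// sumr_ge0// => j _; rewrite exprn_ge0.
have M0 : 0 <= M := le_trans ler01 M1.
apply: (@le_trans _ _ (M ^+ k * (1 + size S)%:R ^+ k)); last first.
  by apply: ler_wpM2r => //; rewrite exprn_ge0.
rewrite -exprMn; apply: lerXn2r; rewrite ?nnegrE; [exact/ltW/bracket_gt0|exact: mulr_ge0|].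
rewrite natrD mulrDr mulr1; apply: lerD => //.
have : \sum_(i <- S) `|x i| <= \sum_(i <- S) M.
  by rewrite big_seq [leRHS]big_seq; apply: ler_sum.
by move/le_trans; apply; rewrite big_const_seq count_predT iter_addr_0 mulr_natr.
Qed.

Definition rapid_decay S F := forall k, exists K, forall x, norm1 (F x) * bracket S x ^+ k <= K.
(* All bounds are uniform in the variables outside [S]. *)
Definition rapid S F := cseqcont F /\ rapid_decay S F.

Lemma lerD_bracketX S x (c c' u u' : R) (e e' : nat) : 0 <= c -> 0 <= c' ->
  u <= c * bracket S x ^+ e -> u' <= c' * bracket S x ^+ e' ->
  u + u' <= (c + c') * bracket S x ^+ (e + e').
Proof.
move=> c0 c'0 ue u'e; rewrite mulrDl; apply: lerD.
  by apply: le_trans ue _; rewrite ler_wpM2l// ler_weXn2l ?bracket_ge1// leq_addr.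
by apply: le_trans u'e _; rewrite ler_wpM2l// ler_weXn2l ?bracket_ge1// leq_addl.
Qed.

Lemma poly_fun_le_bracket S (p : pt -> R) : poly_fun [in S] p ->
  exists c, exists e : nat, 0 <= c /\ forall x, `|p x| <= c * bracket S x ^+ e.
Proof.
elim=> [c|i iS|q r _ [c [e [c0 qe]]] _ [c' [e' [c'0 re]]]|
        q r _ [c [e [c0 qe]]] _ [c' [e' [c'0 re]]]].
- by exists `|c|, 0%N; split=> // x; rewrite expr0 mulr1.
- by exists 1, 1%N; split=> // x; rewrite mul1r expr1 le_bracket.
- exists (c + c'), (e + e')%N; split=> [|x]; first exact: addr_ge0.
  by apply: le_trans (ler_normD _ _) _; exact: lerD_bracketX.
- exists (c * c'), (e + e')%N; split=> [|x]; first exact: mulr_ge0.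
  by rewrite normrM exprD mulrACA ler_pM.
Qed.

Lemma bracket_le_comp S S' Phi : (forall i, i \in S' -> poly_recovers [in S] Phi i) ->
  exists c, exists e : nat, 0 <= c /\ forall x, bracket S' x <= c * bracket S (Phi x) ^+ e.
Proof.
elim: S' => [|i S' IH] rec.
  by exists 1, 0%N; split=> // x; rewrite /bracket big_nil addr0 expr0 mulr1.
have [p /poly_fun_le_bracket[c [e [c0 pe]]] pE] := rec i (mem_head _ _).
have [|c' [e' [c'0 Se]]] := IH; first by move=> j jS; apply: rec; rewrite inE jS orbT.
exists (c + c'), (e + e')%N; split=> [|x]; first exact: addr_ge0.
rewrite [leLHS](_ : _ = `|x i| + bracket S' x); last by rewrite /bracket big_cons addrCA.
by apply: lerD_bracketX => //; rewrite pE.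
Qed.

(* A substitution preserves rapid decrease when the old variables are polynomials in the new. *)
Lemma rapid_comp S S' F Phi : (forall j, seqcont (fun x => Phi x j)) ->
  (forall i, i \in S' -> poly_recovers [in S] Phi i) -> rapid S F ->
  rapid S' (fun x => F (Phi x)).
Proof.
move=> cP rec [cF rF]; split; first exact: cseqcont_comp.
have [c [e [c0 le_comp]]] := bracket_le_comp rec.
move=> k; have [K FK] := rF (e * k)%N; exists (K * c ^+ k) => x.
apply: (@le_trans _ _ (norm1 (F (Phi x)) * (c * bracket S (Phi x) ^+ e) ^+ k)).
  apply: ler_wpM2l; first exact: norm1_ge0.
  by rewrite lerXn2r ?nnegrE ?mulr_ge0 ?exprn_ge0// ltW// bracket_gt0.
by rewrite exprMn -exprM mulrCA mulrC; apply: ler_wpM2r; [exact: exprn_ge0|exact: FK].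
Qed.

Lemma rapidS S S' F : {subset S' <= S} -> rapid S F -> rapid S' F.
Proof.
move=> SS; apply: (@rapid_comp S S' F id) => [j|i iS]; first exact: seqcont_coord.
by apply: poly_recovers_coord => //; exact: SS.
Qed.

Lemma rapidM S F G B : cseqcont G -> (forall x, norm1 (G x) <= B) -> rapid S F ->
  rapid S (fun x => G x * F x).
Proof.
move=> cG GB [cF rF]; split; first exact: cseqcontM.
move=> k; have [K FK] := rF k; exists (B * K) => x.
have b0 : 0 <= bracket S x ^+ k by rewrite exprn_ge0// ltW// bracket_gt0.
apply: le_trans (ler_wpM2r b0 (norm1M_le _ _)) _.
by rewrite -mulrA ler_pM ?norm1_ge0// mulr_ge0 ?norm1_ge0.
Qed.

Lemma rapid_psiM S F g : seqcont g -> rapid S F -> rapid S (fun x => psi (g x) * F x).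
Proof.
move=> cg; apply: (@rapidM _ _ _ 2); first exact: cseqcont_psi.
by move=> x; exact: norm1_psi_le2.
Qed.

Lemma rapidZ S F (c : C) : rapid S F -> rapid S (fun x => c * F x).
Proof. by apply: rapidM => //; exact: cseqcont_cst. Qed.

Lemma bracket_cons_upd S x i t : i \notin S -> bracket (i :: S) (upd x i t) = bracket S x + `|t|.
Proof.
move=> iS; rewrite /bracket big_cons upd_same -addrA [X in _ + X]addrC; congr (_ + (_ + _)).
by apply: eq_big_seq => j jS; rewrite upd_other//; apply: contraNneq iS => <-.
Qed.

Lemma rapid_slice S F i k : i \notin S -> rapid (i :: S) F ->
  exists K, forall x, cquad_decay (K / bracket S x ^+ k) (fun t => F (upd x i t)).
Proof.
move=> iS [cF rF]; have [K FK] := rF (k + 2)%N.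
exists K => x; split=> [|t]; first exact: cseqcont_slice.
have b0 := bracket_gt0 S x.
rewrite -mulrA -invfM ler_pdivlMr ?mulr_gt0 ?exprn_gt0 ?oneDsqr_gt0//.
apply: le_trans (FK (upd x i t)); apply: ler_wpM2l; first exact: norm1_ge0.
rewrite bracket_cons_upd// exprD; apply: ler_pM.
- by rewrite exprn_ge0// ltW.
- exact/ltW/oneDsqr_gt0.
- have b_le : bracket S x <= bracket S x + `|t| by rewrite lerDl.
  by rewrite lerXn2r// nnegrE ltW// (lt_le_trans b0).
- have := bracket_ge1 S x; rewrite /oneDsqr -(real_normK (num_real t)).
  have := normr_ge0 t; nra.
Qed.

Lemma rapid_cquad_decay S F i x : i \in S -> rapid S F ->
  exists K, cquad_decay K (fun t => F (upd x i t)).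
Proof.
move=> iS cF; have cF' : rapid [:: i] F by apply: rapidS cF => j; rewrite inE => /eqP ->.
by have [K decayK] := @rapid_slice [::] F i 0 isT cF'; exists (K / bracket [::] x ^+ 0).
Qed.

Lemma rapid_decay_coords S F : (exists K, forall x, norm1 (F x) <= K) ->
  (forall i k, i \in S -> exists K, forall x, norm1 (F x) * `|x i| ^+ k <= K) -> rapid_decay S F.
Proof.
move=> [K0 F_K0] F_coord k; have [K F_K] : exists K, forall x,
    norm1 (F x) * (1 + \sum_(i <- S) `|x i| ^+ k) <= K.
  have [K1 F_K1] : exists K, forall x, norm1 (F x) * (\sum_(i <- S) `|x i| ^+ k) <= K.
    elim: S F_coord => [|i S IH] F_coord; first by exists 0 => x; rewrite big_nil mulr0.
    have [K F_K] := IH (fun j k' jS => F_coord j k' (@mem_behead _ (i :: S) _ jS)).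
    have [K' F_K'] := F_coord i k (mem_head _ _).
    by exists (K' + K) => x; rewrite big_cons mulrDr lerD.
  by exists (K0 + K1) => x; rewrite mulrDr mulr1 lerD.
exists (K * (1 + size S)%:R ^+ k) => x.
apply: le_trans (ler_wpM2r _ (F_K x)); last by rewrite exprn_ge0.
by rewrite -mulrA; apply: ler_wpM2l (bracketX_le _ _ _); exact: norm1_ge0.
Qed.

End RapidDecay.

Section IteratedIntegral.
Variables (R : realType) (I : eqType).
Local Notation C := R[i].
Local Notation pt := (I -> R).
Implicit Types (x y : pt) (F : pt -> C) (s S : seq I).

Lemma rapid_cint S F i (k : pt -> R -> C) B : i \notin S -> rapid (i :: S) F ->
  (forall t, cseqcont (k ^~ t)) -> (forall x, ccontinuous (k x)) ->
  (forall x t, norm1 (k x t) <= B) ->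
  rapid S (fun x => cint (fun t => k x t * F (upd x i t))).
Proof.
move=> iS cF ck kc kB.
have decay m : exists K, forall x,
    cquad_decay (B * (K / bracket S x ^+ m)) (fun t => k x t * F (upd x i t)).
  by have [K decayK] := rapid_slice m iS cF; exists K => x; exact: cquad_decayM.
split=> [x_ x x_x|m].
  have [K decayK] := decay 0%N; apply: (@ccvg_cint _ (B * K)) => [n|t].
    by have := decayK (x_ n); rewrite expr0 divr1.
  apply: ccvgM; first exact: ck.
  by apply: cF.1; apply: pcvg_upd => //; exact: cvg_cst.
have [K decayK] := decay m; exists (B * K * (2 * pi)) => x.
have b0 : 0 < bracket S x ^+ m by rewrite exprn_gt0// bracket_gt0.
have := norm1_cint_le (decayK x); rewrite -(ler_pM2r b0) => /le_trans; apply.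
by rewrite mulrAC !mulrA divfK// gt_eqF.
Qed.

Lemma cint_upd_Fubini F i j x : i != j -> rapid [:: i; j] F ->
  cint (fun t => cint (fun u => F (upd (upd x i t) j u))) =
  cint (fun u => cint (fun t => F (upd (upd x j u) i t))).
Proof.
move=> ij rF; have [K FK] := rF.2 4%N.
transitivity (cint (fun u => cint (fun t => F (upd (upd x i t) j u)))); last first.
  by apply: eq_cint => u; apply: eq_cint => t; rewrite updC// eq_sym.
rewrite (@cint_Fubini _ _ K)// => [u|t|t u].
- have := cseqcont_slice (upd x j u) i rF.1.
  by congr ccontinuous; apply/funext => t; rewrite updC// eq_sym.
- exact: cseqcont_slice rF.1.
rewrite -mulrA -invfM ler_pdivlMr ?mulr_gt0 ?oneDsqr_gt0//.
apply: le_trans (FK (upd (upd x i t) j u)); apply: ler_wpM2l; first exact: norm1_ge0.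
rewrite /bracket !big_cons big_nil upd_same upd_other// upd_same addr0 (exprD _ 2 2).
have [t0 u0] := (normr_ge0 t, normr_ge0 u).
apply: ler_pM; try exact/ltW/oneDsqr_gt0.
  rewrite /oneDsqr -(real_normK (num_real t)); nra.
rewrite /oneDsqr -(real_normK (num_real u)); nra.
Qed.

Definition int_var i F : pt -> C := fun x => cint (fun t => F (upd x i t)).

Definition int_vars s F : pt -> C := foldr int_var F s.

Lemma rapid_int_var S F i : i \notin S -> rapid (i :: S) F -> rapid S (int_var i F).
Proof.
move=> iS rF; have := @rapid_cint S F i (fun _ _ => 1) (norm1 1) iS rF.
have -> : (fun x => cint (fun t => 1 * F (upd x i t))) = int_var i F.
  by apply/funext => x; apply: eq_cint => t; rewrite mul1r.
by apply=> // *; [exact: cseqcont_cst|exact: ccontinuous_cst].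
Qed.

Lemma rapid_foldr (op : I -> (pt -> C) -> pt -> C) :
  (forall S F i, i \notin S -> rapid (i :: S) F -> rapid S (op i F)) ->
  forall s S F, uniq (s ++ S) -> rapid (s ++ S) F -> rapid S (foldr op F s).
Proof.
move=> rapid_op; elim=> [//|i s IH] S F /= /andP[iS us] rF; apply: rapid_op.
  by apply: contra iS; rewrite mem_cat => ->; rewrite orbT.
apply: IH; first by rewrite (perm_uniq (permEl (perm_catCA s [:: i] S))) /= iS us.
by apply: rapidS rF => j; rewrite !(mem_cat, inE) orbCA.
Qed.

Lemma perm_foldr (op : I -> (pt -> C) -> pt -> C) :
  (forall S F i, i \notin S -> rapid (i :: S) F -> rapid S (op i F)) ->
  (forall F i j, i != j -> rapid [:: i; j] F -> op i (op j F) = op j (op i F)) ->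
  forall s s' F, perm_eq s s' -> uniq s -> rapid s F -> foldr op F s = foldr op F s'.
Proof.
move=> rapid_op opC.
have move_front i s1 s2 F : uniq (i :: s1 ++ s2) -> rapid (i :: s1 ++ s2) F ->
    foldr op F (s1 ++ i :: s2) = foldr op F (i :: s1 ++ s2).
  elim: s1 => [//|j s1 IH] us rF; move: (us) => /=; rewrite inE negb_or -andbA.
  move=> /and4P[ij is12 js12 us12]; rewrite IH /= ?is12//; last first.
    by apply: rapidS rF => k; rewrite !inE => /orP[->//|->]; rewrite !orbT.
  rewrite opC 1?eq_sym//; apply: (rapid_foldr rapid_op (s := s1 ++ s2)).
    by rewrite uniq_catC /= inE negb_or eq_sym ij is12 js12.
  by apply: rapidS rF => k; rewrite mem_cat !inE => /orP[->|/orP[->|->]]; rewrite ?orbT.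
elim=> [|i s IH] s' F ss'.
  by have /perm_size := ss'; rewrite -(perm_nilP (etrans (perm_sym _ _) ss')).
have is' : i \in s' by rewrite -(perm_mem ss') mem_head.
case/splitPr: is' ss' => s1 s2 ss' us rF.
have ss12 : perm_eq (i :: s) (i :: s1 ++ s2).
  by apply: perm_trans ss' _; exact: permEl (perm_catCA s1 [:: i] s2).
rewrite move_front; last 2 first.
- by rewrite -(perm_uniq ss12).
- by apply: rapidS rF => k; rewrite (perm_mem ss12).
rewrite /= (IH (s1 ++ s2))//; [by rewrite -(perm_cons i)|by case/andP: us|].
by apply: rapidS rF => k ks; rewrite inE ks orbT.
Qed.

Lemma int_varC F i j : i != j -> rapid [:: i; j] F ->
  int_var i (int_var j F) = int_var j (int_var i F).
Proof. by move=> ij rF; apply/funext => x; exact: cint_upd_Fubini. Qed.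

Lemma rapid_int_vars s S F : uniq (s ++ S) -> rapid (s ++ S) F -> rapid S (int_vars s F).
Proof. exact: (rapid_foldr rapid_int_var). Qed.

Lemma perm_int_vars s s' F : perm_eq s s' -> uniq s -> rapid s F ->
  int_vars s F = int_vars s' F.
Proof. exact: (perm_foldr rapid_int_var int_varC). Qed.

Lemma int_vars_cons i s F x : int_vars (i :: s) F x = cint (fun t => int_vars s F (upd x i t)).
Proof. by []. Qed.

Lemma int_vars_cat s s' F : int_vars (s ++ s') F = int_vars s (int_vars s' F).
Proof. exact: foldr_cat. Qed.

Lemma rapid_int_vars_rem i s F : uniq (i :: s) -> rapid (i :: s) F -> rapid [:: i] (int_vars s F).
Proof.
move=> us rF; apply: rapid_int_vars; first by rewrite uniq_catC.
by apply: rapidS rF => j; rewrite mem_cat !inE orbC.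
Qed.

Lemma int_varsZ s F (c : pt -> C) x : uniq s -> rapid s F ->
  (forall y i t, i \in s -> c (upd y i t) = c y) ->
  int_vars s (fun y => c y * F y) x = c x * int_vars s F x.
Proof.
elim: s x => [//|i s IH] x us rF cc; rewrite !int_vars_cons.
have [K decayK] := rapid_cquad_decay x (mem_head _ _) (rapid_int_vars_rem us rF).
rewrite -(cintZ _ decayK); apply: eq_cint => t; have /andP[_ us'] := us.
rewrite IH ?cc ?mem_head//; last by move=> y j u js; apply: cc; rewrite inE js orbT.
by apply: rapidS rF => j js; rewrite inE js orbT.
Qed.

Lemma int_varsZl s F (c : C) x : uniq s -> rapid s F ->
  int_vars s (fun y => c * F y) x = c * int_vars s F x.
Proof. by move=> us rF; exact: (int_varsZ (c := fun=> c)). Qed.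

End IteratedIntegral.
Arguments int_vars {R I} s F x : simpl never.

Section IntegralTransfer.
Variables (R : realType).

Lemma eq_int_vars (I J : eqType) (s : seq I) (s' : seq J) F G (x : I -> R) (y : J -> R) :
  size s = size s' ->
  (forall ts, size ts = size s -> F (upds x s ts) = G (upds y s' ts)) ->
  int_vars s F x = int_vars s' G y.
Proof.
elim: s s' x y => [|i s IH] [|i' s'] x y //=; first by move=> _ /(_ [::]); exact.
move=> [ss'] FG; apply: eq_cint => t; apply: IH => // ts sts.
by apply: (FG (t :: ts)); rewrite /= sts.
Qed.

Variable I : eqType.
Local Notation pt := (I -> R).
Implicit Types (x y : pt) (F G : pt -> R[i]) (s : seq I).

Lemma eq_int_vars_upds s F G x :
  (forall ts, size ts = size s -> F (upds x s ts) = G (upds x s ts)) ->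
  int_vars s F x = int_vars s G x.
Proof. by move=> FG; apply: eq_int_vars. Qed.

Lemma int_vars_agree s F x y :
  (forall z z', (forall i, i \in s -> z i = z' i) -> F z = F z') ->
  int_vars s F x = int_vars s F y.
Proof. by move=> F_s; apply: eq_int_vars => // ts sts; apply: F_s => i; exact: eq_upds. Qed.

Lemma int_vars_comm (Phi : pt -> pt) s F x :
  (forall x p t, p \in s -> Phi (upd x p t) = upd (Phi x) p t) ->
  int_vars s F (Phi x) = int_vars s (fun y => F (Phi y)) x.
Proof. by move=> Phi_upd; apply: eq_int_vars => // ts _; rewrite upds_map_comm. Qed.

Lemma int_vars_upd s F x i t : i \notin s ->
  int_vars s F (upd x i t) = int_vars s (fun y => F (upd y i t)) x.
Proof.
move=> is_; apply: (int_vars_comm (Phi := fun y => upd y i t)) => y j u js.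
by rewrite updC//; apply: contraNneq is_ => <-.
Qed.

End IntegralTransfer.

Section TriangularSubstitution.
Variables (R : realType) (I : eqType).
Local Notation pt := (I -> R).
Implicit Types (x y : pt) (F : pt -> R[i]) (s : seq I) (c : I -> R) (g : I -> pt -> R).

Definition triangular_map s c g : pt -> pt :=
  fun y j => if j \in s then c j * y j + g j y else y j.

(* [g i] may depend only on the variables that precede [i] in [s] or lie outside [s]. *)
Fixpoint triangular s g : Prop :=
  if s is i :: s' then
    (forall j y t, j \in s -> g i (upd y j t) = g i y) /\ triangular s' g
  else True.

Lemma triangular_map_notin s c g y i : i \notin s -> triangular_map s c g y i = y i.
Proof. by move=> is_; rewrite /triangular_map (negPf is_). Qed.

Lemma eq_triangular_map s c g g' y : (forall i, i \in s -> g i =1 g' i) ->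
  triangular_map s c g y = triangular_map s c g' y.
Proof. by move=> gg'; apply/funext => i; rewrite /triangular_map; case: ifP => // /gg' ->. Qed.

Lemma triangular_map_cons i s c g y : i \notin s -> triangular (i :: s) g ->
  triangular_map (i :: s) c g y =
  upd (triangular_map s c g y) i
    (c i * triangular_map s c g y i + g i (triangular_map s c g y)).
Proof.
move=> is_ [gi _]; rewrite triangular_map_notin//.
have -> : g i (triangular_map s c g y) = g i y.
  apply: (@invariant_eq _ _ _ s) => [j z t js|j js]; last exact: triangular_map_notin.
  by apply: gi; rewrite inE js orbT.
apply/funext => j; rewrite /upd /triangular_map inE.
by case: eqP => [->|].
Qed.

Lemma int_vars_shear i s (c : R) (g : pt -> R) F x t : i \notin s ->
  (forall j y u, j \in i :: s -> g (upd y j u) = g y) ->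
  int_vars s (fun y => F (upd y i (c * y i + g y))) (upd x i t) =
  int_vars s F (upd x i (c * t + g x)).
Proof.
move=> is_ gi; rewrite !int_vars_upd//; apply: eq_int_vars_upds => ts sts.
rewrite upd_upd upd_same gi ?mem_head//; congr (F (upd _ _ (_ + _))).
apply: (@invariant_eq _ _ _ s) => [j z u js|j js]; last exact: upds_notin.
by apply: gi; rewrite inE js orbT.
Qed.

Lemma rapid_shear i s (c : R) (g : pt -> R) F : i \notin s -> seqcont g -> rapid s F ->
  rapid s (fun y => F (upd y i (c * y i + g y))).
Proof.
move=> is_ cg; apply: rapid_comp => [j|j js].
  rewrite /upd; case: (j == i); last exact: seqcont_coord.
  by apply: seqcontD => //; apply: seqcontM; [exact: seqcont_cst|exact: seqcont_coord].
apply: poly_recovers_coord => // y.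
by rewrite upd_other//; apply: contraNneq is_ => <-.
Qed.

Lemma int_vars_triangular s c g F x : uniq s ->
  (forall i, i \in s -> c i != 0) -> (forall i, i \in s -> seqcont (g i)) ->
  triangular s g -> rapid s F ->
  int_vars s F x =
  (\prod_(i <- s) `|c i|)%:C * int_vars s (fun y => F (triangular_map s c g y)) x.
Proof.
elim: s F x => [|i s IH] F x; first by rewrite big_nil mul1r.
move=> us c0 cg tg rF; have /andP[is_ us'] := us; have [gi tg'] := tg.
have ss j : j \in s -> j \in i :: s by move=> js; rewrite inE js orbT.
pose P := \prod_(j <- s) `|c j|.
have P0 : P != 0.
  rewrite prodf_seq_neq0; apply/allP => j js; apply/implyP => _.
  by rewrite normr_eq0; exact/c0/ss.
have inner t : int_vars s (fun y => F (triangular_map (i :: s) c g y)) (upd x i t) =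
    (P^-1)%:C * int_vars s F (upd x i (c i * t + g i x)).
  rewrite -(int_vars_shear _ _ _ _ is_ gi) [in RHS]IH//.
  - rewrite mulrA -rmorphM mulVf// mul1r; congr (int_vars s _ _).
    by apply/funext => y; rewrite triangular_map_cons.
  - by move=> j /ss; exact: c0.
  - by move=> j /ss; exact: cg.
  - by apply: rapid_shear => //; [exact/cg/mem_head|exact: rapidS rF].
have [K decayK] := rapid_cquad_decay x (mem_head _ _) (rapid_int_vars_rem us rF).
rewrite big_cons -/P !int_vars_cons (eq_cint inner) rmorphM mulrAC.
have := cint_affine (g i x) (c0 _ (mem_head _ _)) (cquad_decayZ (P^-1)%:C decayK).
by move=> ->; rewrite (cintZ _ decayK) mulrC mulrA -rmorphM divff// mul1r.
Qed.

Lemma triangular_ranked (rank : I -> nat) s g :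
  sorted (fun i j => (rank i <= rank j)%N) s ->
  (forall i j y t, i \in s -> j \in s -> (rank i <= rank j)%N -> g i (upd y j t) = g i y) ->
  triangular s g.
Proof.
elim: s => [//|i s IH] so gr; split.
  move=> j y t js; apply: gr => //; first exact: mem_head.
  move: js; rewrite inE => /predU1P[-> //|js].
  have tr : transitive (fun i j => (rank i <= rank j)%N) by move=> ? ? ?; exact: leq_trans.
  by have /allP := order_path_min tr so; apply.
apply: IH; first exact: path_sorted so.
by move=> j k y t js ks; apply: gr; rewrite inE ?js ?ks orbT.
Qed.

Lemma int_vars_ranked (rank : I -> nat) s c (Theta : pt -> pt) F x :
  uniq s -> (forall i, `|c i| = 1) ->
  (forall i, seqcont (fun y => Theta y i)) ->
  (forall y i, i \notin s -> Theta y i = y i) ->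
  (forall i j y t, i \in s -> j \in s -> (rank i <= rank j)%N ->
     Theta (upd y j t) i - c i * upd y j t i = Theta y i - c i * y i) ->
  rapid s F -> rapid s (fun y => F (Theta y)) ->
  int_vars s F x = int_vars s (fun y => F (Theta y)) x.
Proof.
move=> us c1 cTheta Theta_out Theta_rank rF rFT.
pose s' := sort (fun i j => (rank i <= rank j)%N) s.
have ss' : perm_eq s s' by rewrite perm_sym perm_sort.
rewrite (perm_int_vars ss' us rF) (perm_int_vars ss' us rFT).
rewrite (@int_vars_triangular s' c (fun i y => Theta y i - c i * y i)).
- rewrite big1 ?mul1r => [|i _]; last exact: c1.
  congr (int_vars _ _ _); apply/funext => y; congr F; apply/funext => i.
  by rewrite /triangular_map mem_sort; case: ifPn => is_; [ring|rewrite Theta_out].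
- by rewrite sort_uniq.
- by move=> i _; rewrite -normr_gt0 c1.
- move=> i _; apply: seqcontD; first exact: cTheta.
  by apply/seqcontN/seqcontM; [exact: seqcont_cst|exact: seqcont_coord].
- apply: (triangular_ranked (rank := rank)); first by apply: sort_sorted => i j; exact: leq_total.
  by move=> i j y t; rewrite !mem_sort; exact: Theta_rank.
- by apply: rapidS rF => i; rewrite mem_sort.
Qed.

End TriangularSubstitution.

Section PartialFourier.
Variables (R : realType) (hbar : R) (I : eqType).
Local Notation C := R[i].
Local Notation pt := (I -> R).
Local Notation psi := (@psi R hbar).
Implicit Types (x y z : pt) (F G : pt -> C) (s S T : seq I).

Definition fourier_var i F : pt -> C :=
  fun x => cint (fun t => psi (- x i * t) * F (upd x i t)).

Definition fourier_vars s F : pt -> C := foldr fourier_var F s.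

Lemma rapid_fourier_var S F i : i \notin S -> rapid (i :: S) F -> rapid S (fourier_var i F).
Proof.
move=> iS rF; apply: (@rapid_cint _ _ S F i (fun x t => psi (- x i * t)) 2) => // [t|x|x t].
- apply: cseqcont_psi; apply: seqcontM; last exact: seqcont_cst.
  exact/seqcontN/seqcont_coord.
- exact: ccontinuous_psi.
- exact: norm1_psi_le2.
Qed.

Lemma rapid_fourier_vars s S F : uniq (s ++ S) -> rapid (s ++ S) F ->
  rapid S (fourier_vars s F).
Proof. exact: (rapid_foldr rapid_fourier_var). Qed.

Lemma cint_psiC F i j (a b : R) x : i != j -> rapid [:: i; j] F ->
  cint (fun t => psi (a * t) * cint (fun u => psi (b * u) * F (upd (upd x i t) j u))) =
  cint (fun u => psi (b * u) * cint (fun t => psi (a * t) * F (upd (upd x j u) i t))).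
Proof.
move=> ij rF; pose G y := psi (a * y i) * (psi (b * y j) * F y).
have scaled k (c : R) : seqcont (fun y : pt => c * y k).
  by apply: seqcontM; [exact: seqcont_cst|exact: seqcont_coord].
have rG : rapid [:: i; j] G.
  by rewrite /G; apply: rapid_psiM => //; exact: rapid_psiM.
have decay k y c : k \in [:: i; j] ->
    exists K, cquad_decay K (fun t => psi (c * t) * F (upd y k t)).
  move=> k_ij; have [K decayK] := rapid_cquad_decay y k_ij rF.
  by eexists; exact: cquad_decay_psiM decayK.
have ji : j != i by rewrite eq_sym.
transitivity (cint (fun t => cint (fun u => G (upd (upd x i t) j u)))).
  apply: eq_cint => t; have [|K decayK] := decay j (upd x i t) b; first by rewrite !inE eqxx orbT.
  by rewrite -(cintZ _ decayK); apply: eq_cint => u; rewrite /G upd_other// !upd_same.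
rewrite cint_upd_Fubini//; apply: eq_cint => u.
have [|K decayK] := decay i (upd x j u) a; first by rewrite !inE eqxx.
rewrite -(cintZ _ decayK); apply: eq_cint => t.
by rewrite /G upd_same upd_other// upd_same mulrCA.
Qed.

Lemma fourier_varC F i j : i != j -> rapid [:: i; j] F ->
  fourier_var i (fourier_var j F) = fourier_var j (fourier_var i F).
Proof.
move=> ij rF; have ji : j != i by rewrite eq_sym.
apply/funext => x; have := cint_psiC (- x i) (- x j) x ij rF => FG.
transitivity (cint (fun t => psi (- x i * t) *
    cint (fun u => psi (- x j * u) * F (upd (upd x i t) j u)))).
  by apply: eq_cint => t; congr (_ * _); apply: eq_cint => u; rewrite (upd_other _ _ ji).
rewrite FG; apply: eq_cint => u; congr (_ * _); apply: eq_cint => t.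
by rewrite (upd_other _ _ ij).
Qed.

Lemma perm_fourier_vars s s' F : perm_eq s s' -> uniq s -> rapid s F ->
  fourier_vars s F = fourier_vars s' F.
Proof. exact: (perm_foldr rapid_fourier_var fourier_varC). Qed.

Lemma fourier_vars_cons i s F : fourier_vars (i :: s) F = fourier_var i (fourier_vars s F).
Proof. by []. Qed.

Lemma fourier_vars_cat s s' F : fourier_vars (s ++ s') F = fourier_vars s (fourier_vars s' F).
Proof. exact: foldr_cat. Qed.

Lemma fourier_vars_rot i s F : uniq (i :: s) -> rapid (i :: s) F ->
  fourier_vars (i :: s) F = fourier_vars s (fourier_var i F).
Proof.
move=> us rF; rewrite -[RHS](fourier_vars_cat s [:: i]).
by apply: perm_fourier_vars => //; rewrite perm_sym perm_catC.
Qed.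

Lemma fourier_int_varC F i j : i != j -> rapid [:: i; j] F ->
  fourier_var i (int_var j F) = int_var j (fourier_var i F).
Proof.
move=> ij rF; apply/funext => x; have := cint_psiC (- x i) 0 x ij rF.
have psi0M (f : R -> C) : cint (fun t => psi (0 * t) * f t) = cint f.
  by apply: eq_cint => t; rewrite mul0r psi0 mul1r.
rewrite psi0M => FG; rewrite /int_var /fourier_var.
transitivity (cint (fun u => cint (fun t => psi (- x i * t) * F (upd (upd x j u) i t)))).
  by rewrite -FG; apply: eq_cint => t; rewrite psi0M.
by apply: eq_cint => u; apply: eq_cint => t; rewrite (upd_other _ _ ij).
Qed.

Lemma fourier_int_varsC s F i : uniq (i :: s) -> rapid (i :: s) F ->
  fourier_var i (int_vars s F) = int_vars s (fourier_var i F).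
Proof.
elim: s => [//|j s IH] us rF; move: (us); rewrite cons_uniq inE negb_or cons_uniq.
move=> /andP[/andP[ij is_] /andP[js us']].
have int_vars_consE G : int_vars (j :: s) G = int_var j (int_vars s G) by [].
rewrite !int_vars_consE -IH ?cons_uniq ?is_//; last first.
  by apply: rapidS rF => k; rewrite !inE => /orP[->//|->]; rewrite !orbT.
apply: fourier_int_varC => //; apply: rapid_int_vars.
  by rewrite uniq_catC /= inE negb_or ij is_ js.
by apply: rapidS rF => k; rewrite mem_cat !inE => /orP[->|/orP[->|->]]; rewrite ?orbT.
Qed.

Lemma rapid_psi_linear S F s (c : I -> R) : rapid S F ->
  rapid S (fun x => psi (\sum_(i <- s) c i * x i) * F x).
Proof.
apply: rapid_psiM; apply: seqcont_sum => i _.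
by apply: seqcontM; [exact: seqcont_cst|exact: seqcont_coord].
Qed.

Lemma int_vars_psi_linear i s F (c : I -> R) x t : uniq (i :: s) -> rapid s F ->
  int_vars s (fun y => psi (\sum_(j <- i :: s) c j * y j) * F y) (upd x i t) =
  psi (c i * t) * int_vars s (fun y => psi (\sum_(j <- s) c j * y j) * F y) (upd x i t).
Proof.
move=> /andP[is_ us] rF.
have -> : psi (c i * t) = psi (c i * upd x i t i) by rewrite upd_same.
rewrite -(int_varsZ (c := fun y => psi (c i * y i)))//; last 2 first.
- exact: rapid_psi_linear.
- by move=> y j u js; rewrite upd_other//; apply: contraNneq is_ => ->.
by congr (int_vars s _ _); apply/funext => y; rewrite mulrA -psiD big_cons.
Qed.

Lemma fourier_varsE s F z : uniq s -> rapid s F ->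
  fourier_vars s F z = int_vars s (fun x => psi (- (\sum_(i <- s) z i * x i)) * F x) z.
Proof.
have sumN r y : - (\sum_(i <- r) z i * y i) = \sum_(i <- r) (- z i) * y i.
  by rewrite -sumrN; apply: eq_bigr => i _; rewrite mulNr.
move=> us rF; under [fun x => _]eq_fun do rewrite sumN.
elim: s z us rF {sumN} => [|i s IH] z us rF.
  by rewrite /fourier_vars /int_vars /= big_nil psi0 mul1r.
have rFs : rapid s F by apply: rapidS rF => j js; rewrite inE js orbT.
rewrite int_vars_cons fourier_vars_cons; apply: eq_cint => t.
have /andP[is_ us'] := us; rewrite int_vars_psi_linear// IH//; congr (_ * int_vars s _ _).
apply/funext => y; congr (psi _ * _); apply: eq_big_seq => j js.
by rewrite upd_other//; apply: contraNneq is_ => <-.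
Qed.

Lemma fourier_vars_eq_on s F x y : uniq s -> rapid s F ->
  (forall z z', (forall i, i \in s -> z i = z' i) -> F z = F z') ->
  (forall i, i \in s -> x i = y i) -> fourier_vars s F x = fourier_vars s F y.
Proof.
move=> us rF Fs xy; rewrite !fourier_varsE//.
have -> : (fun z => psi (- \sum_(i <- s) x i * z i) * F z) =
    (fun z => psi (- \sum_(i <- s) y i * z i) * F z).
  by apply/funext => z; congr (psi (- _) * _); apply: eq_big_seq => i /xy ->.
apply: int_vars_agree => z z' zz'; congr (psi (- _) * _); last exact: Fs.
by apply: eq_big_seq => i /zz' ->.
Qed.

Lemma fourier_varsZ s F (c : pt -> C) : uniq s -> rapid s F ->
  (forall x i t, i \in s -> c (upd x i t) = c x) ->
  fourier_vars s (fun x => c x * F x) = fun x => c x * fourier_vars s F x.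
Proof.
elim: s => [//|i s IH] us rF cc; have /andP[_ us'] := us.
rewrite !fourier_vars_cons IH//; last 2 first.
- by apply: rapidS rF => j js; rewrite inE js orbT.
- by move=> x j t js; apply: cc; rewrite inE js orbT.
apply/funext => x.
have [|K decayK] := @rapid_cquad_decay _ _ [:: i] (fourier_vars s F) i x (mem_head _ _).
  apply: rapid_fourier_vars; first by rewrite uniq_catC.
  by apply: rapidS rF => j; rewrite mem_cat !inE orbC.
rewrite -(cintZ _ (cquad_decay_psiM hbar (- x i) decayK)).
by apply: eq_cint => t; rewrite cc ?mem_head// mulrCA.
Qed.

Definition fourier_rapid S F :=
  forall T, uniq T -> {subset T <= S} -> rapid S (fourier_vars T F).

Lemma fourier_rapid_rapid S F : fourier_rapid S F -> rapid S F.
Proof. by move=> /(_ [::]); apply. Qed.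

Lemma fourier_rapidZ S (c : C) F : uniq S -> fourier_rapid S F ->
  fourier_rapid S (fun x => c * F x).
Proof.
move=> uS rF T uT TS; rewrite (fourier_varsZ (c := fun=> c))//; first exact/rapidZ/rF.
exact: rapidS TS (fourier_rapid_rapid rF).
Qed.

Lemma fourier_rapid_vars S T T' F : uniq (T' ++ T) -> {subset T <= S} -> {subset T' <= S} ->
  fourier_rapid S F -> rapid S (fourier_vars T' (fourier_vars T F)).
Proof.
move=> uT TS T'S rF; rewrite -fourier_vars_cat; apply: rF => // j.
by rewrite mem_cat => /orP[/T'S|/TS].
Qed.

Lemma fourier_rapid_var i S F : i \notin S -> fourier_rapid (i :: S) F ->
  fourier_rapid S (fourier_var i F).
Proof.
move=> iS rF T uT TS; have SS : {subset S <= i :: S} by move=> j jS; rewrite inE jS orbT.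
apply: (rapidS SS); apply: (fourier_rapid_vars (T := [:: i])) => //.
- by rewrite uniq_catC /= uT andbT; apply: contra iS => /TS.
- by move=> j; rewrite !inE => ->.
- by move=> j /TS; exact: SS.
Qed.

Hypothesis hbar0 : hbar != 0.

Lemma fourier_var_inversion i F x (c : R) : rapid [:: i] F -> rapid [:: i] (fourier_var i F) ->
  (`|hbar| / (2 * pi))%:C * cint (fun t => psi (c * t) * fourier_var i F (upd x i t)) =
  F (upd x i c).
Proof.
move=> rF rFh; have [K decayK] := rapid_cquad_decay x (mem_head i [::]) rF.
have [K' decayK'] := rapid_cquad_decay x (mem_head i [::]) rFh.
have slice (z : R) : fourier_var i F (upd x i z) = cint (fun t => psi (- z * t) * F (upd x i t)).
  by rewrite /fourier_var upd_same; apply: eq_cint => t; rewrite upd_upd.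
have decay_hat : cquad_decay K' (fun z : R => cint (fun t => psi (- z * t) * F (upd x i t))).
  by move: decayK'; congr cquad_decay; apply/funext => t; exact: slice.
by rewrite -(fourier_inversion hbar0 c decayK decay_hat); under eq_cint do rewrite slice.
Qed.

Lemma fourier_vars_inversion s F (c : pt) x : uniq s -> fourier_rapid s F ->
  ((`|hbar| / (2 * pi)) ^+ size s)%:C *
    int_vars s (fun y => psi (\sum_(i <- s) c i * y i) * fourier_vars s F y) x =
  F (fun j => if j \in s then c j else x j).
Proof.
elim: s F x => [|i s IH] F x us rF.
  by rewrite /fourier_vars /int_vars /= expr0 mul1r big_nil psi0 mul1r.
have /andP[is_ us'] := us; have rFi := fourier_rapid_var is_ rF.
have r1 : {subset [:: i] <= i :: s} by move=> j; rewrite !inE => ->.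
rewrite (fourier_vars_rot us (fourier_rapid_rapid rF)) exprS rmorphM -mulrA.
pose G y := psi (\sum_(j <- i :: s) c j * y j) * fourier_vars s (fourier_var i F) y.
have [K decayK] : exists K, cquad_decay K (fun t => int_vars s G (upd x i t)).
  apply: rapid_cquad_decay (mem_head _ _) (rapid_int_vars_rem us _).
  apply: rapid_psi_linear; rewrite -(fourier_vars_rot us (fourier_rapid_rapid rF)).
  exact: rF.
rewrite int_vars_cons -(cintZ _ decayK).
pose xc j := if j \in s then c j else x j.
have -> : (fun j => if j \in i :: s then c j else x j) = upd xc i (c i).
  by apply/funext => j; rewrite /upd /xc inE; case: eqP => [->|].
rewrite -fourier_var_inversion.
- congr (_ * _); apply: eq_cint => t.
  rewrite /G int_vars_psi_linear//; last exact: (rFi s us').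
  rewrite mulrCA IH//; congr (_ * fourier_var i F _).
  by apply/funext => j; rewrite /upd /xc; case: eqP => [->|//]; rewrite (negPf is_).
- exact: rapidS r1 (fourier_rapid_rapid rF).
- exact: rapidS r1 (rF [:: i] isT r1).
Qed.

End PartialFourier.
Arguments fourier_vars {R} hbar {I} s F x : simpl never.

(** * Triangular factorizations in coordinates *)

Section Slots.
Variable n : nat.
Implicit Types (i j k : nat) (p q : nat * nat).

Definition in_block k p := (k <= p.1 < n)%N && (k <= p.2 < n)%N.
Definition block k := [seq (i, j) | i <- index_iota k n, j <- index_iota k n].
Definition offdiag k := [seq p <- block k | p.1 != p.2].
Definition diagonal k := [seq (i, i) | i <- index_iota k n].
Definition pivot_row k := [seq (k, j) | j <- index_iota k.+1 n].
Definition pivot_col k := [seq (i, k) | i <- index_iota k.+1 n].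
Definition cross k := pivot_row k ++ pivot_col k.

Lemma mem_block k p : (p \in block k) = in_block k p.
Proof.
apply/allpairsP/idP => [[[i j] /= [i_ j_ ->]]|/andP[]].
  by rewrite /in_block /= -!mem_index_iota i_ j_.
by rewrite -!mem_index_iota => p1 p2; exists p; rewrite p1 p2; case: p {p1 p2}.
Qed.

Lemma mem_offdiag k p : (p \in offdiag k) = (p.1 != p.2) && in_block k p.
Proof. by rewrite mem_filter mem_block. Qed.

Lemma mem_diagonal k p : (p \in diagonal k) = (p.1 == p.2) && (k <= p.1 < n)%N.
Proof.
apply/mapP/andP => [[j + ->]|[/eqP pk pj]]; first by rewrite mem_index_iota eqxx.
by exists p.1; rewrite ?mem_index_iota//; case: p pk {pj} => i j /= ->.
Qed.

Lemma mem_pivot_row k p : (p \in pivot_row k) = (p.1 == k) && (k < p.2 < n)%N.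
Proof.
apply/mapP/andP => [[j + ->]|[/eqP pk pj]]; first by rewrite mem_index_iota eqxx.
by exists p.2; rewrite ?mem_index_iota//; case: p pk {pj} => i j /= ->.
Qed.

Lemma mem_pivot_col k p : (p \in pivot_col k) = (p.2 == k) && (k < p.1 < n)%N.
Proof.
apply/mapP/andP => [[j + ->]|[/eqP pk pj]]; first by rewrite mem_index_iota eqxx.
by exists p.1; rewrite ?mem_index_iota//; case: p pk {pj} => i j /= ->.
Qed.

Lemma mem_cross k p :
  (p \in cross k) = (p.1 == k) && (k < p.2 < n)%N || (p.2 == k) && (k < p.1 < n)%N.
Proof. by rewrite mem_cat mem_pivot_row mem_pivot_col. Qed.

Definition mem_slots :=
  (mem_block, mem_offdiag, mem_diagonal, mem_pivot_row, mem_pivot_col, mem_cross).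

Lemma uniq_block k : uniq (block k).
Proof. by apply: allpairs_uniq; rewrite ?iota_uniq// => -[i j] [i' j'] _ _ /= []-> ->. Qed.

Lemma uniq_offdiag k : uniq (offdiag k).
Proof. exact/filter_uniq/uniq_block. Qed.

Lemma uniq_diagonal k : uniq (diagonal k).
Proof. by rewrite map_inj_uniq ?iota_uniq// => i j []. Qed.

Lemma uniq_pivot_row k : uniq (pivot_row k).
Proof. by rewrite map_inj_uniq ?iota_uniq// => i j []. Qed.

Lemma uniq_pivot_col k : uniq (pivot_col k).
Proof. by rewrite map_inj_uniq ?iota_uniq// => i j []. Qed.

Lemma uniq_cross k : uniq (cross k).
Proof.
rewrite cat_uniq uniq_pivot_row uniq_pivot_col andbT /=; apply/hasPn => p.
by rewrite !mem_slots; lia.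
Qed.

Lemma uniq_cross_block k : uniq (cross k ++ block k.+1).
Proof.
rewrite cat_uniq uniq_cross uniq_block andbT /=; apply/hasPn => p.
by rewrite !mem_slots /in_block; lia.
Qed.

Lemma perm_block k : (k < n)%N -> perm_eq (block k) ((k, k) :: cross k ++ block k.+1).
Proof.
move=> kn; apply: uniq_perm; first exact: uniq_block.
  by rewrite cons_uniq uniq_cross_block andbT mem_cat !mem_slots /in_block /=; lia.
by move=> [i j]; rewrite inE mem_cat !mem_slots /in_block /= xpair_eqE; lia.
Qed.

Lemma perm_offdiag k : (k < n)%N -> perm_eq (offdiag k) (offdiag k.+1 ++ cross k).
Proof.
move=> kn; apply: uniq_perm; first exact: uniq_offdiag.
  rewrite cat_uniq uniq_offdiag uniq_cross andbT /=; apply/hasPn => p.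
  by rewrite !mem_slots /in_block; lia.
by move=> [i j]; rewrite mem_cat !mem_slots /in_block /=; lia.
Qed.

Lemma diagonal_cons k : (k < n)%N -> diagonal k = (k, k) :: diagonal k.+1.
Proof. by move=> kn; rewrite /diagonal /index_iota -{1}(subnSK kn). Qed.

Lemma sub_blockS k : {subset block k.+1 <= block k}.
Proof. by move=> p; rewrite !mem_slots /in_block; lia. Qed.

Lemma sub_cross_block k : (k < n)%N -> {subset cross k <= block k}.
Proof. by move=> kn p; rewrite !mem_slots /in_block; lia. Qed.

Lemma sub_offdiag_block k : {subset offdiag k <= block k}.
Proof. by move=> p; rewrite !mem_slots => /andP[]. Qed.

Lemma sub_offdiagS k : {subset offdiag k.+1 <= offdiag k}.
Proof. by move=> p; rewrite !mem_slots /in_block; lia. Qed.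

Lemma sub_cross_offdiag k : (k < n)%N -> {subset cross k <= offdiag k}.
Proof. by move=> kn p; rewrite !mem_slots /in_block; lia. Qed.

Lemma pivot_notin_offdiag k : (k, k) \notin offdiag k.
Proof. by rewrite mem_offdiag /= eqxx. Qed.

Lemma cross_notin_block k p : p \in cross k -> forall q, in_block k.+1 q -> q != p.
Proof.
move=> pk q; rewrite /in_block => qk; apply: contraTneq pk => <-; rewrite mem_cross; lia.
Qed.

End Slots.

Section TriangularFactorizations.
Variables (R : realType) (n : nat) (b : nat -> R).
Local Notation pt := ((nat * nat)%type -> R).
Local Notation offdiag := (offdiag n).
Local Notation in_block := (in_block n).
Implicit Types (x y : pt) (p q : (nat * nat)%type) (i j k r : nat) (d : nat -> R).

(* The entries of the unipotent triangular matrices encoded by the offdiagonal entries of [x]. *)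
Definition upper x i j : R := if (i < j)%N then x (i, j) else (i == j)%:R.
Definition lower x i j : R := if (j < i)%N then x (i, j) else (i == j)%:R.

(* On the indices [k <= i < n], the product of an upper triangular matrix, [diag b] and a lower
   triangular one; respectively of a lower triangular matrix, the diagonal of [x] and an upper
   triangular one, both triangular factors being stored transposed. *)
Definition UDL k x : pt := fun p =>
  if in_block k p then \sum_(k <= q < n) upper x p.1 q * b q * lower x q p.2 else x p.
Definition LDU k x : pt := fun p =>
  if in_block k p then \sum_(k <= q < n) upper x q p.1 * x (q, q) * lower x p.2 q else x p.

Lemma upper_diag x i : upper x i i = 1. Proof. by rewrite /upper ltnn eqxx. Qed.
Lemma lower_diag x i : lower x i i = 1. Proof. by rewrite /lower ltnn eqxx. Qed.

Lemma upper_lt x i j : (i < j)%N -> upper x i j = x (i, j). Proof. by rewrite /upper => ->. Qed.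
Lemma lower_gt x i j : (j < i)%N -> lower x i j = x (i, j). Proof. by rewrite /lower => ->. Qed.

Lemma upper_gt x i j : (j < i)%N -> upper x i j = 0.
Proof. by move=> ji; rewrite /upper ltnNge ltnW//= gtn_eqF. Qed.

Lemma lower_lt x i j : (i < j)%N -> lower x i j = 0.
Proof. by move=> ji; rewrite /lower ltnNge ltnW//= ltn_eqF. Qed.

Lemma seqcont_upper i j : seqcont (fun x => upper x i j).
Proof. by rewrite /upper; case: ltnP => _; [exact: seqcont_coord|exact: seqcont_cst]. Qed.

Lemma seqcont_lower i j : seqcont (fun x => lower x i j).
Proof. by rewrite /lower; case: ltnP => _; [exact: seqcont_coord|exact: seqcont_cst]. Qed.

Lemma seqcont_UDL k p : seqcont (fun x => UDL k x p).
Proof.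
rewrite /UDL; case: (in_block k p); last exact: seqcont_coord.
apply: seqcont_sum => q _; apply: seqcontM; last exact: seqcont_lower.
by apply: seqcontM; [exact: seqcont_upper|exact: seqcont_cst].
Qed.

Lemma seqcont_LDU k p : seqcont (fun x => LDU k x p).
Proof.
rewrite /LDU; case: (in_block k p); last exact: seqcont_coord.
apply: seqcont_sum => q _; apply: seqcontM; last exact: seqcont_lower.
by apply: seqcontM; [exact: seqcont_upper|exact: seqcont_coord].
Qed.

Lemma upper_upd x i j p t : (i, j) != p -> upper (upd x p t) i j = upper x i j.
Proof. by rewrite /upper; case: ltnP => // _ ijp; rewrite upd_other. Qed.

Lemma lower_upd x i j p t : (i, j) != p -> lower (upd x p t) i j = lower x i j.
Proof. by rewrite /lower; case: ltnP => // _ ijp; rewrite upd_other. Qed.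

Lemma UDL_upd k x p t : (forall q, in_block k q -> q != p) ->
  UDL k (upd x p t) = upd (UDL k x) p t.
Proof.
move=> kp; apply/funext => q; rewrite /UDL; case: ifPn => kq; last first.
  by rewrite /upd; case: eqP => // _; rewrite (negPf kq).
rewrite upd_other ?kp// kq; apply: eq_big_nat => r kr.
by rewrite upper_upd ?lower_upd// kp//; move: kq kr; rewrite /in_block /=; lia.
Qed.

Lemma LDU_upd k x p t : (forall q, in_block k q -> q != p) ->
  LDU k (upd x p t) = upd (LDU k x) p t.
Proof.
move=> kp; apply/funext => q; rewrite /LDU; case: ifPn => kq; last first.
  by rewrite /upd; case: eqP => // _; rewrite (negPf kq).
rewrite upd_other ?kp// kq; apply: eq_big_nat => r kr.
have rr : in_block k (r, r) by rewrite /in_block /= kr.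
by rewrite upper_upd ?lower_upd ?upd_other// kp//; move: kq kr; rewrite /in_block /=; lia.
Qed.

Lemma UDL_upd_diag k x r t : in_block k (r, r) -> UDL k (upd x (r, r) t) = UDL k x.
Proof.
move=> kr; apply/funext => p; rewrite /UDL; case: ifPn => kp.
  apply: eq_bigr => q _; rewrite /upper /lower.
  by case: ltnP => pq; case: ltnP => qp //; rewrite !upd_other// xpair_eqE; lia.
by rewrite upd_other//; apply: contraNneq kp => ->.
Qed.

Lemma UDL_maxn k x p : in_block k p -> let m := maxn p.1 p.2 in
  UDL k x p = b m * (if p.1 == p.2 then 1 else x p) +
    \sum_(m.+1 <= r < n) b r * (x (p.1, r) * x (r, p.2)).
Proof.
move=> kp; rewrite /UDL kp; case: p kp => i j; rewrite /in_block /= => ij.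
rewrite (big_cat_nat (n := maxn i j)) /=; [|lia|lia].
rewrite [X in X + _]big_nat_cond [X in X + _]big1 => [|q /andP[/andP[_ qij] _]]; last first.
  have [qi|qj] : (q < i)%N \/ (q < j)%N by lia.
    by rewrite upper_gt// !mul0r.
  by rewrite lower_lt// mulr0.
rewrite add0r big_ltn; last by lia.
congr (_ + _); last first.
  by apply: eq_big_nat => r ijr; rewrite upper_lt ?lower_gt; [ring|lia..].
case: (ltngtP i j) => [lt_ij|lt_ji|->]; last by rewrite upper_diag lower_diag mul1r.
  by rewrite upper_lt// lower_diag mulr1 mulrC.
by rewrite upper_diag lower_gt// mul1r.
Qed.

Lemma LDU_minn k x p : in_block k p -> let m := minn p.1 p.2 in
  LDU k x p = x (m, m) * (if p.1 == p.2 then 1 else x (p.2, p.1)) +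
    \sum_(k <= r < m) x (r, r) * (x (r, p.1) * x (p.2, r)).
Proof.
move=> kp; rewrite /LDU kp; case: p kp => i j; rewrite /in_block /= => ij.
rewrite (big_cat_nat (n := (minn i j).+1)) /=; [|lia|lia].
rewrite [X in _ + X]big_nat_cond [X in _ + X]big1 => [|q /andP[/andP[ijq _] _]]; last first.
  have [iq|jq] : (i < q)%N \/ (j < q)%N by lia.
    by rewrite upper_gt// !mul0r.
  by rewrite lower_lt// mulr0.
rewrite addr0 big_nat_recr /=; last by lia.
rewrite addrC; congr (_ + _); last first.
  by apply: eq_big_nat => r ijr; rewrite upper_lt ?lower_gt; [ring|lia..].
case: (ltngtP i j) => [lt_ij|lt_ji|->]; last by rewrite upper_diag lower_diag mul1r.
  by rewrite upper_diag lower_gt// mul1r.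
by rewrite upper_lt// lower_diag mulr1 mulrC.
Qed.

Lemma UDL_blockS k x p : in_block k.+1 p -> UDL k x p = UDL k.+1 x p.
Proof.
move=> kp; rewrite /UDL kp ifT; last by move: kp; rewrite /in_block; lia.
move: kp; rewrite /in_block => kp; rewrite big_ltn; last by lia.
by rewrite upper_gt ?mul0r ?add0r//; lia.
Qed.

Lemma UDL_row k x j : (k < j < n)%N ->
  UDL k x (k, j) = \sum_(k.+1 <= q < n) x (k, q) * b q * lower x q j.
Proof.
move=> kj; rewrite /UDL ifT /=; last by rewrite /in_block /=; lia.
rewrite big_ltn /=; last by lia.
rewrite lower_lt ?mulr0 ?add0r; last by lia.
by apply: eq_big_nat => q kq; rewrite upper_lt//; lia.
Qed.

Lemma UDL_col k x i : (k < i < n)%N ->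
  UDL k x (i, k) = \sum_(k.+1 <= q < n) upper x i q * b q * x (q, k).
Proof.
move=> ki; rewrite /UDL ifT /=; last by rewrite /in_block /=; lia.
rewrite big_ltn /=; last by lia.
rewrite upper_gt ?mul0r ?add0r; last by lia.
by apply: eq_big_nat => q kq; rewrite lower_gt//; lia.
Qed.

Lemma UDL_pivot_entry k y : (k < n)%N ->
  UDL k y (k, k) = b k + \sum_(k.+1 <= j < n) y (k, j) * b j * y (j, k).
Proof.
move=> kn; rewrite UDL_maxn /in_block /= ?maxnn ?leqnn ?kn// eqxx mulr1; congr (_ + _).
by apply: eq_bigr => j _; ring.
Qed.

Lemma UDL_inverse k : (forall i, (i < n)%N -> b i != 0) ->
  {in offdiag k, forall p, poly_recovers [in offdiag k] (UDL k) p}.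
Proof.
move=> b0; apply: (poly_recovers_rec (rank := fun p => n - maxn p.1 p.2)%N).
move=> [i j]; rewrite mem_offdiag => /andP[/= ij kij].
exists (b (maxn i j))^-1, (i, j); first by rewrite unfold_in mem_offdiag ij.
exists [seq (b r, ((i, r), (r, j))) | r <- index_iota (maxn i j).+1 n] => [t|x].
  move=> /mapP[r]; rewrite mem_index_iota => mr -> /=; rewrite !mem_offdiag.
  by move: kij; rewrite /in_block /=; split; lia.
rewrite big_map UDL_maxn//= (negPf ij) addrK mulKf//; apply: b0.
by move: kij; rewrite /in_block /=; lia.
Qed.

Definition set_diag d x : pt := fun p => if p.1 == p.2 then d p.1 else x p.

Lemma set_diagE d x i : set_diag d x (i, i) = d i. Proof. by rewrite /set_diag /= eqxx. Qed.

Lemma set_diag_offdiag d x p : p.1 != p.2 -> set_diag d x p = x p.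
Proof. by rewrite /set_diag => /negPf ->. Qed.

Lemma set_diag_id x : set_diag (fun i => x (i, i)) x = x.
Proof. by apply/funext => -[i j]; rewrite /set_diag /=; case: eqP => [->|]. Qed.

Lemma set_diag_upd d x p t : p.1 != p.2 -> set_diag d (upd x p t) = upd (set_diag d x) p t.
Proof.
move=> p12; apply/funext => q; rewrite /set_diag /upd.
by have [->|//] := eqVneq q p; rewrite (negPf p12).
Qed.

Lemma seqcont_set_diag d p : seqcont (fun x => set_diag d x p).
Proof. by rewrite /set_diag; case: eqP => _; [exact: seqcont_cst|exact: seqcont_coord]. Qed.

Lemma int_vars_set_diag (s : seq (nat * nat)) (F : pt -> R[i]) x :
  (forall p, p \in s -> p.1 != p.2) ->
  int_vars s (fun y => F (set_diag (fun i => x (i, i)) y)) x = int_vars s F x.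
Proof.
move=> s_off; rewrite -(int_vars_comm (Phi := set_diag _)) ?set_diag_id// => y p t /s_off.
exact: set_diag_upd.
Qed.

Lemma LDU_inverse k d : (forall i, (k <= i < n)%N -> d i != 0) ->
  {in offdiag k, forall p, poly_recovers [in offdiag k] (fun x => LDU k (set_diag d x)) p}.
Proof.
move=> d0; apply: (poly_recovers_rec (rank := fun p => minn p.1 p.2)).
move=> [i j]; rewrite mem_offdiag => /andP[/= ij kij].
have kji : in_block k (j, i) by move: kij; rewrite /in_block andbC.
exists (d (minn j i))^-1, (j, i); first by rewrite unfold_in mem_offdiag /= eq_sym ij.
exists [seq (d r, ((r, j), (i, r))) | r <- index_iota k (minn j i)] => [t|x].
  move=> /mapP[r]; rewrite mem_index_iota => mr -> /=; rewrite !mem_offdiag.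
  by move: kij; rewrite /in_block /=; split; lia.
rewrite big_map LDU_minn//= eq_sym (negPf ij) set_diagE set_diag_offdiag//=.
have -> : \sum_(k <= r < minn j i)
    set_diag d x (r, r) * (set_diag d x (r, j) * set_diag d x (i, r)) =
    \sum_(k <= r < minn j i) d r * (x (r, j) * x (i, r)).
  by apply: eq_big_nat => r mr; rewrite set_diagE !set_diag_offdiag//=; lia.
by rewrite addrK mulKf//; apply: d0; move: kij; rewrite /in_block /=; lia.
Qed.

End TriangularFactorizations.
Section PivotElimination.
Variables (R : realType) (hbar : R) (n : nat).
Local Notation C := R[i].
Local Notation slot := (nat * nat)%type.
Local Notation pt := (slot -> R).
Local Notation psi := (@psi R hbar).
Local Notation fourier_var := (@fourier_var R hbar slot).
Local Notation fourier_vars := (@fourier_vars R hbar slot).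
Local Notation fourier_rapid := (@fourier_rapid R hbar slot).
Local Notation block := (block n).
Local Notation cross := (cross n).
Implicit Types (x y : pt) (p q : slot) (F h : pt -> C) (T : seq slot) (k : nat) (a : R).

Definition next_ind k (j : nat) : R := (j == k.+1)%:R.
Definition adjacent_at k x : R := \sum_(k.+1 <= j < n) next_ind k j * (x (k, j) + x (j, k)).

Lemma sum_next_ind k (f : nat -> R) : \sum_(k.+1 <= j < n) next_ind k j * f j =
  if (k.+1 < n)%N then f k.+1 else 0.
Proof.
case: ifPn => kn1; last by rewrite big_geq// leqNgt.
rewrite big_ltn// /next_ind eqxx mul1r big1_seq ?addr0// => j; rewrite mem_index_iota => kj.
by rewrite gtn_eqF ?mul0r//; lia.
Qed.

Lemma seqcont_adjacent_at k : seqcont (adjacent_at k).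
Proof.
apply: seqcont_sum => j _; apply: seqcontM; first exact: seqcont_cst.
by apply: seqcontD; exact: seqcont_coord.
Qed.

(* [eliminate k a [::]] is one step of Gaussian elimination, from [LDU k.+1] to [LDU k] with pivot
   [a]; in the coordinates [T], which have been Fourier transformed, the translation is left out
   and becomes a phase. *)
Definition eliminate k a T x : pt := fun p =>
  if p == (k, k) then a else
  if p \in cross k then a * x (p.2, p.1) else
  if (p \in block k.+1) && (p \notin T) then x p + a * (x (k, p.1) * x (p.2, k)) else x p.
Definition elim_phase k a T x : R :=
  - adjacent_at k x + a * \sum_(p <- T) x p * (x (k, p.1) * x (p.2, k)).
Definition elim_integrand k a T F x : C := psi (elim_phase k a T x) * F (eliminate k a T x).
Definition elim_int k a h : pt -> C := int_vars (cross k) (elim_integrand k a [::] h).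

Lemma eliminate_cross k a T x p : p \in cross k -> eliminate k a T x p = a * x (p.2, p.1).
Proof.
move=> pk; rewrite /eliminate pk ifF//.
by case: p pk => i j; rewrite mem_cross xpair_eqE /=; lia.
Qed.

Lemma eliminate_block k a T x p : p \in block k.+1 ->
  eliminate k a T x p = x p + (p \notin T)%:R * (a * (x (k, p.1) * x (p.2, k))).
Proof.
move=> pk; rewrite /eliminate ifF; last first.
  by case: p pk => i j; rewrite mem_block /in_block xpair_eqE /=; lia.
rewrite ifF; last by move: pk; rewrite !mem_slots /in_block; lia.
by rewrite pk /=; case: (p \in T) => /=; rewrite ?mul1r// mul0r addr0.
Qed.

Lemma seqcont_eliminate k a T p : seqcont (fun x => eliminate k a T x p).
Proof.
have scaled g : seqcont g -> seqcont (fun x : pt => a * g x).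
  by move=> cg; apply: seqcontM => //; exact: seqcont_cst.
rewrite /eliminate; case: (p == _); first exact: seqcont_cst.
case: (p \in cross k); first exact/scaled/seqcont_coord.
case: (_ && _); last exact: seqcont_coord.
apply: seqcontD; first exact: seqcont_coord.
by apply/scaled/seqcontM; exact: seqcont_coord.
Qed.

Lemma seqcont_elim_phase k a T : seqcont (elim_phase k a T).
Proof.
apply: seqcontD; first exact/seqcontN/seqcont_adjacent_at.
apply: seqcontM; first exact: seqcont_cst.
apply: seqcont_sum => p _; apply: seqcontM; first exact: seqcont_coord.
by apply: seqcontM; exact: seqcont_coord.
Qed.

Lemma upd_block_cross k x p t i : p \in block k.+1 ->
  (upd x p t (k, i) = x (k, i)) * (upd x p t (i, k) = x (i, k)).
Proof.
by case: p => r s; rewrite mem_block /in_block /= => rs; split; apply: upd_other;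
  rewrite xpair_eqE; lia.
Qed.

Lemma eliminate_upd k a T x p t : p \in block k.+1 -> p \notin T ->
  eliminate k a T (upd x p t) =
  upd (eliminate k a (p :: T) x) p (t + a * (x (k, p.1) * x (p.2, k))).
Proof.
move=> pk pT; apply/funext => q; have [->|qp] := eqVneq q p.
  by rewrite eliminate_block// !upd_same !(upd_block_cross _ _ _ pk) pT mul1r.
rewrite [RHS]upd_other// /eliminate inE (negPf qp) /=; case: ifP => // _.
case: ifP => [|_]; last by rewrite !(upd_block_cross _ _ _ pk) !upd_other.
rewrite mem_cross => qk; rewrite upd_other//.
by case: q p pk qk {qp pT} => [i j] [r s]; rewrite mem_block /in_block xpair_eqE /=; lia.
Qed.

Lemma elim_phase_upd k a T x p t : p \in block k.+1 -> p \notin T ->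
  elim_phase k a T (upd x p t) = elim_phase k a T x.
Proof.
move=> pk pT; congr (- _ + a * _).
  by apply: eq_bigr => j _; rewrite !(upd_block_cross _ _ _ pk).
apply: eq_big_seq => q qT; rewrite !(upd_block_cross _ _ _ pk) upd_other//.
by apply: contraNneq pT => <-.
Qed.

Lemma poly_recovers_eliminate k a T p : (k < n)%N -> a != 0 -> p \in cross k ++ block k.+1 ->
  poly_recovers [in block k] (eliminate k a T) p.
Proof.
move=> kn a0.
have from_cross q : q \in cross k -> forall x, x (q.2, q.1) = a^-1 * eliminate k a T x q.
  by move=> qk x; rewrite eliminate_cross// mulKf.
have crossP i j : (i, j) \in cross k -> poly_fun (R := R) [in block k] (fun y => a^-1 * y (i, j)).
  move=> ij; apply: poly_funM; first exact: poly_fun_cst.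
  by apply: poly_fun_coord; exact: sub_cross_block.
rewrite mem_cat; case: p => i j; have [ij _|_ /= ij] := boolP ((i, j) \in cross k).
  have ji : (j, i) \in cross k by move: ij; rewrite !mem_cross /=; lia.
  by exists (fun y => a^-1 * y (j, i)) => [|x]; [exact: crossP|exact: (from_cross (j, i))].
have [ki jk] : (i, k) \in cross k /\ (k, j) \in cross k.
  by move: ij; rewrite !mem_slots /in_block /=; split; lia.
exists (fun y => y (i, j) - ((i, j) \notin T)%:R * (a * ((a^-1 * y (i, k)) * (a^-1 * y (k, j))))).
  apply: poly_funD; first by apply: poly_fun_coord; exact: sub_blockS.
  apply: poly_funN; apply: poly_funM; first exact: poly_fun_cst.
  apply: poly_funM; first exact: poly_fun_cst.
  by apply: poly_funM; exact: crossP.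
by move=> x; rewrite eliminate_block//= (from_cross _ ki) (from_cross _ jk) addrK.
Qed.

Lemma rapid_elim_integrand k a T F : (k < n)%N -> a != 0 -> rapid (block k) F ->
  rapid (cross k ++ block k.+1) (elim_integrand k a T F).
Proof.
move=> kn a0 rF; apply: rapid_psiM; first exact: seqcont_elim_phase.
apply: rapid_comp rF => [p|p pk]; first exact: seqcont_eliminate.
exact: poly_recovers_eliminate.
Qed.

Lemma fourier_var_elim_integrand k a T F p : p \in block k.+1 -> p \notin T ->
  rapid (block k) F ->
  fourier_var p (elim_integrand k a T F) = elim_integrand k a (p :: T) (fourier_var p F).
Proof.
move=> pk pT rF; apply/funext => x; set y := eliminate k a (p :: T) x.
have [K decayK] := rapid_cquad_decay y (sub_blockS pk) rF.
have yp : y p = x p by rewrite /y eliminate_block// mem_head mul0r addr0.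
pose c := a * (x (k, p.1) * x (p.2, k)).
rewrite /elim_integrand -/y {2}/fourier_var yp.
have -> : elim_phase k a (p :: T) x = elim_phase k a T x + x p * c.
  by rewrite /elim_phase big_cons /c; ring.
rewrite -(fourier_translate hbar (x p) c _ decayK); apply: eq_cint => t.
by rewrite elim_phase_upd// eliminate_upd// mulrA -psiD addrC mulNr.
Qed.

Lemma fourier_vars_elim_int k a h T : (k < n)%N -> a != 0 -> fourier_rapid (block k) h ->
  uniq T -> {subset T <= block k.+1} ->
  fourier_vars T (elim_int k a h) = int_vars (cross k) (elim_integrand k a T (fourier_vars T h)).
Proof.
move=> kn a0 rh; elim: T => [//|p T IH] /andP[pT uT] TS.
have TS' : {subset T <= block k.+1} by move=> q qT; apply: TS; rewrite inE qT orbT.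
have pk : p \in block k.+1 by apply: TS; rewrite mem_head.
have rTh : rapid (block k) (fourier_vars T h) by apply: rh => // q /TS'/sub_blockS.
have p_cross : p \notin cross k by move: pk; rewrite !mem_slots /in_block; lia.
rewrite !fourier_vars_cons IH// fourier_int_varsC ?cons_uniq ?p_cross ?uniq_cross//.
  by rewrite (fourier_var_elim_integrand _ pk pT rTh).
apply: rapidS (rapid_elim_integrand T kn a0 rTh) => q.
by rewrite in_cons => /predU1P[->|qk]; rewrite mem_cat ?pk ?orbT// qk.
Qed.

Lemma fourier_rapid_elim_int k a h : (k < n)%N -> a != 0 -> fourier_rapid (block k) h ->
  fourier_rapid (block k.+1) (elim_int k a h).
Proof.
move=> kn a0 rh T uT TS; rewrite fourier_vars_elim_int//.
apply: rapid_int_vars; first exact: uniq_cross_block.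
by apply: rapid_elim_integrand => //; apply: rh => // q /TS/sub_blockS.
Qed.

End PivotElimination.
(** * The integral identity *)

Section SliceIntegralDuality.
Variables (R : realType) (hbar : R) (n : nat) (b : nat -> R).
Hypotheses (hbar0 : hbar != 0) (b0 : forall i, (i < n)%N -> b i != 0).
Local Notation C := R[i].
Local Notation slot := (nat * nat)%type.
Local Notation pt := (slot -> R).
Local Notation psi := (@psi R hbar).
Local Notation fourier_var := (@fourier_var R hbar slot).
Local Notation fourier_vars := (@fourier_vars R hbar slot).
Local Notation fourier_rapid := (@fourier_rapid R hbar slot).
Local Notation block := (block n).
Local Notation in_block := (in_block n).
Local Notation offdiag := (offdiag n).
Local Notation diagonal := (diagonal n).
Local Notation pivot_row := (pivot_row n).
Local Notation pivot_col := (pivot_col n).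
Local Notation cross := (cross n).
Local Notation UDL := (UDL n b).
Local Notation LDU := (LDU n).
Local Notation next_ind := (@next_ind R).
Local Notation adjacent_at := (adjacent_at n).
Local Notation eliminate := (eliminate n).
Local Notation elim_phase := (elim_phase n).
Local Notation elim_integrand := (elim_integrand hbar n).
Local Notation elim_int := (elim_int hbar n).
Implicit Types (x y z : pt) (F h : pt -> C) (s T : seq slot) (i j k : nat) (a : R) (p : slot).

Definition pivot_phase k a : R := \sum_(k.+1 <= j < n) next_ind k j * (a * b j)^-1.

Definition UDL_pivot k a x : pt := upd (UDL k x) (k, k) a.

Definition dual_integrand k a F y : C :=
  psi (adjacent_at k y - a * \sum_(k.+1 <= j < n) y (k, j) * b j * y (j, k)) *
  fourier_vars (cross k) F (UDL_pivot k a y).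

Lemma rapid_dual_integrand k F : rapid (block k) (fourier_vars (cross k) F) -> (k < n)%N ->
  rapid ((k, k) :: offdiag k) (fun y => dual_integrand k (y (k, k)) F y).
Proof.
move=> rF kn; apply: rapid_psiM.
  apply: seqcontD; first exact: seqcont_adjacent_at.
  apply/seqcontN/seqcontM; first exact: seqcont_coord.
  apply: seqcont_sum => q _; apply: seqcontM; last exact: seqcont_coord.
  by apply: seqcontM; [exact: seqcont_coord|exact: seqcont_cst].
apply: rapid_comp rF => [p|p].
  by rewrite /UDL_pivot /upd; case: eqP => _; [exact: seqcont_coord|exact: seqcont_UDL].
rewrite inE => /predU1P[->|pk].
  apply: poly_recovers_coord => [|x]; last by rewrite /UDL_pivot upd_same.
  by rewrite unfold_in mem_block /in_block /= leqnn kn.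
have [q qk qE] := UDL_inverse b0 pk.
exists q => [|x]; first exact: poly_funW (@sub_offdiag_block _ _) qk.
rewrite qE; apply: (eq_poly_fun qk) => r rk; rewrite /UDL_pivot upd_other//.
by apply: contraTneq rk => ->; rewrite unfold_in mem_offdiag eqxx.
Qed.

Lemma dual_integrand_upd_pivot k a F y t : (k < n)%N ->
  dual_integrand k a F (upd y (k, k) t) = dual_integrand k a F y.
Proof.
move=> kn; rewrite /dual_integrand /UDL_pivot UDL_upd_diag; last by rewrite /in_block /= leqnn kn.
by congr (psi (_ - _ * _) * _); apply: eq_big_nat => j kj; rewrite !upd_other// xpair_eqE; lia.
Qed.

Section RowSubstitution.
Variables (k : nat) (a : R).
(* The substitution of [y' := next / (a b) - y U] for the row [y] of the pivot, [U] being the upper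
   triangular factor of the remaining block. *)
Definition row_shift p y : R :=
  next_ind k p.2 * (a * b p.2)^-1 - \sum_(k.+1 <= i < p.2) y (k, i) * y (i, p.2).

Lemma triangular_row_shift : triangular (pivot_row k) row_shift.
Proof.
apply: (triangular_ranked (rank := snd)) => [|p q y t].
  by rewrite sorted_map; apply: sub_sorted (iota_sorted _ _) => i j.
rewrite !mem_pivot_row => p_in q_in pq; congr (_ - _); apply: eq_big_nat => i pi.
by rewrite !upd_other//; case: q q_in pq => r s /=; rewrite xpair_eqE; lia.
Qed.

Definition row_sub : pt -> pt := triangular_map (pivot_row k) (fun=> -1) row_shift.

Lemma row_sub_row y j : (k < j < n)%N -> row_sub y (k, j) =
  next_ind k j * (a * b j)^-1 - \sum_(k.+1 <= i < n) y (k, i) * upper y i j.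
Proof.
move=> kj; rewrite /row_sub /triangular_map mem_pivot_row /= eqxx kj /row_shift /=.
rewrite [X in _ = _ - X](big_cat_nat (n := j)) /=; [|lia|lia].
rewrite [X in _ = _ - (_ + X)]big_ltn; last by lia.
rewrite upper_diag mulr1 [X in _ = _ - (_ + (_ + X))]big_nat_cond.
rewrite [X in _ = _ - (_ + (_ + X))]big1 => [|i /andP[/andP[ji _] _]]; last first.
  by rewrite upper_gt ?mulr0.
have -> : \sum_(k.+1 <= i < j) y (k, i) * upper y i j = \sum_(k.+1 <= i < j) y (k, i) * y (i, j).
  by apply: eq_big_nat => i ij; rewrite upper_lt//; lia.
by ring.
Qed.

Lemma row_sub_other y p : p \notin pivot_row k -> row_sub y p = y p.
Proof. exact: triangular_map_notin. Qed.

Lemma row_sub_below y i j : (k < i)%N -> row_sub y (i, j) = y (i, j).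
Proof. by move=> ki; rewrite row_sub_other// mem_pivot_row /=; lia. Qed.

Lemma upper_row_sub y i j : (k < i)%N -> upper (row_sub y) i j = upper y i j.
Proof. by move=> ki; rewrite /upper row_sub_below. Qed.

Lemma lower_row_sub y i j : (k < i)%N -> lower (row_sub y) i j = lower y i j.
Proof. by move=> ki; rewrite /lower row_sub_below. Qed.

Lemma row_sub_upd y p t : p \in pivot_col k -> row_sub (upd y p t) = upd (row_sub y) p t.
Proof.
rewrite mem_pivot_col => /andP[/eqP p2 p1]; apply/funext => q.
have [qk|qk] := boolP (q \in pivot_row k); last first.
  by rewrite row_sub_other// /upd; case: eqP => // _; rewrite row_sub_other.
case: p p1 p2 => r s /= rk ->; case: q qk => i j; rewrite mem_pivot_row /= => /andP[/eqP -> kj].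
rewrite !upd_other ?xpair_eqE; last by lia.
rewrite !row_sub_row// ; congr (_ - _); apply: eq_big_nat => l lk.
by rewrite upper_upd ?upd_other// xpair_eqE; lia.
Qed.

Lemma UDLS_row_sub y p : p \notin pivot_row k -> UDL k.+1 (row_sub y) p = UDL k.+1 y p.
Proof.
move=> pk; rewrite /UDL; case: ifPn => [p_in|_]; last exact: row_sub_other.
apply: eq_big_nat => q kq; rewrite upper_row_sub ?lower_row_sub//; first by lia.
by move: p_in; rewrite /in_block; lia.
Qed.

Lemma UDLS_upd y p t : p \in cross k -> UDL k.+1 (upd y p t) = upd (UDL k.+1 y) p t.
Proof. by move=> pk; apply: UDL_upd; exact: cross_notin_block pk. Qed.

Definition dual_row y : pt := fun p =>
  if p == (k, k) then a else
  if p \in pivot_row k then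
    next_ind k p.2 / a - \sum_(k.+1 <= i < n) y (k, i) * UDL k.+1 y (i, p.2)
  else UDL k.+1 y p.

Definition col_shift y p (v : pt) : R :=
  \sum_(p.1.+1 <= r < n) b r * (y (p.1, r) * v (r, p.2)).

Lemma triangular_col_shift y : triangular (rev (pivot_col k)) (col_shift y).
Proof.
apply: (triangular_ranked (rank := fun p => n - p.1)%N) => [|p q v t].
  rewrite rev_sorted sorted_map; apply: sub_sorted (iota_sorted _ _) => i j /= ij; lia.
rewrite !mem_rev !mem_pivot_col => p_in q_in pq; apply: eq_big_nat => r pr.
by rewrite upd_other//; case: q q_in pq => i j /=; rewrite xpair_eqE; lia.
Qed.

Lemma dual_row_upd y p t : p \in pivot_col k -> dual_row (upd y p t) = upd (dual_row y) p t.
Proof.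
move=> pk; have p_cross : p \in cross k by rewrite mem_cat pk orbT.
apply/funext => q; rewrite /dual_row UDLS_upd//; have [->|qp] := eqVneq q p.
  rewrite !upd_same ifF; last first.
    by case: p pk {p_cross} => i j; rewrite mem_pivot_col xpair_eqE /=; lia.
  by rewrite ifF//; move: pk; rewrite mem_pivot_col mem_pivot_row; lia.
rewrite !upd_other//; case: ifP => // _; case: ifP => // qk.
congr (_ - _); apply: eq_bigr => i _; case: p pk {p_cross qp} => r s.
rewrite mem_pivot_col /= => rs; rewrite !upd_other// xpair_eqE;
  move: qk; rewrite mem_pivot_row; lia.
Qed.

Hypothesis a0 : a != 0.

Lemma UDL_row_sub_row y j : (k < j < n)%N -> UDL k (row_sub y) (k, j) =
  next_ind k j / a - \sum_(k.+1 <= i < n) y (k, i) * UDL k.+1 y (i, j).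
Proof.
move=> kj; rewrite UDL_row//.
have -> : \sum_(k.+1 <= q < n) row_sub y (k, q) * b q * lower (row_sub y) q j =
    \sum_(k.+1 <= q < n) next_ind k q * (lower y q j / a) -
    \sum_(k.+1 <= q < n) \sum_(k.+1 <= i < n) y (k, i) * (upper y i q * b q * lower y q j).
  rewrite -sumrB; apply: eq_big_nat => q kq; have bq : b q != 0 by apply: b0; lia.
  rewrite row_sub_row// lower_row_sub; last by lia.
  rewrite mulrBl mulrBl !mulr_suml; congr (_ - _); first by field; rewrite a0 bq.
  by apply: eq_bigr => i _; ring.
congr (_ - _).
  rewrite sum_next_ind ifT; last by lia.
  have [->|jk] := eqVneq j k.+1; first by rewrite lower_diag /next_ind eqxx.
  by rewrite lower_lt ?/next_ind ?(negPf jk) ?mul0r//; lia.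
rewrite exchange_big /=; apply: eq_big_nat => i ki.
by rewrite /UDL /in_block /= ki kj mulr_sumr.
Qed.

Lemma UDL_pivot_row_sub y : UDL_pivot k a (row_sub y) =
  triangular_map (rev (pivot_col k)) (fun p => b p.1) (col_shift y) (dual_row y).
Proof.
apply/funext => -[i j]; rewrite /UDL_pivot /triangular_map mem_rev.
have [/eqP[-> ->]|ij] := boolP ((i, j) == (k, k)).
  by rewrite upd_same mem_pivot_col /= eqxx ltnn /dual_row eqxx.
rewrite upd_other//; case: ifPn => [|ij_col].
  rewrite mem_pivot_col /= => /andP[/eqP -> ki].
  have UDLS_col r : (k < r)%N -> dual_row y (r, k) = y (r, k).
    move=> kr; rewrite /dual_row xpair_eqE mem_pivot_row gtn_eqF//= /UDL ifF//.
    by rewrite /in_block /=; lia.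
  rewrite UDL_maxn; last by rewrite /in_block /=; lia.
  rewrite /= (maxn_idPl _); last by lia.
  rewrite gtn_eqF ?row_sub_below ?UDLS_col//; [|lia..]; congr (_ + _).
  by apply: eq_big_nat => r ir; rewrite !row_sub_below ?UDLS_col//; lia.
rewrite /dual_row (negPf ij); case: ifPn => [|ij_row].
  by rewrite mem_pivot_row /= => /andP[/eqP -> kj]; exact: UDL_row_sub_row.
rewrite -UDLS_row_sub//; have [ijk|ijk] := boolP (in_block k.+1 (i, j)); first exact: UDL_blockS.
rewrite /UDL (negPf ijk) ifF//; move: ij ij_col ij_row ijk.
by rewrite xpair_eqE mem_pivot_col mem_pivot_row /in_block /=; lia.
Qed.

Lemma dual_phase y : let z := row_sub y in
  adjacent_at k z - a * (\sum_(k.+1 <= j < n) z (k, j) * b j * z (j, k)) =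
  pivot_phase k a - \sum_(k.+1 <= j < n) next_ind k j * y (k, j) +
  \sum_(p <- pivot_col k) a * y (k, p.1) * UDL_pivot k a z p.
Proof.
move=> z; rewrite /adjacent_at; under eq_bigr do rewrite mulrDr.
rewrite big_split /= -addrA; congr (_ + _).
  rewrite /pivot_phase -sumrB; under [RHS]eq_bigr do rewrite -mulrBr.
  rewrite !sum_next_ind; case: ifP => // kn1; rewrite /z row_sub_row; last by lia.
  rewrite /next_ind eqxx mul1r big_ltn// upper_diag mulr1 big_nat_cond big1 ?addr0//.
  by move=> i /andP[/andP[ki _] _]; rewrite upper_gt ?mulr0.
transitivity (\sum_(k.+1 <= j < n) \sum_(k.+1 <= i < n)
    a * y (k, i) * (upper z i j * b j * z (j, k))).
  rewrite mulr_sumr -sumrB; apply: eq_big_nat => j kj; have bj : b j != 0 by apply: b0; lia.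
  have -> : \sum_(k.+1 <= i < n) a * y (k, i) * (upper z i j * b j * z (j, k)) =
      a * b j * z (j, k) * \sum_(k.+1 <= i < n) y (k, i) * upper y i j.
    rewrite mulr_sumr; apply: eq_big_nat => i ki; rewrite upper_row_sub; last by lia.
    by ring.
  by rewrite [z (k, j)]row_sub_row//; set s := \sum_(_ <= _ < _) _; field; rewrite a0 bj.
rewrite exchange_big /pivot_col big_map /=; apply: eq_big_nat => i ki.
by rewrite /UDL_pivot upd_other ?UDL_col ?mulr_sumr// xpair_eqE; lia.
Qed.

End RowSubstitution.

Section PivotStep.
Variables (k : nat) (a : R) (h : pt -> C).
Hypotheses (kn : (k < n)%N) (rh : fourier_rapid (block k) h).

Let g := fourier_vars (block k.+1) h.
Local Notation row_sub := (row_sub k a).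
Local Notation dual_row := (dual_row k a).

Lemma rapid_fourier_cross T : uniq T -> {subset T <= cross k} ->
  rapid (block k) (fourier_vars T g).
Proof.
move=> uT TS; apply: fourier_rapid_vars rh; [|exact: sub_blockS|].
  rewrite cat_uniq uT uniq_block andbT /=; apply/hasPn => p pk; apply/negP => /TS.
  by move: pk; rewrite !mem_slots /in_block; lia.
by move=> p /TS/(sub_cross_block kn).
Qed.

Lemma fourier_cross_cat : fourier_vars (cross k) g =
  fourier_vars (pivot_col k) (fourier_vars (pivot_row k) g).
Proof.
rewrite -fourier_vars_cat; apply: perm_fourier_vars; [by rewrite perm_catC|exact: uniq_cross|].
by apply: rapidS (sub_cross_block kn) _; exact: (@rapid_fourier_cross [::]).
Qed.

Lemma rapid_dual_integrand_fixed : rapid (offdiag k) (dual_integrand k a g).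
Proof.
have rQ := rapid_dual_integrand (rapid_fourier_cross (uniq_cross _ _) (fun p pk => pk)) kn.
have := rapid_shear 0 (pivot_notin_offdiag n k) (seqcont_cst (c := a))
  (rapidS (fun p pk => mem_behead (s := (k, k) :: _) pk) rQ).
by congr rapid; apply/funext => y; rewrite mul0r add0r upd_same dual_integrand_upd_pivot.
Qed.


Hypothesis a0 : a != 0.

(* After the row substitution the column variables enter only through a linear map and a linear
   phase: this is where the Fourier transform in the column gets inverted. *)
Definition col_kernel y v : C := psi (\sum_(p <- pivot_col k) a * y (k, p.1) * v p) *
  fourier_vars (pivot_col k) (fourier_vars (pivot_row k) g) v.

Definition sub_phase y : R :=
  pivot_phase k a - \sum_(k.+1 <= j < n) next_ind k j * y (k, j).

Lemma dual_integrand_row_sub y : dual_integrand k a g (row_sub y) = psi (sub_phase y) *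
  col_kernel y (triangular_map (rev (pivot_col k)) (fun p => b p.1) (col_shift y) (dual_row y)).
Proof.
by rewrite /dual_integrand (dual_phase k a0) psiD -mulrA fourier_cross_cat -UDL_pivot_row_sub.
Qed.

Lemma rapid_col_kernel y : rapid (pivot_col k) (col_kernel y).
Proof.
apply: rapid_psi_linear; rewrite -fourier_cross_cat.
apply: rapidS (rapid_fourier_cross (uniq_cross _ _) (fun p pk => pk)) => p pk.
by apply: sub_cross_block => //; rewrite mem_cat pk orbT.
Qed.

Lemma int_col_row_sub y :
  int_vars (rev (pivot_col k)) (dual_integrand k a g) (row_sub y) =
  int_vars (rev (pivot_col k)) (fun v => psi (sub_phase y) * col_kernel y
    (triangular_map (rev (pivot_col k)) (fun p => b p.1) (col_shift y) v)) (dual_row y).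
Proof.
rewrite int_vars_comm => [|x p t]; last by rewrite mem_rev; exact: row_sub_upd.
apply: eq_int_vars => // ts _; set x := upds y _ ts.
have xE p : p \notin pivot_col k -> x p = y p by rewrite -mem_rev; exact: upds_notin.
have x_row j : x (k, j) = y (k, j) by rewrite xE// mem_pivot_col /= ltnn andbF.
rewrite dual_integrand_row_sub -upds_map_comm => [|z p t]; last first.
  by rewrite mem_rev; exact: dual_row_upd.
rewrite (@eq_triangular_map _ _ _ _ (col_shift x) (col_shift y)) => [|p]; last first.
  rewrite mem_rev mem_pivot_col => /andP[_ kp] v.
  by apply: eq_big_nat => r pr; rewrite xE// mem_pivot_col /=; lia.
congr (psi (_ - _) * (psi _ * _)); first by apply: eq_bigr => j _; rewrite x_row.
by apply: eq_bigr => p _; rewrite x_row.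
Qed.

Definition dual_point y : pt := fun p => if p \in pivot_col k then a * y (k, p.1) else dual_row y p.

Definition dual_gain : R :=
  (`|hbar| / (2 * pi)) ^+ (n - k.+1) * \prod_(k.+1 <= j < n) `|b j|.

Lemma int_col_dual_integrand y :
  dual_gain%:C * int_vars (pivot_col k) (dual_integrand k a g) (row_sub y) =
  psi (sub_phase y) * fourier_vars (pivot_row k) g (dual_point y).
Proof.
have rK := rapid_col_kernel y; have uc := uniq_pivot_col n k.
have perm_col : perm_eq (pivot_col k) (rev (pivot_col k)) by rewrite perm_sym perm_rev.
have rQ : rapid (pivot_col k) (dual_integrand k a g).
  by apply: rapidS rapid_dual_integrand_fixed => p; rewrite !mem_slots /in_block; lia.
pose tri := triangular_map (rev (pivot_col k)) (fun p => b p.1) (col_shift y).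
have unscale : int_vars (pivot_col k) (fun v => psi (sub_phase y) * col_kernel y v) (dual_row y) =
    (\prod_(k.+1 <= j < n) `|b j|)%:C * int_vars (rev (pivot_col k))
      (fun v => psi (sub_phase y) * col_kernel y (tri v)) (dual_row y).
  rewrite (perm_int_vars perm_col uc); last exact: rapidZ.
  rewrite (@int_vars_triangular _ _ _ (fun p => b p.1) (col_shift y)).
  - congr (_%:C * _); rewrite -(perm_big _ perm_col) /= /pivot_col big_map.
    by apply: eq_bigr.
  - by rewrite rev_uniq.
  - by move=> p; rewrite mem_rev mem_pivot_col => /andP[_ /andP[_]]; exact: b0.
  - move=> p _; apply: seqcont_sum => r _; apply: seqcontM; first exact: seqcont_cst.
    by apply: seqcontM; [exact: seqcont_cst|exact: seqcont_coord].
  - exact: triangular_col_shift.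
  - by apply: rapidZ; apply: rapidS rK => p; rewrite mem_rev.
rewrite /dual_gain (perm_int_vars perm_col uc rQ) int_col_row_sub.
rewrite rmorphM -mulrA -unscale int_varsZl// mulrCA; congr (_ * _).
have -> : (n - k.+1 = size (pivot_col k))%N by rewrite size_map size_iota.
apply: fourier_vars_inversion => // T uT TS; rewrite -fourier_vars_cat.
apply: rapidS (rapid_fourier_cross _ _) => [p pk||p].
- by apply: sub_cross_block => //; rewrite mem_cat pk orbT.
- rewrite cat_uniq uT uniq_pivot_row andbT /=; apply/hasPn => p pk; apply/negP => /TS.
  by move: pk; rewrite !mem_slots; lia.
- by rewrite !mem_cat => /orP[/TS ->|->]; rewrite ?orbT.
Qed.

Lemma UDLS_col y i : UDL k.+1 y (i, k) = y (i, k).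
Proof. by rewrite /UDL ifF// /in_block /=; lia. Qed.

Lemma UDLS_row y j : UDL k.+1 y (k, j) = y (k, j).
Proof. by rewrite /UDL ifF// /in_block /=; lia. Qed.

Lemma eliminate_dual_point y ts : size ts = (n - k.+1)%N ->
  triangular_map (pivot_row k) (fun=> a) (fun _ _ => 0) (upds (dual_point y) (pivot_row k) ts) =
  eliminate k a (block k.+1) (upds (UDL k.+1 y) (pivot_col k) ts).
Proof.
move=> sts; apply/funext => -[i j]; rewrite /triangular_map /eliminate.
have slot_inj (f : nat -> slot) : injective f -> forall l x, (k < l < n)%N ->
    upds x (map f (index_iota k.+1 n)) ts (f l) = nth 0 ts (index l (index_iota k.+1 n)).
  move=> f_inj l x kl; apply: upds_map => //; first exact: iota_uniq.
    by rewrite size_iota.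
  by rewrite mem_index_iota.
have [ij_row|ij_row] := boolP ((i, j) \in pivot_row k).
  move: (ij_row); rewrite mem_pivot_row /= => /andP[/eqP -> kj].
  rewrite ifF; last by rewrite xpair_eqE; lia.
  rewrite mem_cross /= eqxx kj addr0 (slot_inj (pair k))//; last by move=> ? ? [].
  by rewrite (slot_inj (pair^~ k))// => ? ? [].
rewrite upds_notin// /dual_point; have [ij_col|ij_col] := boolP ((i, j) \in pivot_col k).
  move: (ij_col); rewrite mem_pivot_col /= => /andP[/eqP -> ki].
  rewrite ifF; last by rewrite xpair_eqE; lia.
  rewrite mem_cross /= eqxx ki orbT upds_notin ?UDLS_row//.
  by rewrite mem_pivot_col /=; lia.
rewrite /dual_row; case: ifP => // _.
have -> : ((i, j) \in cross k) = false by rewrite mem_cat (negPf ij_row) (negPf ij_col).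
by rewrite (negPf ij_row) andbN upds_notin.
Qed.

Lemma elim_phase_dual_point y x : (forall p, p \notin pivot_col k -> x p = UDL k.+1 y p) ->
  elim_phase k a (block k.+1) x = - \sum_(k.+1 <= j < n) next_ind k j * y (k, j) -
  \sum_(p <- pivot_row k) dual_point y p * eliminate k a (block k.+1) x p.
Proof.
move=> xE; have x_row j : x (k, j) = y (k, j).
  by rewrite xE ?UDLS_row// mem_pivot_col /= ltnn andbF.
have x_block i j : (k < i < n)%N -> (k < j < n)%N -> x (i, j) = UDL k.+1 y (i, j).
  by move=> ki kj; rewrite xE// mem_pivot_col /=; lia.
have -> : \sum_(p <- pivot_row k) dual_point y p * eliminate k a (block k.+1) x p =
    \sum_(k.+1 <= j < n) next_ind k j * x (j, k) -
    a * \sum_(k.+1 <= j < n) \sum_(k.+1 <= i < n) y (k, i) * UDL k.+1 y (i, j) * x (j, k).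
  rewrite mulr_sumr -sumrB /pivot_row big_map; apply: eq_big_nat => j kj.
  rewrite eliminate_cross; last by rewrite mem_cross /= eqxx kj.
  rewrite /dual_point mem_pivot_col /= ltnn andbF /dual_row xpair_eqE.
  rewrite mem_pivot_row /= eqxx kj gtn_eqF /=; last by lia.
  by rewrite -mulr_suml; set s := \sum_(_ <= _ < _) _; field; exact: a0.
rewrite /elim_phase.
have -> : \sum_(p <- block k.+1) x p * (x (k, p.1) * x (p.2, k)) =
    \sum_(k.+1 <= j < n) \sum_(k.+1 <= i < n) y (k, i) * UDL k.+1 y (i, j) * x (j, k).
  rewrite exchange_big /= /block big_allpairs; apply: eq_big_nat => i ki.
  by apply: eq_big_nat => j kj; rewrite /= x_row x_block//; ring.
rewrite /adjacent_at; under [X in - X + _]eq_bigr do rewrite mulrDr x_row.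
by rewrite big_split /=; ring.
Qed.

Definition elim_gain : C := psi (pivot_phase k a) * (`|a| ^+ (n - k.+1))%:C.

Lemma fourier_row_dual_point y :
  psi (sub_phase y) * fourier_vars (pivot_row k) g (dual_point y) =
  elim_gain * int_vars (pivot_col k) (elim_integrand k a (block k.+1) g) (UDL k.+1 y).
Proof.
have ur := uniq_pivot_row n k.
have rg : rapid (pivot_row k) g.
  apply: rapidS (@rapid_fourier_cross [::] isT _) => // p pk.
  by apply: sub_cross_block => //; rewrite mem_cat pk.
pose row_phase w := - \sum_(p <- pivot_row k) dual_point y p * w p.
have rrg : rapid (pivot_row k) (fun w => psi (row_phase w) * g w).
  apply: rapid_psiM rg; apply/seqcontN/seqcont_sum => p _.
  by apply: seqcontM; [exact: seqcont_cst|exact: seqcont_coord].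
pose D := - \sum_(k.+1 <= j < n) next_ind k j * y (k, j).
rewrite /elim_gain /sub_phase psiD -!mulrA -/D fourier_varsE// -(int_varsZl (psi D))//.
rewrite (@int_vars_triangular _ _ _ (fun=> a) (fun _ _ => 0))//; last 3 first.
- by move=> p _; exact: seqcont_cst.
- by elim: (pivot_row k).
- exact: rapidZ.
rewrite big_const_seq count_predT size_map size_iota iter_mulr_1; congr (_ * (_ * _)).
apply: eq_int_vars => [|ts sts]; first by rewrite !size_map.
have sts' : size ts = (n - k.+1)%N by rewrite sts size_map size_iota.
rewrite eliminate_dual_point// mulrA -psiD /elim_integrand (elim_phase_dual_point (y := y))//.
by move=> p; exact: upds_notin.
Qed.

Lemma elim_int_duality x :
  elim_gain * fourier_vars (block k.+1) (elim_int k a h) (UDL k.+1 x) =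
  dual_gain%:C * int_vars (cross k) (dual_integrand k a g) x.
Proof.
have rg : rapid (block k) g by exact: (@rapid_fourier_cross [::]).
have ur := uniq_pivot_row n k.
have u_col_row : uniq (pivot_col k ++ pivot_row k) by rewrite uniq_catC uniq_cross.
have r_elim : rapid (pivot_row k) (fun y =>
    int_vars (pivot_col k) (elim_integrand k a (block k.+1) g) (UDL k.+1 y)).
  apply: (@rapid_comp _ _ (pivot_row k)) => [p|p|]; first exact: seqcont_UDL.
    case: p => i j pk; apply: poly_recovers_coord => // y.
    by rewrite /UDL ifF//; move: pk; rewrite mem_pivot_row /in_block /=; lia.
  apply: rapid_int_vars => //; apply: rapidS (rapid_elim_integrand hbar _ kn a0 rg) => p.
  by rewrite !mem_cat orbC => ->.
have r_dual : rapid (pivot_row k) (int_vars (pivot_col k) (dual_integrand k a g)).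
  apply: rapid_int_vars => //; apply: rapidS rapid_dual_integrand_fixed => p.
  by rewrite mem_cat !mem_slots /in_block; lia.
rewrite fourier_vars_elim_int ?uniq_block// -/g !int_vars_cat int_vars_comm => [|y p t pk].
  rewrite -[LHS]int_varsZl// -[RHS]int_varsZl//.
  rewrite [RHS](@int_vars_triangular _ _ (pivot_row k) (fun=> -1) (row_shift k a))//.
  - rewrite big1 => [|p _]; last by rewrite normrN1.
    rewrite mul1r; apply: eq_int_vars_upds => ts _.
    by rewrite -fourier_row_dual_point -int_col_dual_integrand.
  - move=> p _; apply: seqcontD; first exact: seqcont_cst.
    by apply/seqcontN/seqcont_sum => i _; apply: seqcontM; exact: seqcont_coord.
  - exact: triangular_row_shift.
  - exact: rapidZ.
by apply: UDLS_upd; rewrite mem_cat pk.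
Qed.

End PivotStep.
Definition slice_phase k x : R :=
  - (\sum_(k <= i < n) x (i, i) * b i) + \sum_(k <= i < n.-1) (x (i, i) * b i.+1)^-1.
Definition adjacent_sum k x : R := \sum_(k <= i < n.-1) (x (i, i.+1) + x (i.+1, i)).
Definition slice_weight k x : R := \prod_(k <= i < n) `|x (i, i)| ^+ (n.-1 - i).
Definition diag_neq0 k x := all (fun i => x (i, i) != 0) (index_iota k n).

Definition orbital_integrand k h y : C := psi (- adjacent_sum k y) * h (LDU k y).
Definition orbital_int k h : pt -> C := int_vars (offdiag k) (orbital_integrand k h).
Definition dual_orbital_integrand k F y : C := psi (adjacent_sum k y) * F (UDL k y).
Definition dual_orbital_int k F : pt -> C :=
  int_vars (offdiag k) (dual_orbital_integrand k F).
Definition slice_integrand k h x : C :=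
  if diag_neq0 k x then psi (slice_phase k x) * (slice_weight k x)%:C * orbital_int k h x else 0.

Lemma diag_neq0P k x i : diag_neq0 k x -> (k <= i < n)%N -> x (i, i) != 0.
Proof. by move=> /allP x0 ki; apply: x0; rewrite mem_index_iota. Qed.

Lemma diag_neq0_step k x : (k < n)%N -> diag_neq0 k x = (x (k, k) != 0) && diag_neq0 k.+1 x.
Proof. by move=> kn; rewrite /diag_neq0 /index_iota -{1}(subnSK kn). Qed.

Lemma adjacent_sum_step k x : (k < n)%N ->
  adjacent_sum k x = adjacent_at k x + adjacent_sum k.+1 x.
Proof.
move=> kn; rewrite /adjacent_at sum_next_ind /adjacent_sum; case: ifPn => kn1.
  by rewrite big_ltn//; lia.
by rewrite !big_geq ?addr0//; lia.
Qed.

Lemma slice_phase_step k x : (k < n)%N ->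
  slice_phase k x = - (x (k, k) * b k) + pivot_phase k (x (k, k)) + slice_phase k.+1 x.
Proof.
move=> kn; rewrite /slice_phase /pivot_phase sum_next_ind big_ltn//; case: ifPn => kn1.
  by rewrite [X in _ + X = _]big_ltn; [ring|lia].
rewrite [X in _ + X = _]big_geq; last by lia.
by rewrite [X in _ = _ + (_ + X)]big_geq; [ring|lia].
Qed.

Lemma slice_weight_step k x : (k < n)%N ->
  slice_weight k x = `|x (k, k)| ^+ (n - k.+1) * slice_weight k.+1 x.
Proof. by move=> kn; rewrite /slice_weight big_ltn//; congr (_ ^+ _ * _); lia. Qed.

Lemma seqcont_adjacent_sum k : seqcont (adjacent_sum k).
Proof. by apply: seqcont_sum => i _; apply: seqcontD; exact: seqcont_coord. Qed.

Lemma adjacent_sum_upd_cross k x p t : p \in cross k ->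
  adjacent_sum k.+1 (upd x p t) = adjacent_sum k.+1 x.
Proof.
rewrite mem_cross; case: p => r s /= rs; apply: eq_big_nat => i ki.
by congr (_ + _); apply: upd_other; rewrite xpair_eqE; lia.
Qed.

Lemma LDU_step k x : (k < n)%N -> LDU k x = eliminate k (x (k, k)) [::] (LDU k.+1 x).
Proof.
move=> kn; have outer p : ~~ in_block k.+1 p -> LDU k.+1 x p = x p by rewrite /LDU => /negPf ->.
apply/funext => -[i j]; have [ij|ij] := boolP ((i, j) \in block k.+1).
  rewrite eliminate_block// mul1r /= [LDU _ _ (k, i)]outer ?[LDU _ _ (j, k)]outer;
    [|by rewrite /in_block /=; lia..].
  move: ij; rewrite mem_block => ij; have kij : in_block k (i, j).
    by move: ij; rewrite /in_block /=; lia.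
  rewrite /LDU ij kij big_ltn//= upper_lt ?lower_gt; last 2 first.
  - by move: ij; rewrite /in_block /=; lia.
  - by move: ij; rewrite /in_block /=; lia.
  by ring.
have [ij_cross|ij_cross] := boolP ((i, j) \in cross k).
  rewrite eliminate_cross// outer; last by move: ij_cross; rewrite mem_cross /in_block /=; lia.
  move: ij_cross; rewrite mem_cross /= => ij_cross.
  rewrite LDU_minn; last by rewrite /in_block /=; lia.
  have -> : minn i j = k by lia.
  by rewrite big_geq// addr0 ifF//=; lia.
rewrite /eliminate (negPf ij) (negPf ij_cross) outer; last by rewrite -mem_block.
case: eqP => [[-> ->]|/eqP ij_k].
  by rewrite LDU_minn /in_block /= ?leqnn ?kn// minnn eqxx mulr1 big_geq ?addr0.
rewrite /LDU ifF//; move: ij ij_k ij_cross; rewrite !mem_slots /in_block xpair_eqE /=; lia.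
Qed.

Lemma rapid_orbital_integrand k d h : (forall i, (k <= i < n)%N -> d i != 0) ->
  rapid (block k) h -> rapid (offdiag k) (fun y => orbital_integrand k h (set_diag d y)).
Proof.
move=> d0 rh; apply: rapid_psiM.
  apply: seqcontN; exact: (seqcont_comp (@seqcont_set_diag R d) (@seqcont_adjacent_sum k)).
apply: rapid_comp rh => [p|p pk].
  exact: (seqcont_comp (g := fun y => LDU k y p) (@seqcont_set_diag R d) (@seqcont_LDU R n k p)).
exact: poly_recoversW (@sub_offdiag_block _ _) (LDU_inverse d0 pk).
Qed.

Lemma orbital_int_set_diag k h x :
  orbital_int k h x =
  int_vars (offdiag k) (fun y => orbital_integrand k h (set_diag (fun i => x (i, i)) y)) x.
Proof. by rewrite int_vars_set_diag// => p; rewrite mem_offdiag => /andP[]. Qed.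

Lemma orbital_intZ k h c x : diag_neq0 k x -> rapid (block k) h ->
  orbital_int k (fun y => c * h y) x = c * orbital_int k h x.
Proof.
move=> x0 rh; rewrite !orbital_int_set_diag -int_varsZl ?uniq_offdiag//; last first.
  by apply: rapid_orbital_integrand rh => i; exact: diag_neq0P.
by congr (int_vars _ _ _); apply/funext => y; rewrite /orbital_integrand mulrCA.
Qed.

Lemma slice_integrandZ k h c x : rapid (block k) h ->
  slice_integrand k (fun y => c * h y) x = c * slice_integrand k h x.
Proof.
move=> rh; rewrite /slice_integrand; case: ifPn => [x0|_]; last by rewrite mulr0.
by rewrite orbital_intZ// mulrCA.
Qed.

Lemma int_cross_orbital_integrand k h y : (k < n)%N -> y (k, k) != 0 -> rapid (block k) h ->
  int_vars (cross k) (orbital_integrand k h) y =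
  orbital_integrand k.+1 (elim_int k (y (k, k)) h) y.
Proof.
move=> kn a0 rh; set a := y (k, k) in a0 *.
have LDUS_cross x p : p \in cross k -> LDU k.+1 x p = x p.
  by rewrite mem_cross /LDU => pk; rewrite ifF//; move: pk; rewrite /in_block; lia.
have r_elim : rapid (cross k) (fun x => elim_integrand k a [::] h (LDU k.+1 x)).
  apply: (@rapid_comp _ _ (cross k)) => [p|p pk|]; first exact: seqcont_LDU.
    by apply: poly_recovers_coord => // x; exact: LDUS_cross.
  by apply: rapidS (rapid_elim_integrand hbar _ kn a0 rh) => p pk; rewrite mem_cat pk.
rewrite [RHS]/orbital_integrand /elim_int.
rewrite (int_vars_comm (Phi := LDU k.+1)) => [|x p t pk]; last first.
  by apply: LDU_upd; exact: cross_notin_block pk.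
rewrite -(int_varsZ (c := fun x => psi (- adjacent_sum k.+1 x))) ?uniq_cross//; last first.
  by move=> x p t pk; rewrite adjacent_sum_upd_cross.
apply: eq_int_vars_upds => ts _; set x := upds y _ ts.
have xk : x (k, k) = a by rewrite /x upds_notin// mem_cross /= ltnn andbF.
rewrite /orbital_integrand (LDU_step _ kn) xk /elim_integrand mulrA -psiD; congr (psi _ * _).
rewrite adjacent_sum_step// /elim_phase big_nil mulr0 addr0 opprD addrC; congr (_ - _).
by apply: eq_big_nat => j kj; rewrite !LDUS_cross// mem_cross /=; lia.
Qed.

Lemma orbital_int_step k h x : (k < n)%N -> diag_neq0 k x -> rapid (block k) h ->
  orbital_int k h x = orbital_int k.+1 (elim_int k (x (k, k)) h) x.
Proof.
move=> kn x0 rh; pose d i := x (i, i).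
have d0 i : (k <= i < n)%N -> d i != 0 by exact: diag_neq0P.
rewrite [RHS]orbital_int_set_diag orbital_int_set_diag -/d.
rewrite (perm_int_vars (perm_offdiag kn)) ?uniq_offdiag//; last exact: rapid_orbital_integrand.
rewrite int_vars_cat; congr (int_vars _ _ _); apply/funext => y.
rewrite -(int_vars_comm (Phi := set_diag d)) => [|z p t pk]; last first.
  by apply: set_diag_upd; move: pk; rewrite mem_cross; lia.
by rewrite int_cross_orbital_integrand ?set_diagE//; apply: d0; rewrite leqnn.
Qed.

Lemma rapid_dual_orbital_integrand k F : rapid (block k) F ->
  rapid (offdiag k) (dual_orbital_integrand k F).
Proof.
move=> rF; apply: rapid_psiM; first exact: seqcont_adjacent_sum.
apply: rapid_comp rF => [p|p pk]; first exact: seqcont_UDL.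
exact: poly_recoversW (@sub_offdiag_block _ _) (UDL_inverse b0 pk).
Qed.

Lemma dual_orbital_intZ k F c x : rapid (block k) F ->
  dual_orbital_int k (fun y => c * F y) x = c * dual_orbital_int k F x.
Proof.
move=> rF; rewrite /dual_orbital_int -int_varsZl ?uniq_offdiag//; last first.
  exact: rapid_dual_orbital_integrand.
by congr (int_vars _ _ _); apply/funext => y; rewrite /dual_orbital_integrand mulrCA.
Qed.

Definition pivot_factor k a : C := psi (- (a * b k)) * elim_gain k a.

Lemma int_diagonal_step k a h x : (k < n)%N -> fourier_rapid (block k) h ->
  x (k, k) = a -> a != 0 ->
  int_vars (diagonal k.+1) (slice_integrand k h) x =
  int_vars (diagonal k.+1) (slice_integrand k.+1 (fun y => pivot_factor k a * elim_int k a h y)) x.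
Proof.
move=> kn rh xa a0; apply: eq_int_vars_upds => ts _; set y := upds x _ ts.
have ya : y (k, k) = a by rewrite /y upds_notin// mem_diagonal /= ltnn andbF.
rewrite /slice_integrand diag_neq0_step// ya a0 /=; case: ifPn => // y0.
have yk0 : diag_neq0 k y by rewrite diag_neq0_step// ya a0.
rewrite slice_phase_step// slice_weight_step// orbital_int_step ?ya//; last first.
  exact: fourier_rapid_rapid rh.
rewrite orbital_intZ//; last exact: fourier_rapid_rapid (fourier_rapid_elim_int kn a0 rh).
rewrite /pivot_factor /elim_gain rmorphM !psiD; set u := psi (- _).
by ring.
Qed.

Definition pivot_integrand k F y : C :=
  psi (adjacent_sum k.+1 y - y (k, k) * b k) * dual_integrand k (y (k, k)) F y.

Lemma rapid_pivot_integrand k F : (k < n)%N -> rapid (block k) (fourier_vars (cross k) F) ->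
  rapid ((k, k) :: offdiag k) (pivot_integrand k F).
Proof.
move=> kn rF; apply: rapid_psiM; last exact: rapid_dual_integrand.
apply: seqcontD; first exact: seqcont_adjacent_sum.
by apply/seqcontN/seqcontM; [exact: seqcont_coord|exact: seqcont_cst].
Qed.

Lemma dual_orbital_int_pivot k h x : (k < n)%N -> fourier_rapid (block k) h ->
  dual_orbital_int k (fourier_vars (block k) h) x =
  int_vars ((k, k) :: offdiag k) (pivot_integrand k (fourier_vars (block k.+1) h)) x.
Proof.
move=> kn rh; set g := fourier_vars (block k.+1) h.
have rg := rapid_fourier_cross kn rh (uniq_cross n k) (fun _ pk => pk).
have kk : (k, k) \in block k by rewrite mem_block /in_block /= leqnn kn.
rewrite -(perm_int_vars (s := offdiag k ++ [:: (k, k)])); last 3 first.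
- by rewrite perm_catC.
- by rewrite uniq_catC /= pivot_notin_offdiag uniq_offdiag.
- by apply: rapidS (rapid_pivot_integrand kn rg) => p; rewrite mem_cat !inE orbC.
rewrite int_vars_cat; congr (int_vars _ _ _); apply/funext => y.
have -> : fourier_vars (block k) h = fourier_var (k, k) (fourier_vars (cross k) g).
  rewrite /g -fourier_vars_cat -fourier_vars_cons.
  exact: perm_fourier_vars (perm_block kn) (uniq_block _ _) (fourier_rapid_rapid rh).
have [K decayK] := rapid_cquad_decay (UDL k y) kk rg.
rewrite /dual_orbital_integrand /fourier_var int_vars_cons.
rewrite -(cintZ _ (cquad_decay_psiM hbar (- UDL k y (k, k)) decayK)).
apply: eq_cint => t; rewrite /int_vars /= /pivot_integrand upd_same dual_integrand_upd_pivot//.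
rewrite /dual_integrand mulrA -psiD [RHS]mulrA -psiD; congr (psi _ * _).
have -> : adjacent_sum k.+1 (upd y (k, k) t) = adjacent_sum k.+1 y.
  by apply: eq_big_nat => i ki; rewrite !upd_other// xpair_eqE; lia.
by rewrite UDL_pivot_entry// adjacent_sum_step//; ring.
Qed.

Lemma dual_orbital_int_step k a h x : (k < n)%N -> fourier_rapid (block k) h ->
  x (k, k) = a -> a != 0 ->
  pivot_factor k a * dual_orbital_int k.+1 (fourier_vars (block k.+1) (elim_int k a h)) x =
  (dual_gain k)%:C * int_vars (offdiag k) (pivot_integrand k (fourier_vars (block k.+1) h)) x.
Proof.
move=> kn rh xa a0; set g := fourier_vars (block k.+1) h.
have rQ : rapid (offdiag k) (dual_integrand k a g) by exact: rapid_dual_integrand_fixed.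
have cQ : seqcont (fun y => adjacent_sum k.+1 y - a * b k).
  by apply: seqcontD; [exact: seqcont_adjacent_sum|exact: seqcont_cst].
pose Q y := psi (adjacent_sum k.+1 y - a * b k) * dual_integrand k a g y.
have rQ' : rapid (offdiag k) Q by exact: rapid_psiM.
have -> : int_vars (offdiag k) (pivot_integrand k g) x = int_vars (offdiag k) Q x.
  apply: eq_int_vars_upds => ts _.
  by rewrite /pivot_integrand upds_notin ?pivot_notin_offdiag// xa.
rewrite (perm_int_vars (perm_offdiag kn)) ?uniq_offdiag// int_vars_cat.
have rF := fourier_rapid_elim_int kn a0 rh (uniq_block _ _) (fun _ pk => pk).
rewrite -!int_varsZl ?uniq_offdiag//; last 2 first.
- exact: rapid_dual_orbital_integrand.
- apply: rapid_int_vars; first by rewrite uniq_catC -(perm_uniq (perm_offdiag kn)) uniq_offdiag.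
  apply: rapidS rQ' => p; rewrite (mem_cat p (cross k)).
  by move=> /orP[/(sub_cross_offdiag kn)|/sub_offdiagS].
congr (int_vars _ _ _); apply/funext => y.
rewrite int_varsZ ?uniq_cross//; last 2 first.
- exact: rapidS (sub_cross_offdiag kn) rQ.
- by move=> z p t pk; rewrite adjacent_sum_upd_cross.
rewrite [RHS]mulrCA /g -(elim_int_duality kn rh a0) /dual_orbital_integrand /pivot_factor psiD.
by set u := psi (- _); ring.
Qed.

Definition duality_const m k : C :=
  ((`|hbar| / (2 * pi)) ^+ 'C(m, 2) * \prod_(k <= i < n) `|b i| ^+ (i - k))%:C.

Lemma duality_const_step m k : n = (k + m.+1)%N ->
  duality_const m.+1 k = duality_const m k.+1 * (dual_gain k)%:C.
Proof.
move=> nk; rewrite /duality_const /dual_gain -rmorphM; congr (_%:C).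
have -> : (n - k.+1 = m)%N by lia.
rewrite binS bin1 exprD mulrACA; congr (_ * _); rewrite big_ltn; last by lia.
rewrite subnn expr0 mul1r -big_split /=.
by apply: eq_big_nat => i ki; rewrite -exprSr; congr (_ ^+ _); lia.
Qed.

Lemma slice_integral_duality0 h x :
  int_vars (diagonal n) (slice_integrand n h) x =
  duality_const 0 n * dual_orbital_int n (fourier_vars (block n) h) x.
Proof.
have in0 : index_iota n n = [::] by rewrite /index_iota subnn.
have in1 : index_iota n n.-1 = [::] by rewrite /index_iota (_ : n.-1 - n = 0)%N//; lia.
rewrite /duality_const /slice_integrand /dual_orbital_int /orbital_int /dual_orbital_integrand.
rewrite /orbital_integrand /diag_neq0 /slice_phase /slice_weight /adjacent_sum.
rewrite /diagonal /offdiag /block in0 in1 /= /int_vars /fourier_vars /= !big_nil.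
rewrite !addr0 oppr0 psi0 expr0 !mulr1 !mul1r; congr h; apply/funext => p.
by rewrite /LDU /UDL; have -> : in_block n p = false by rewrite /in_block; lia.
Qed.

(* Induction on the size of the block: peeling off the pivot [a = x (k, k)] replaces [h] by a
   multiple of [elim_int k a h], and [elim_int_duality] evaluates its Fourier transform. *)
Theorem slice_integral_duality m k h x : n = (k + m)%N -> fourier_rapid (block k) h ->
  int_vars (diagonal k) (slice_integrand k h) x =
  duality_const m k * dual_orbital_int k (fourier_vars (block k) h) x.
Proof.
elim: m k h x => [|m IH] k h x nk rh.
  by rewrite addn0 in nk; subst k; exact: slice_integral_duality0.
have kn : (k < n)%N by lia.
have rg := rapid_fourier_cross kn rh (uniq_cross n k) (fun _ pk => pk).
have u_pivot : uniq ((k, k) :: offdiag k) by rewrite /= pivot_notin_offdiag uniq_offdiag.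
have [K decayK] := rapid_cquad_decay x (mem_head _ _)
  (rapid_int_vars_rem u_pivot (rapid_pivot_integrand kn rg)).
rewrite diagonal_cons// dual_orbital_int_pivot// !int_vars_cons -(cintZ _ decayK).
apply: (@eq_cint_neq _ 0) => [|a a0].
  by have [] := cquad_decayZ (duality_const m.+1 k) decayK.
set x' := upd x (k, k) a.
have xa : x' (k, k) = a by exact: upd_same.
have rH := fourier_rapid_elim_int kn a0 rh.
rewrite (int_diagonal_step kn rh xa a0) IH; [|lia|exact: fourier_rapidZ (uniq_block _ _) rH].
rewrite (fourier_varsZ hbar (c := fun=> pivot_factor k a)) ?uniq_block//; last first.
  exact: fourier_rapid_rapid rH.
rewrite dual_orbital_intZ; last exact: rH (uniq_block _ _) (fun _ pk => pk).
by rewrite (dual_orbital_int_step kn rh xa a0) mulrA -duality_const_step.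
Qed.

End SliceIntegralDuality.
(** * Schwartz functions *)

Section SmoothFourier.
Variables (R : realType) (hbar : R) (I : eqType).
Hypothesis hbar0 : hbar != 0.
Local Notation C := R[i].
Local Notation pt := (I -> R).
Local Notation fourier_var := (@fourier_var R hbar I).
Local Notation fourier_vars := (@fourier_vars R hbar I).
Implicit Types (x : pt) (s S T : seq I).

Lemma norm1_imM (a : R) (z : C) : norm1 ((0 +i* a) * z) = `|a| * norm1 z.
Proof. by rewrite /norm1 ReM ImM /= !mul0r sub0r add0r normrN !normrM mulrDr addrC. Qed.

(* [partial s] stands for the iterated partial derivative of [partial [::]] along [s]. *)
Variables (S : seq I) (partial : seq I -> pt -> C).
Hypotheses (uS : uniq S) (rapid_partial : forall s, rapid S (partial s)).
Hypothesis is_derivec_partial : forall s i x (t : R), i \in S ->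
  is_derivec t (fun u => partial s (upd x i u)) (partial (i :: s) (upd x i t)).

Lemma fourier_var_partial s i x : i \in S ->
  fourier_var i (partial (i :: s)) x = (0 +i* (hbar * x i)) * fourier_var i (partial s) x.
Proof.
move=> iS; have [K decayK] := rapid_cquad_decay x iS (rapid_partial s).
have [K' decayK'] := rapid_cquad_decay x iS (rapid_partial (i :: s)).
by apply: fourier_derive decayK decayK' _ => t; exact: is_derivec_partial.
Qed.

Lemma norm1_fourier_vars_partial T s i k x : uniq T -> {subset T <= S} -> i \in T ->
  norm1 (fourier_vars T (partial (nseq k i ++ s)) x) =
  `|hbar * x i| ^+ k * norm1 (fourier_vars T (partial s) x).
Proof.
move=> uT TS iT; elim: k => [|k IH]; first by rewrite expr0 mul1r.
rewrite exprS -mulrA -IH -norm1_imM; congr norm1.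
have perm_T : perm_eq T (rem i T ++ [:: i]) by rewrite perm_sym perm_catC perm_sym perm_to_rem.
have rT s' : rapid T (partial s') by exact: rapidS TS _.
rewrite !(perm_fourier_vars hbar perm_T uT (rT _)) !fourier_vars_cat.
have -> : fourier_vars [:: i] (partial (nseq k.+1 i ++ s)) =
    fun y => (0 +i* (hbar * y i)) * fourier_vars [:: i] (partial (nseq k i ++ s)) y.
  by apply/funext => y; exact/fourier_var_partial/TS.
have u_rem : uniq (rem i T ++ [:: i]) by rewrite -(perm_uniq perm_T).
rewrite fourier_varsZ ?rem_uniq// => [|y j t j_rem].
  apply: rapid_fourier_vars; first by rewrite uniq_catC.
  by apply: rapidS (rT _) => j; rewrite (perm_mem perm_T) !mem_cat orbC.
rewrite upd_other//; apply: contraTneq j_rem => <-.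
by move: u_rem; rewrite uniq_catC /= => /andP[].
Qed.

Lemma fourier_vars_partial_bounded T s : uniq T -> {subset T <= S} ->
  exists K, forall x, norm1 (fourier_vars T (partial s) x) <= K.
Proof.
move=> uT TS.
have [_ /(_ 0%N)[K FK]] : rapid [::] (fourier_vars T (partial s)).
  by apply: rapid_fourier_vars; rewrite cats0//; exact: rapidS TS _.
by exists K => x; have := FK x; rewrite expr0 mulr1.
Qed.

Lemma smooth_fourier_rapid : fourier_rapid hbar S (partial [::]).
Proof.
move=> T uT TS; have rT : rapid [seq i <- S | i \notin T] (fourier_vars T (partial [::])).
  apply: rapid_fourier_vars.
    rewrite cat_uniq uT filter_uniq// andbT /=; apply/hasPn => i.
    by rewrite mem_filter => /andP[].
  by apply: rapidS (rapid_partial _) => i; rewrite mem_cat mem_filter => /orP[/TS|/andP[]].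
split; first exact: rT.1.
apply: rapid_decay_coords => [|i k iS]; first exact: fourier_vars_partial_bounded.
have [iT|iT] := boolP (i \in T).
  have [K FK] := fourier_vars_partial_bounded (nseq k i ++ [::]) uT TS.
  exists (K / `|hbar| ^+ k) => x; rewrite ler_pdivlMr ?exprn_gt0 ?normr_gt0//.
  by have := FK x; rewrite norm1_fourier_vars_partial// normrM exprMn mulrC mulrA mulrAC.
have [K FK] := rT.2 k; exists K => x; apply: le_trans (FK x).
rewrite ler_wpM2l ?norm1_ge0// lerXn2r ?nnegrE ?normr_ge0 ?(ltW (bracket_gt0 _ _))//.
by apply: le_bracket; rewrite mem_filter iT.
Qed.

End SmoothFourier.

Section Lipschitz.
Variables (R : realType) (I : eqType).
Implicit Types (x y : I -> R) (S : seq I).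

Lemma lipschitz_derive_le (g dg : R -> R) (K : R) :
  (forall t : R, is_derive t 1 g (dg t)) -> (forall t, `|dg t| <= K) ->
  forall t u, `|g t - g u| <= K * `|t - u|.
Proof.
move=> dgP dgK t u; wlog tu : t u / t <= u.
  by move=> lip; case: (leP t u) => [/lip //|/ltW/lip]; rewrite distrC [`|u - t|]distrC.
have cg : continuous g.
  by move=> v; apply/differentiable_continuous/derivable1_diffP; exact: ex_derive.
have [v _ gE] := MVT_segment tu (fun v _ => dgP v) (continuous_subspaceT cg).
by rewrite distrC gE normrM distrC; apply: ler_wpM2r.
Qed.

Lemma lipschitz_coords S (g : (I -> R) -> R) (K : R) x y : 0 <= K ->
  (forall x i t u, i \in S -> `|g (upd x i t) - g (upd x i u)| <= K * `|t - u|) ->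
  (forall j, j \notin S -> x j = y j) ->
  `|g x - g y| <= K * \sum_(i <- S) `|x i - y i|.
Proof.
move=> K0; elim: S y => [|i S IH] y lip xy.
  by have -> : x = y by [apply/funext => j; exact: xy]; rewrite subrr normr0 big_nil mulr0.
rewrite big_cons mulrDr; pose z := upd y i (x i).
have -> : g x - g y = (g z - g y) + (g x - g z) by ring.
apply: le_trans (ler_normD _ _) _; apply: lerD.
  by have := lip y i (x i) (y i) (mem_head _ _); rewrite upd_id.
apply: le_trans (IH z _ _) _.
- by move=> x' j t u jS; apply: lip; rewrite inE jS orbT.
- move=> j jS; rewrite /z /upd; case: eqP => [->//|/eqP ji].
  by apply: xy; rewrite inE negb_or ji.
apply: ler_wpM2l => //; apply: ler_sum => j _; rewrite /z /upd.
by case: eqP => // ->; rewrite subrr normr0.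
Qed.

Lemma lipschitz_seqcont S (g : (I -> R) -> R) (K : R) : 0 <= K ->
  (forall x i t u, i \in S -> `|g (upd x i t) - g (upd x i u)| <= K * `|t - u|) ->
  (forall x y, {in S, x =1 y} -> g x = g y) -> seqcont g.
Proof.
move=> K0 lip dep x_ x x_x; pose y_ m j := if j \in S then x_ m j else x j.
have dist_le m : `|g x - g (x_ m)| <= K * \sum_(i <- S) `|x i - x_ m i|.
  have -> : g (x_ m) = g (y_ m) by apply: dep => j jS; rewrite /y_ jS.
  have -> : \sum_(i <- S) `|x i - x_ m i| = \sum_(i <- S) `|x i - y_ m i|.
    by apply: eq_big_seq => j jS; rewrite /y_ jS.
  by apply: lipschitz_coords => // j jS; rewrite /y_ (negPf jS).
have dist0 : K * \sum_(i <- S) `|x i - x_ m i| @[m --> \oo] --> 0.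
  have : seqcont (fun z : I -> R => K * \sum_(i <- S) `|x i - z i|).
    apply: seqcontM; first exact: seqcont_cst.
    apply: seqcont_sum => i _ z_ z z_z.
    by apply: cvg_norm; apply: cvgB; [exact: cvg_cst|exact: z_z].
  by move=> /(_ _ _ x_x); rewrite big1 ?mulr0// => i _; rewrite subrr normr0.
apply/cvgrPdist_le => e e0; move/cvgrPdist_le : dist0 => /(_ e e0); apply: filterS => m.
by rewrite sub0r normrN => /(le_trans (ler_norm _)); exact: le_trans.
Qed.

End Lipschitz.

Section SchwartzFourier.
Variables (R : realType) (hbar : R) (n : nat).
Hypothesis hbar0 : hbar != 0.
Local Notation C := R[i].
Local Notation Re := complex.Re.
Local Notation Im := complex.Im.
Local Notation pt := ((nat * nat)%type -> R).
Implicit Types (x : pt) (i j : 'I_n) (f : 'M[R]_n -> R).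

(* The rows are reversed: [wmx_of_point x = w X] for the matrix [X] with entries [x (i, j)]. *)
Definition entry_slot i j : nat * nat := (nat_of_ord (rev_ord i), nat_of_ord j).
Definition wmx_of_point x : 'M[R]_n := \matrix_(i, j) x (entry_slot i j).

Definition slot_index (q : nat * nat) : option ('I_n * 'I_n) :=
  if insub q.1 is Some i then if insub q.2 is Some j then Some (rev_ord i, j) else None else None.

Lemma slot_indexK i j : slot_index (entry_slot i j) = Some (i, j).
Proof. by rewrite /slot_index !valK rev_ordK. Qed.

Lemma mem_block_ord i j : (nat_of_ord i, nat_of_ord j) \in block n 0.
Proof. by rewrite mem_block /in_block /= !ltn_ord. Qed.

Lemma mem_block_slotP (q : nat * nat) : q \in block n 0 -> exists i j, q = entry_slot i j.
Proof.
rewrite mem_block => /andP[/andP[_ q1] /andP[_ q2]].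
exists (rev_ord (Ordinal q1)), (Ordinal q2); rewrite /entry_slot rev_ordK.
by case: q q1 q2.
Qed.

Lemma entry_slot_eq i j k l : (entry_slot i j == entry_slot k l) = ((i, j) == (k, l)).
Proof. by rewrite !xpair_eqE !(inj_eq val_inj) (inj_eq rev_ord_inj). Qed.

Lemma eq_wmx_of_point x y : {in block n 0, x =1 y} -> wmx_of_point x = wmx_of_point y.
Proof. by move=> xy; apply/matrixP => i j; rewrite !mxE xy// mem_block_ord. Qed.

Lemma wmx_of_point_upd x i j t u :
  wmx_of_point (upd x (entry_slot i j) (u + t)) =
  u *: delta_mx i j + wmx_of_point (upd x (entry_slot i j) t).
Proof.
apply/matrixP => k l; rewrite !mxE /upd entry_slot_eq xpair_eqE.
by case: ifP => _ /=; rewrite ?mulr1 ?mulr0 ?add0r.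
Qed.

Lemma is_derive_entry f x i j (t : R) (x_ := fun u => wmx_of_point (upd x (entry_slot i j) u)) :
  derivable f (x_ t) (delta_mx i j) ->
  is_derive t 1 (fun u => f (x_ u)) ('D_(delta_mx i j) f (x_ t)).
Proof.
move=> df; have quotientE : (fun u : R => u^-1 *: (((fun v => f (x_ v)) \o shift t) (u *: 1)
     - f (x_ t))) = (fun u : R => u^-1 *: ((f \o shift (x_ t)) (u *: delta_mx i j) - f (x_ t))).
  by apply/funext => u /=; rewrite /x_ wmx_of_point_upd [u *: 1]mulr1.
have dg : derivable (fun u => f (x_ u)) t 1 by rewrite /derivable quotientE.
by apply: DeriveDef => //; rewrite /derive quotientE.
Qed.

Lemma entry_le_norm (A : 'M[R]_n) i j : `|A i j| <= `|A|.
Proof.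
rewrite [leRHS]/Num.Def.normr /= mx_normrE.
exact: (le_bigmax _ (fun ij => `|A ij.1 ij.2|) (i, j)).
Qed.

Lemma schwartzR_bounded f s : schwartzR f ->
  exists2 K, 0 <= K & forall A, `|iter_partial s f A| <= K.
Proof.
move=> /(_ s) [_ /(_ 0%N)[K fK]]; exists K => [|A].
  by apply: le_trans (fK 0); rewrite mulr_ge0// exprn_ge0// addr_ge0.
by have := fK A; rewrite expr0 mul1r.
Qed.

Lemma schwartzR_partial_bounded f s : schwartzR f ->
  exists2 K, 0 <= K & forall ij A, `|iter_partial (ij :: s) f A| <= K.
Proof.
move=> sf; have /choice[B BP] : forall ij : 'I_n * 'I_n,
    exists K, 0 <= K /\ forall A, `|iter_partial (ij :: s) f A| <= K.
  by move=> ij; have [K K0 fK] := schwartzR_bounded (ij :: s) sf; exists K.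
exists (\sum_ij B ij) => [|ij A]; first by apply: sumr_ge0 => ij _; exact: (BP ij).1.
apply: le_trans ((BP ij).2 A) _; rewrite (bigD1 ij)//= lerDl.
by apply: sumr_ge0 => kl _; exact: (BP kl).1.
Qed.

Lemma schwartzR_seqcont f s : schwartzR f ->
  seqcont (fun x => iter_partial s f (wmx_of_point x)).
Proof.
move=> sf; have [K K0 fK] := schwartzR_partial_bounded s sf.
apply: (@lipschitz_seqcont _ _ (block n 0) _ K) => // [x q t u /mem_block_slotP[i [j ->]]|x y xy].
  pose x_ v := wmx_of_point (upd x (entry_slot i j) v).
  apply: (@lipschitz_derive_le _ (fun v => iter_partial s f (x_ v))
    (fun v => iter_partial ((i, j) :: s) f (x_ v))) => // v.
  by apply: is_derive_entry; exact: (sf s).1.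
by rewrite (eq_wmx_of_point xy).
Qed.

Lemma schwartzR_decay f s i j k : schwartzR f ->
  exists K, forall x, `|iter_partial s f (wmx_of_point x)| * `|x (entry_slot i j)| ^+ k <= K.
Proof.
move=> sf; have [_ /(_ k)[K fK]] := sf s; exists K => x.
apply: le_trans (fK (wmx_of_point x)); rewrite mulrC ler_wpM2r//.
rewrite lerXn2r ?nnegrE ?addr_ge0//; apply: (@le_trans _ _ `|wmx_of_point x|).
  by have := entry_le_norm (wmx_of_point x) i j; rewrite mxE.
by rewrite lerDr.
Qed.

Variable h : 'M[R]_n -> C.
Hypothesis sh : schwartz h.

Definition slot_partial (s : seq (nat * nat)) x : C :=
  iter_partial (pmap slot_index s) (fun A => Re (h A)) (wmx_of_point x) +i*
  iter_partial (pmap slot_index s) (fun A => Im (h A)) (wmx_of_point x).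

Lemma rapid_slot_partial s : rapid (block n 0) (slot_partial s).
Proof.
have [sRe sIm] := sh; pose r := pmap slot_index s.
split=> [x_ x x_x|].
  by split; [exact: (@schwartzR_seqcont _ r sRe x_ x)|exact: (@schwartzR_seqcont _ r sIm x_ x)].
apply: rapid_decay_coords => [|q k /mem_block_slotP[i [j ->]]].
  have [[K _ ReK] [K' _ ImK']] := (schwartzR_bounded r sRe, schwartzR_bounded r sIm).
  by exists (K + K') => x; exact: lerD (ReK _) (ImK' _).
have [[K ReK] [K' ImK']] := (schwartzR_decay r i j k sRe, schwartzR_decay r i j k sIm).
by exists (K + K') => x; rewrite /norm1 mulrDl; exact: lerD (ReK _) (ImK' _).
Qed.

Lemma schwartz_fourier_rapid : fourier_rapid hbar (block n 0) (fun x => h (wmx_of_point x)).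
Proof.
have -> : (fun x => h (wmx_of_point x)) = slot_partial [::].
  by apply/funext => x; rewrite /slot_partial /=; case: (h _).
apply: smooth_fourier_rapid => //; [exact: uniq_block|exact: rapid_slot_partial|].
move=> s q x t /mem_block_slotP[i [j ->]]; rewrite /slot_partial /= slot_indexK.
by split; apply: is_derive_entry; [exact: (sh.1 _).1|exact: (sh.2 _).1].
Qed.

End SchwartzFourier.

(** * Parallel transport *)

Section MxDerive.
Variable R : realType.

Lemma is_derive_unique (f : R -> R) (t a b : R) :
  is_derive t 1 f a -> is_derive t 1 f b -> a = b.
Proof. by move=> [_ <-] [_ <-]. Qed.

Lemma is_derive_bigsum (J : Type) (r : seq J) (P : pred J) (f : J -> R -> R) (df : J -> R)
    (t : R) : (forall j, P j -> is_derive t 1 (f j) (df j)) ->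
  is_derive t 1 (fun s => \sum_(j <- r | P j) f j s) (\sum_(j <- r | P j) df j).
Proof.
move=> dfP; elim: r => [|j r IH].
  by under eq_fun do rewrite big_nil; rewrite big_nil; exact: is_derive_cst.
under eq_fun do rewrite big_cons; rewrite big_cons.
by case: ifP => [Pj|_//]; have ? := dfP _ Pj; exact: is_deriveD.
Qed.

Definition is_derive_mx m k (P : R -> 'M[R]_(m, k)) (t : R) (P' : 'M[R]_(m, k)) :=
  forall i j, is_derive t 1 (fun s => P s i j) (P' i j).

Lemma is_derive_mx_unique m k (P : R -> 'M[R]_(m, k)) t P1 P2 :
  is_derive_mx P t P1 -> is_derive_mx P t P2 -> P1 = P2.
Proof. by move=> d1 d2; apply/matrixP => i j; exact: is_derive_unique (d1 i j) (d2 i j). Qed.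

Lemma is_derive_mx_cst m k (A : 'M[R]_(m, k)) t : is_derive_mx (fun=> A) t 0.
Proof. by move=> i j; rewrite mxE; exact: is_derive_cst. Qed.

Lemma is_derive_mxM m k l (P : R -> 'M[R]_(m, k)) (Q : R -> 'M[R]_(k, l)) t P' Q' :
  is_derive_mx P t P' -> is_derive_mx Q t Q' ->
  is_derive_mx (fun s => P s *m Q s) t (P' *m Q t + P t *m Q').
Proof.
move=> dP dQ i j; rewrite !mxE -big_split /=; under eq_fun do rewrite mxE.
apply: is_derive_bigsum => q _; have [? ?] := (dP i q, dQ q j).
by apply: is_derive_eq; rewrite /GRing.scale /=; ring.
Qed.

Lemma is_derive_mx_affine m k (A B : 'M[R]_(m, k)) t : is_derive_mx (fun s => A + s *: B) t B.
Proof.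
move=> i j; under eq_fun do rewrite !mxE.
by apply: is_derive_eq; rewrite /GRing.scale /=; ring.
Qed.

Lemma is_derive_mxtrace m (P : R -> 'M[R]_m) t P' :
  is_derive_mx P t P' -> is_derive t 1 (fun s => \tr (P s)) (\tr P').
Proof. by move=> dP; apply: is_derive_bigsum => i _; exact: dP. Qed.

Lemma is_derive_fchar m (P : R -> 'M[R]_m) t P' : is_derive_mx P t P' ->
  is_derive t 1 (fun s => fchar (P s)) (fchar P').
Proof.
by move=> dP; apply: is_derive_bigsum => i _; apply: is_derive_bigsum => j _; exact: dP.
Qed.

Lemma near_eq_is_derive_mx m k (P Q : R -> 'M[R]_(m, k)) t P' :
  (\forall s \near t, P s = Q s) -> is_derive_mx P t P' -> is_derive_mx Q t P'.
Proof.
move=> PQ dP i j; have := dP i j; apply: near_eq_is_derive.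
by apply: filterS PQ => s ->.
Qed.

Lemma derivable_is_derive_mx m k (P : R -> 'M[R]_(m, k)) (t : R) :
  (forall i j, derivable (fun s => P s i j) t 1) -> exists P', is_derive_mx P t P'.
Proof.
move=> dP; exists (\matrix_(i, j) 'D_1 (fun s => P s i j) t) => i j.
by rewrite mxE; apply/derivableP.
Qed.

Lemma is_derive_mx_pair n (gamma : R -> 'M[R]_n * 'M[R]_n) t : derivable gamma t 1 ->
  is_derive_mx (fun s => (gamma s).1) t (derive1 gamma t).1 /\
  is_derive_mx (fun s => (gamma s).2) t (derive1 gamma t).2.
Proof.
move=> dg; rewrite derive1E.
have cvg_quotient : u^-1 *: ((gamma \o shift t) (u *: 1) - gamma t) @[u --> 0^'] -->
    'D_1 gamma t by exact: dg.
have is_derive_entry_of (pr : 'M[R]_n * 'M[R]_n -> 'M[R]_n) i j :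
    continuous (fun z => pr z i j) -> (forall z z', pr (z - z') = pr z - pr z') ->
    (forall u z, pr (u *: z) = u *: pr z) ->
    is_derive t 1 (fun s => pr (gamma s) i j) (pr ('D_1 gamma t) i j).
  move=> c_pr prB prZ; have := cvg_comp _ _ cvg_quotient (c_pr _).
  have -> : (fun z => pr z i j) \o
      (fun u : R => u^-1 *: ((gamma \o shift t) (u *: 1) - gamma t)) =
      (fun u : R => u^-1 *: (((fun s => pr (gamma s) i j) \o shift t) (u *: 1) -
        pr (gamma t) i j)).
    by apply/funext => u /=; rewrite prZ prB !mxE.
  move=> cvg_pr; apply: DeriveDef; first by apply/cvg_ex; eexists; exact: cvg_pr.
  exact: cvg_lim cvg_pr.
have c_entry i j (pr : 'M[R]_n * 'M[R]_n -> 'M[R]_n) : continuous pr ->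
    continuous (fun z => pr z i j).
  move=> c_pr z; apply: (@continuous_comp _ _ _ pr (fun A => A i j) z (c_pr z)).
  exact: coord_continuous.
split=> i j; [apply: (is_derive_entry_of fst)|apply: (is_derive_entry_of snd)] => //.
  by apply: c_entry => z; exact: cvg_fst.
by apply: c_entry => z; exact: cvg_snd.
Qed.

Lemma derivable_pair_mx n (P Q : R -> 'M[R]_n) (t : R) P' Q' :
  is_derive_mx P t P' -> is_derive_mx Q t Q' ->
  derivable (fun s => (P s, Q s)) t 1 /\ derive1 (fun s => (P s, Q s)) t = (P', Q').
Proof.
move=> dP dQ.
have cvg_mx (S : R -> 'M[R]_n) S' : is_derive_mx S t S' ->
    u^-1 *: ((S \o shift t) (u *: 1) - S t) @[u --> 0^'] --> S'.
  move=> dS; have dS' : derivable S t 1 by apply/derivable_mxP => i j; have [] := dS i j.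
  suff <- : 'D_1 S t = S' by exact: dS'.
  by rewrite derive_mx//; apply/matrixP => i j; rewrite mxE; have [_ ->] := dS i j.
have cvg_PQ : u^-1 *: (((fun s => (P s, Q s)) \o shift t) (u *: 1) - (P t, Q t)) @[u --> 0^'] -->
    (P', Q').
  exact: cvg_pair (cvg_mx _ _ dP) (cvg_mx _ _ dQ).
split; first by apply/cvg_ex; exists (P', Q').
by rewrite derive1E; exact: cvg_lim cvg_PQ.
Qed.

Definition mx_horner m k (P : 'M[{poly R}]_(m, k)) (t : R) : 'M[R]_(m, k) :=
  map_mx (horner_eval t) P.

Lemma mx_horner_polyC m k (A : 'M[R]_(m, k)) t : mx_horner (map_mx polyC A) t = A.
Proof. by apply/matrixP => i j; rewrite !mxE /horner_eval hornerC. Qed.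

Lemma is_derive_mx_horner m k (P : 'M[{poly R}]_(m, k)) t :
  is_derive_mx (mx_horner P) t (mx_horner (map_mx (@deriv R) P) t).
Proof.
move=> i j; have -> : (fun s => mx_horner P s i j) = horner (P i j).
  by apply/funext => s; rewrite mxE.
by rewrite !mxE; exact: is_derive_poly.
Qed.

Lemma C1_path_horner n (P Q : 'M[{poly R}]_n) :
  C1_path (fun t => (mx_horner P t, mx_horner Q t)).
Proof.
have dPQ (P1 P2 : 'M[{poly R}]_n) (t : R) :=
  derivable_pair_mx (is_derive_mx_horner P1 t) (is_derive_mx_horner P2 t).
split=> [t|]; first by have [] := dPQ P Q t.
have -> : derive1 (fun t => (mx_horner P t, mx_horner Q t)) =
    (fun t => (mx_horner (map_mx (@deriv R) P) t, mx_horner (map_mx (@deriv R) Q) t)).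
  by apply/funext => t; have [] := dPQ P Q t.
move=> t; apply: differentiable_continuous; apply/derivable1_diffP.
by have [] := dPQ (map_mx (@deriv R) P) (map_mx (@deriv R) Q) t.
Qed.

End MxDerive.

Section Transport.
Variables (R : realType) (hbar : R) (n : nat).
Local Notation C := R[i].
Local Notation pt := (phase_space R n).
Local Notation psi := (@psi R hbar).
Implicit Types (S : set pt) (g : pt -> R) (gamma : R -> pt).

(* A primitive of the connection form along the differentiable paths in [S]. *)
Definition primitive_along S g := forall gamma,
  (forall t : R, derivable gamma t 1) -> forall t : R,
  derivable (fun s => g (gamma s)) t 1 /\
  ((\forall s \near t, S (gamma s)) ->
   is_derive t 1 (fun s => g (gamma s)) (\tr ((gamma t).2 *m (derive1 gamma t).1))).

Lemma derivable_continuousR (f : R -> R) : (forall t : R, derivable f t 1) -> continuous f.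
Proof. by move=> df t; apply/differentiable_continuous/derivable1_diffP. Qed.

Lemma eq_of_is_derivec0 (f : R -> C) : ccontinuous f ->
  (forall t : R, 0 < t < 1 -> is_derivec t f 0) -> f 1 = f 0.
Proof.
move=> [cr ci] df; have eq_of_is_derive0 (g : R -> R) : continuous g ->
    (forall t : R, 0 < t < 1 -> is_derive t 1 g 0) -> g 1 = g 0.
  move=> cg dg; apply/eqP; rewrite -subr_eq0; apply/eqP.
  have dg' (t : R) : t \in `]0, 1[%R -> is_derive t 1 g 0 by rewrite in_itv; exact: dg.
  have [_ _ ->] := @MVT_segment R g (fun=> 0) 0 1 ler01 dg' (continuous_subspaceT cg).
  by rewrite mul0r.
apply: eq_ReIm; first by apply: (eq_of_is_derive0 (fun t => complex.Re (f t))) => // t /df[].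
by apply: (eq_of_is_derive0 (fun t => complex.Im (f t))) => // t /df[].
Qed.

Lemma is_transport_psi S g x z c : primitive_along S g ->
  is_transport hbar S x z c -> c = psi (g x - g z).
Proof.
move=> pg [gamma [u [[dga _] Sg [g0 g1] hu [u0 u1]]]].
pose G (t : R) := g (gamma t) - g z.
have cG : continuous G.
  apply: derivable_continuousR => t; apply: derivableB; last exact: derivable_cst.
  exact: (pg gamma dga t).1.
have cu : ccontinuous u by split; apply: derivable_continuousR => t; have [[? _] [? _]] := hu t.
have psi_const : u 1 * psi (-1 * G 1) = u 0 * psi (-1 * G 0).
  apply: (eq_of_is_derivec0 (f := fun t => u t * psi (-1 * G t))) => [|t /andP[t0 t1]].
    by apply: ccontinuousM => //; exact: ccontinuous_comp (ccontinuous_psi hbar _) cG.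
  have near_S : \forall s \near t, S (gamma s).
    have : \forall s \near t, s \in `]0, 1[%R by apply: near_in_itvoo; rewrite in_itv /= t0.
    by apply: filterS => s; rewrite in_itv /= => /andP[s0 s1]; apply: Sg; rewrite !ltW.
  have dg := (pg gamma dga t).2 near_S; set tau := \tr _ in dg.
  have dG : is_derive t 1 (fun s => -1 * G s) (- tau).
    by rewrite /G; apply: is_derive_eq; rewrite /GRing.scale /=; ring.
  have := is_derivecM (hu t) (is_derivec_psi hbar dG); rewrite -/tau; congr is_derivec.
  by apply: eq_ReIm; rewrite /= ?ReD ?ImD !(ReM, ImM) /=; ring.
have G0 : G 0 = 0 by rewrite /G g0 subrr.
have G1 : G 1 = g x - g z by rewrite /G g1.
move: psi_const; rewrite G0 mulr0 psi0 u0 G1 mulN1r mulr1 u1 => cpsi.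
by rewrite -[LHS]mulr1 -(psi_mulN hbar (g x - g z)) mulrCA cpsi mulr1.
Qed.

Lemma is_transport_path S g x z gamma : primitive_along S g ->
  C1_path gamma -> (forall t, S (gamma t)) -> gamma 0 = z -> gamma 1 = x ->
  is_transport hbar S x z (psi (g x - g z)).
Proof.
move=> pg Cg Sg g0 g1; exists gamma, (fun t => psi (g (gamma t) - g z)); split=> //.
  move=> t; apply: is_derivec_psi.
  have dg : is_derive t 1 (fun s => g (gamma s)) (\tr ((gamma t).2 *m (derive1 gamma t).1)).
    by apply: (pg gamma Cg.1 t).2; exact: filterE.
  by apply: is_derive_eq; rewrite subr0.
by rewrite g0 g1 subrr psi0.
Qed.

Lemma transport_psi S g x z gamma : primitive_along S g ->
  C1_path gamma -> (forall t, S (gamma t)) -> gamma 0 = z -> gamma 1 = x ->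
  transport hbar S x z = psi (g x - g z).
Proof.
move=> pg Cg Sg g0 g1; apply: (is_transport_psi pg).
have := is_transport_path pg Cg Sg g0 g1.
by move=> /(ex_intro (is_transport hbar S x z) _); exact: (xgetPex 0).
Qed.

End Transport.

(** * Unipotent matrices and the moment map *)

Section Unipotent.
Variables (R : realType) (n : nat).
Local Notation M := 'M[R]_n.
Implicit Types (u v X : M).

Lemma NgroupP u : Ngroup u <-> (forall i j : 'I_n, (j < i)%N -> u i j = 0) /\ forall i, u i i = 1.
Proof.
split=> [Nu|[u0 u1] i j ji].
  split=> [i j ji|i].
    have := Nu i j (ltnW ji); rewrite !mxE (_ : (i == j) = false) ?subr0//.
    by apply/negbTE; rewrite neq_ltn ji orbT.
  by have /eqP := Nu i i (leqnn _); rewrite !mxE eqxx subr_eq0 => /eqP.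
rewrite !mxE; case: eqP => [<-|/eqP ij]; first by rewrite u1 subrr.
by rewrite u0 ?subr0// ltn_neqAle ji andbT eq_sym.
Qed.

Lemma eq_Ngroup u v : Ngroup u -> Ngroup v ->
  (forall i j : 'I_n, (i < j)%N -> u i j = v i j) -> u = v.
Proof.
move=> /NgroupP[u0 u1] /NgroupP[v0 v1] uv; apply/matrixP => i j.
have [/uv //|ji|/val_inj ->] := ltngtP i j; first by rewrite u0 ?v0.
by rewrite u1 v1.
Qed.

Lemma Ngroup1 : Ngroup (1%:M : M).
Proof. by move=> i j _; rewrite subrr mxE. Qed.

Lemma NgroupD u X : Ngroup u -> strict_upper X -> Ngroup (u + X).
Proof. by move=> Nu sX i j ji; rewrite addrAC [LHS]mxE Nu// sX// addr0. Qed.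

Lemma mulmx_Ngroup (X : M) u i j : Ngroup u ->
  (X *m u) i j = X i j + \sum_(k < n | (k < j)%N) X i k * u k j.
Proof.
move=> /NgroupP[u0 u1]; rewrite mxE (bigD1 j)//= u1 mulr1; congr (_ + _).
rewrite (bigID (fun k : 'I_n => (k < j)%N)) /= [X in _ + X]big1 => [|k /andP[kj]]; last first.
  by rewrite -leqNgt => jk; rewrite u0 ?mulr0// ltn_neqAle jk andbT eq_sym; exact: kj.
by rewrite addr0; apply: eq_bigl => k; rewrite -val_eqE /=; lia.
Qed.

Lemma Ngroup_mulmx u (X : M) i j : Ngroup u ->
  (u *m X) i j = X i j + \sum_(k < n | (i < k)%N) u i k * X k j.
Proof.
move=> /NgroupP[u0 u1]; rewrite mxE (bigD1 i)//= u1 mul1r; congr (_ + _).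
rewrite (bigID (fun k : 'I_n => (i < k)%N)) /= [X in _ + X]big1 => [|k /andP[ki]]; last first.
  by rewrite -leqNgt => ik; rewrite u0 ?mul0r// ltn_neqAle ik andbT; exact: ki.
by rewrite addr0; apply: eq_bigl => k; rewrite -val_eqE /=; lia.
Qed.

Lemma NgroupM u v : Ngroup u -> Ngroup v -> Ngroup (u *m v).
Proof.
move=> Nu Nv; have [u0 u1] := (NgroupP u).1 Nu; have [v0 v1] := (NgroupP v).1 Nv.
apply/NgroupP; split=> [i j ji|i]; rewrite mulmx_Ngroup//.
  rewrite u0// add0r big1// => k kj; rewrite u0 ?mul0r//; exact: ltn_trans ji.
by rewrite u1 big1 ?addr0// => k ki; rewrite u0 ?mul0r.
Qed.

Lemma det_Ngroup u : Ngroup u -> \det u = 1.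
Proof.
move=> /NgroupP [u0 u1]; rewrite -det_tr det_trig; last first.
  by apply/is_trig_mxP => i j ij; rewrite mxE u0.
by rewrite big1// => i _; rewrite mxE u1.
Qed.

Lemma Ngroup_unitmx u : Ngroup u -> u \in unitmx.
Proof. by move=> Nu; rewrite unitmxE det_Ngroup// unitr1. Qed.

Lemma invmx_Ngroup u : Ngroup u -> invmx u = \adj u.
Proof. by move=> Nu; rewrite /invmx Ngroup_unitmx// det_Ngroup// invr1 scale1r. Qed.

Lemma invmx_Ngroup_rec u i j : Ngroup u ->
  invmx u i j = (i == j)%:R - \sum_(k < n | (k < j)%N) invmx u i k * u k j.
Proof.
move=> Nu; have : invmx u *m u = 1%:M by rewrite mulVmx// Ngroup_unitmx.
by move=> /(congr1 (fun A : M => A i j)); rewrite mulmx_Ngroup// mxE => <-; rewrite addrK.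
Qed.

Lemma NgroupV u : Ngroup u -> Ngroup (invmx u).
Proof.
move=> Nu; have invu0 m (i j : 'I_n) : (j < m)%N -> (j < i)%N -> invmx u i j = 0.
  elim: m i j => [//|m IH] i j jm ji; rewrite invmx_Ngroup_rec// big1 ?subr0 => [|k kj].
    by rewrite (_ : (i == j) = false)//; apply/negbTE; rewrite neq_ltn ji orbT.
  by rewrite IH ?mul0r//; [apply: leq_trans kj _|exact: ltn_trans ji].
apply/NgroupP; split=> [i j ji|i]; first exact: invu0 (ltnSn j) ji.
by rewrite invmx_Ngroup_rec// eqxx big1 ?subr0// => k ki; rewrite (invu0 k.+1) ?mul0r.
Qed.

Lemma strict_upper_mulr X u : strict_upper X -> Ngroup u -> strict_upper (X *m u).
Proof.
move=> sX Nu i j ji; rewrite mulmx_Ngroup// sX// add0r big1// => k kj.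
by rewrite sX ?mul0r//; apply: ltnW; exact: leq_trans ji.
Qed.

Lemma strict_upper_mull X u : strict_upper X -> Ngroup u -> strict_upper (u *m X).
Proof.
move=> sX Nu i j ji; rewrite Ngroup_mulmx// sX// add0r big1// => k ik.
by rewrite sX ?mulr0//; apply: ltnW; exact: leq_ltn_trans ik.
Qed.

Lemma fcharZ c X : fchar (c *: X) = c * fchar X.
Proof.
rewrite /fchar mulr_sumr; apply: eq_bigr => i _; rewrite mulr_sumr.
by apply: eq_bigr => j _; rewrite mxE.
Qed.

Lemma fchar1 : fchar (1%:M : M) = 0.
Proof.
rewrite /fchar big1// => i _; rewrite big1// => j /eqP ji; rewrite mxE.
by rewrite (_ : (i == j) = false)// -val_eqE /= ji; lia.
Qed.

Lemma fchar_mulr X u : strict_upper X -> Ngroup u -> fchar (X *m u) = fchar X.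
Proof.
move=> sX Nu; apply: eq_bigr => i _; apply: eq_bigr => j /eqP ji.
rewrite mulmx_Ngroup// big1 ?addr0// => k kj; rewrite sX ?mul0r//.
by move: kj; rewrite ji ltnS.
Qed.

Lemma fchar_mull X u : strict_upper X -> Ngroup u -> fchar (u *m X) = fchar X.
Proof.
move=> sX Nu; apply: eq_bigr => i _; apply: eq_bigr => j /eqP ji.
rewrite Ngroup_mulmx// big1 ?addr0// => k ik; rewrite sX ?mulr0//.
by rewrite ji.
Qed.

Lemma momentE (z : phase_space R n) X1 X2 :
  moment z X1 X2 = \tr (z.2 *m z.1 *m X2) - \tr (z.1 *m z.2 *m X1).
Proof.
rewrite /moment mulmxBr raddfB /= !mulmxA; congr (_ - _).
by rewrite mxtrace_mulC mulmxA.
Qed.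

Lemma M_ffP (z : phase_space R n) : M_ff z <->
  (forall X, strict_upper X -> \tr (z.2 *m z.1 *m X) = fchar X) /\
  (forall X, strict_upper X -> \tr (z.1 *m z.2 *m X) = fchar X).
Proof.
have su0 : strict_upper (0 : M) by move=> i j _; rewrite mxE.
have fchar0 : fchar (0 : M) = 0 by rewrite -[0](scale0r 0) fcharZ mul0r.
split=> [zM|[tr_r tr_l] X1 X2 s1 s2]; last by rewrite momentE tr_r// tr_l// addrC.
split=> X sX.
  by have := zM 0 X su0 sX; rewrite momentE !mulmx0 mxtrace0 fchar0 subr0 oppr0 add0r.
have := zM X 0 sX su0.
by rewrite momentE !mulmx0 mxtrace0 fchar0 sub0r addr0 => /oppr_inj.
Qed.

Lemma mxtrace_conj (A u X : M) :
  \tr (invmx u *m A *m u *m X) = \tr (A *m (u *m X *m invmx u)).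
Proof. by rewrite -!mulmxA mxtrace_mulC !mulmxA. Qed.

Lemma strict_upper_conj u X : Ngroup u -> strict_upper X -> strict_upper (u *m X *m invmx u).
Proof. by move=> Nu sX; apply: strict_upper_mulr; [exact: strict_upper_mull|exact: NgroupV]. Qed.

Lemma fchar_conj u X : Ngroup u -> strict_upper X -> fchar (u *m X *m invmx u) = fchar X.
Proof.
by move=> Nu sX; rewrite fchar_mulr ?fchar_mull//; [exact: strict_upper_mull|exact: NgroupV].
Qed.

Lemma M_ff_act (z : phase_space R n) u v : Ngroup u -> Ngroup v -> M_ff z -> M_ff (act z (u, v)).
Proof.
move=> Nu Nv /M_ffP[tr_r tr_l].
have conj_mul (A B u' v' : M) : Ngroup u' ->
    invmx v' *m B *m u' *m (invmx u' *m A *m v') = invmx v' *m (B *m A) *m v'.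
  by move=> Nu'; rewrite !mulmxA mulmxK ?Ngroup_unitmx.
apply/M_ffP; split=> X sX; rewrite /act /= conj_mul// mxtrace_conj.
  by rewrite tr_r ?fchar_conj//; exact: strict_upper_conj.
by rewrite tr_l ?fchar_conj//; exact: strict_upper_conj.
Qed.

Lemma M_ff_affine (A0 A1 B : M) t :
  M_ff (A0, B) -> M_ff (A1, B) -> M_ff (A0 + t *: (A1 - A0), B).
Proof.
move=> /M_ffP[/= r0 l0] /M_ffP[/= r1 l1]; apply/M_ffP; split=> X sX /=.
  rewrite mulmxDr mulmxDl mxtraceD -scalemxAr -scalemxAl mxtraceZ mulmxBr mulmxBl raddfB.
  by rewrite /= r0// r1// subrr mulr0 addr0.
rewrite !mulmxDl mxtraceD -!scalemxAl mxtraceZ !mulmxBl raddfB.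
by rewrite /= l0// l1// subrr mulr0 addr0.
Qed.

Lemma act1 (z : phase_space R n) : act z (1%:M, 1%:M) = z.
Proof. by case: z => A B; rewrite /act /= invmx1 !mul1mx !mulmx1. Qed.

Lemma actK (z : phase_space R n) u v : Ngroup u -> Ngroup v ->
  act (act z (u, v)) (invmx u, invmx v) = z.
Proof.
case: z => A B Nu Nv; rewrite /act /= !invmxK !mulmxA.
by rewrite !mulmxV ?Ngroup_unitmx// !mul1mx !mulmxK ?Ngroup_unitmx.
Qed.

Definition unip_segment u (t : R) : M := 1%:M + (1 - t) *: (u - 1%:M).

Lemma unip_segment0 u : unip_segment u 0 = u.
Proof. by rewrite /unip_segment subr0 scale1r addrC subrK. Qed.

Lemma unip_segment1 u : unip_segment u 1 = 1%:M.
Proof. by rewrite /unip_segment subrr scale0r addr0. Qed.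

Lemma Ngroup_unip_segment u t : Ngroup u -> Ngroup (unip_segment u t).
Proof. by move=> Nu; apply: NgroupD Ngroup1 _ => i j ji; rewrite mxE Nu// mulr0. Qed.

(* The inverses are polynomial, being adjugates. *)
Lemma C1_act_path (A0 A1 B u v : M) : Ngroup u -> Ngroup v ->
  C1_path (fun t => act (A0 + t *: (A1 - A0), B) (unip_segment u t, unip_segment v t)).
Proof.
move=> Nu Nv.
pose segment (w : M) : 'M[{poly R}]_n := 1%:M + (1 - 'X) *: map_mx polyC (w - 1%:M).
pose line : 'M[{poly R}]_n := map_mx polyC A0 + 'X *: map_mx polyC (A1 - A0).
have segmentE w t : mx_horner (segment w) t = unip_segment w t.
  apply/matrixP => i j; rewrite !mxE /horner_eval !hornerE.
  by case: (i == j); rewrite !hornerE.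
have lineE t : mx_horner line t = A0 + t *: (A1 - A0).
  by apply/matrixP => i j; rewrite !mxE /horner_eval !hornerE.
have adjE (P : 'M[{poly R}]_n) t : mx_horner (\adj P) t = \adj (mx_horner P t).
  by rewrite /mx_horner map_mx_adj.
have := C1_path_horner (\adj (segment u) *m line *m segment v)
  (\adj (segment v) *m map_mx polyC B *m segment u).
congr C1_path; apply/funext => t.
rewrite /mx_horner !map_mxM -!/(mx_horner _ t) !adjE !segmentE lineE mx_horner_polyC.
by rewrite /act /= !invmx_Ngroup//; exact: Ngroup_unip_segment.
Qed.

End Unipotent.

(** * Coordinates on the orbits and primitives of the connection form *)

Section OrbitCoordinates.
Variables (R : realType) (n : nat).
Local Notation M := 'M[R]_n.
Local Notation pt := ((nat * nat)%type -> R).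
Implicit Types (U V A B X : M) (a b : 'rV[R]_n) (x y : pt) (i j k : 'I_n).

Definition mx_entry A (i j : nat) : R :=
  if insub i is Some i' then if insub j is Some j' then A i' j' else 0 else 0.
Definition rv_entry a (i : nat) : R := if insub i is Some i' then a 0 i' else 0.

Lemma mx_entryE A i j : mx_entry A i j = A i j.
Proof. by rewrite /mx_entry !valK. Qed.

Lemma rv_entryE a i : rv_entry a i = a 0 i.
Proof. by rewrite /rv_entry valK. Qed.

Lemma rv_entry_neq0 a (i : nat) : torus a -> (i < n)%N -> rv_entry a i != 0.
Proof. by move=> ta i_n; have := ta (Ordinal i_n); rewrite -rv_entryE. Qed.

Lemma ltn_rev i j : (rev_ord i < rev_ord j)%N = (j < i)%N.
Proof. by rewrite /=; have := ltn_ord i; have := ltn_ord j; lia. Qed.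

(* [U] is stored below the diagonal and [w V w] above it, both transposed, so that [V w a U] and
   [U b w V] become [LDU] and [UDL] ([LDU_mulmx], [UDL_mulmx]). *)
Definition Umx_of x : M := \matrix_(i, j) lower x j i.
Definition Vmx_of x : M := \matrix_(i, j) upper x (rev_ord j) (rev_ord i).
Definition point_of_UV U V : pt := fun p => if (p.2 < p.1)%N then mx_entry U p.2 p.1 else
  if (p.1 < p.2)%N then mx_entry V (n - p.2.+1) (n - p.1.+1) else 0.

Lemma Ngroup_Umx_of x : Ngroup (Umx_of x).
Proof. by apply/NgroupP; split=> [i j ji|i]; rewrite mxE ?lower_diag ?lower_lt. Qed.

Lemma Ngroup_Vmx_of x : Ngroup (Vmx_of x).
Proof. by apply/NgroupP; split=> [i j ji|i]; rewrite mxE ?upper_diag ?upper_gt ?ltn_rev. Qed.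

Definition lower_slot i j : nat * nat := (nat_of_ord j, nat_of_ord i).
Definition upper_slot i j : nat * nat := (nat_of_ord (rev_ord j), nat_of_ord (rev_ord i)).

Lemma Umx_of_lt x i j : (i < j)%N -> Umx_of x i j = x (lower_slot i j).
Proof. by move=> ij; rewrite mxE lower_gt. Qed.

Lemma Vmx_of_lt x i j : (i < j)%N -> Vmx_of x i j = x (upper_slot i j).
Proof. by move=> ij; rewrite mxE upper_lt ?ltn_rev. Qed.

Lemma offdiag_ord i j : i != j -> (nat_of_ord i, nat_of_ord j) \in offdiag n 0.
Proof. by move=> ij; rewrite mem_offdiag /in_block /= !ltn_ord !andbT; exact: ij. Qed.

Lemma offdiagP p : p \in offdiag n 0 ->
  exists i j, p = (nat_of_ord i, nat_of_ord j) /\ i != j.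
Proof.
rewrite mem_offdiag /in_block => /andP[p12 /andP[/andP[_ p1] /andP[_ p2]]].
by exists (Ordinal p1), (Ordinal p2); case: p p12 p1 p2.
Qed.

Lemma lower_slot_offdiag i j : (i < j)%N -> lower_slot i j \in offdiag n 0.
Proof. by move=> ij; apply: offdiag_ord; rewrite -val_eqE /= gtn_eqF. Qed.

Lemma upper_slot_offdiag i j : (i < j)%N -> upper_slot i j \in offdiag n 0.
Proof. by rewrite -ltn_rev => ij; apply: offdiag_ord; rewrite -val_eqE neq_ltn ij. Qed.

Lemma offdiag_slotP p : p \in offdiag n 0 ->
  exists i j, (i < j)%N /\ (p = lower_slot i j \/ p = upper_slot i j).
Proof.
move=> /offdiagP[k [l [-> kl]]]; have [kl'|lk|/val_inj lk] := ltngtP k l.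
- by exists (rev_ord l), (rev_ord k); rewrite ltn_rev /upper_slot !rev_ordK; split; [|right].
- by exists l, k; split; [|left].
- by rewrite lk eqxx in kl.
Qed.

Lemma eq_Umx_of x y : {in offdiag n 0, x =1 y} -> Umx_of x = Umx_of y.
Proof.
move=> xy; apply: eq_Ngroup => [||i j ij]; [exact: Ngroup_Umx_of..|].
by rewrite !Umx_of_lt// xy// lower_slot_offdiag.
Qed.

Lemma eq_Vmx_of x y : {in offdiag n 0, x =1 y} -> Vmx_of x = Vmx_of y.
Proof.
move=> xy; apply: eq_Ngroup => [||i j ij]; [exact: Ngroup_Vmx_of..|].
by rewrite !Vmx_of_lt// xy// upper_slot_offdiag.
Qed.

Lemma Umx_of0 : Umx_of (fun=> 0) = 1%:M.
Proof.
apply: eq_Ngroup => [||i j ij]; [exact: Ngroup_Umx_of|exact: Ngroup1|].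
by rewrite Umx_of_lt// mxE -val_eqE /= ltn_eqF.
Qed.

Lemma Vmx_of0 : Vmx_of (fun=> 0) = 1%:M.
Proof.
apply: eq_Ngroup => [||i j ij]; [exact: Ngroup_Vmx_of|exact: Ngroup1|].
by rewrite Vmx_of_lt// mxE -val_eqE /= ltn_eqF.
Qed.

Lemma point_of_UV_lower U V i j : (i < j)%N -> point_of_UV U V (lower_slot i j) = U i j.
Proof. by move=> ij; rewrite /point_of_UV /= ij mx_entryE. Qed.

Lemma point_of_UV_upper U V i j : (i < j)%N -> point_of_UV U V (upper_slot i j) = V i j.
Proof.
move=> ij; rewrite /point_of_UV /upper_slot ltn_rev ltnNge ltnW//= ltn_rev ij.
have rev_rev k : (n - (rev_ord k).+1 = k)%N by rewrite -[RHS](congr1 val (rev_ordK k)).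
by rewrite !rev_rev mx_entryE.
Qed.

Lemma Umx_of_point_of_UV U V : Ngroup U -> Umx_of (point_of_UV U V) = U.
Proof.
move=> NU; apply: eq_Ngroup => // [|i j ij]; first exact: Ngroup_Umx_of.
by rewrite Umx_of_lt// point_of_UV_lower.
Qed.

Lemma Vmx_of_point_of_UV U V : Ngroup V -> Vmx_of (point_of_UV U V) = V.
Proof.
move=> NV; apply: eq_Ngroup => // [|i j ij]; first exact: Ngroup_Vmx_of.
by rewrite Vmx_of_lt// point_of_UV_upper.
Qed.

Lemma mul_slice_h A b i k : (A *m slice_h b) i k = A i (rev_ord k) * b 0 (rev_ord k).
Proof.
rewrite /slice_h mulmxA mxE (bigD1 (rev_ord k))//= big1 ?addr0 => [|j jk].
  by rewrite [wmx _ _ _ _]mxE rev_ordK eqxx mulr1 mul_mx_diag mxE.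
rewrite [wmx _ _ _ _]mxE (_ : (k == rev_ord j) = false) ?mulr0//.
by apply: contraNF jk => /eqP ->; rewrite rev_ordK.
Qed.

Lemma slice_vE a : slice_v a = slice_h (\row_i a 0 (rev_ord i)).
Proof.
apply/matrixP => i j; rewrite /slice_v /slice_h mul_mx_diag mul_diag_mx !mxE.
by case: eqP => [->|_]; rewrite ?mul1r ?mulr1// mul0r mulr0.
Qed.

Lemma mul_slice_v A a i k : (A *m slice_v a) i k = A i (rev_ord k) * a 0 k.
Proof. by rewrite slice_vE mul_slice_h mxE rev_ordK. Qed.

Lemma UDL_mulmx x b i j : (Umx_of x *m slice_h b *m Vmx_of x) i j =
  UDL n (rv_entry b) 0 x (nat_of_ord (rev_ord j), nat_of_ord i).
Proof.
rewrite /UDL /in_block !ltn_ord /= big_mkord mxE (reindex_inj rev_ord_inj) /=.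
by apply: eq_bigr => q _; rewrite mul_slice_h rev_ordK rv_entryE !mxE rev_ordK; ring.
Qed.

Lemma LDU_mulmx x a i j : (forall k, x (nat_of_ord k, nat_of_ord k) = a 0 k) ->
  (Vmx_of x *m slice_v a *m Umx_of x) i j = LDU n 0 x (nat_of_ord (rev_ord i), nat_of_ord j).
Proof.
move=> xa; rewrite /LDU /in_block !ltn_ord /= big_mkord mxE.
by apply: eq_bigr => q _; rewrite mul_slice_v xa !mxE rev_ordK.
Qed.

Lemma same_orbit_refl A : same_orbit A A.
Proof. by exists 1%:M, 1%:M; split; [exact: Ngroup1|exact: Ngroup1|rewrite mul1mx mulmx1]. Qed.

Lemma same_orbit_trans A B C : same_orbit A B -> same_orbit B C -> same_orbit A C.
Proof.
move=> [u1 [u2 [Nu1 Nu2 ->]]] [v1 [v2 [Nv1 Nv2 ->]]]; exists (v1 *m u1), (u2 *m v2).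
by split; [exact: NgroupM|exact: NgroupM|rewrite !mulmxA].
Qed.

Definition point_of_mxw B : pt := fun p => mx_entry B p.2 (n - p.1.+1).

Lemma point_of_mxw_ord B i j :
  point_of_mxw B (nat_of_ord i, nat_of_ord j) = B j (rev_ord i).
Proof. by rewrite /point_of_mxw /= -[(n - i.+1)%N]/(nat_of_ord (rev_ord i)) mx_entryE. Qed.

Lemma point_of_mxw_UDL b x p : p \in block n 0 ->
  point_of_mxw (Umx_of x *m slice_h b *m Vmx_of x) p = UDL n (rv_entry b) 0 x p.
Proof.
move=> /mem_block_slotP[i [j ->]].
by rewrite /entry_slot point_of_mxw_ord UDL_mulmx rev_ordK.
Qed.

Section Factors.
Variables (b : 'rV[R]_n) (tb : torus b).

Lemma ex_slot_poly : exists pf : nat * nat -> pt -> R, forall p, p \in offdiag n 0 ->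
  poly_fun [in offdiag n 0] (pf p) /\ forall x, x p = pf p (UDL n (rv_entry b) 0 x).
Proof.
have /choice[pf pfP] : forall p, exists f : pt -> R, p \in offdiag n 0 ->
    poly_fun [in offdiag n 0] f /\ forall x, x p = f (UDL n (rv_entry b) 0 x).
  move=> p; have [po|_] := boolP (p \in offdiag n 0); last by exists (fun=> 0).
  by have [f f_poly fE] := UDL_inverse (fun l => rv_entry_neq0 tb) po; exists f.
by exists pf.
Qed.

Definition slot_poly : nat * nat -> pt -> R := projT1 (cid ex_slot_poly).

Lemma slot_polyP p : p \in offdiag n 0 -> poly_fun [in offdiag n 0] (slot_poly p) /\
  forall x, x p = slot_poly p (UDL n (rv_entry b) 0 x).
Proof. by rewrite /slot_poly; case: cid => /= f; apply. Qed.

Definition recover B : pt := fun p => slot_poly p (point_of_mxw B).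
Definition Ufactor B : M := Umx_of (recover B).
Definition Vfactor B : M := Vmx_of (recover B).

Lemma eq_recover B B' : {in offdiag n 0, point_of_mxw B =1 point_of_mxw B'} ->
  {in offdiag n 0, recover B =1 recover B'}.
Proof. by move=> BB' p /slot_polyP[p_poly _]; exact: eq_poly_fun p_poly BB'. Qed.

Lemma recover_UDL x : {in offdiag n 0, recover (Umx_of x *m slice_h b *m Vmx_of x) =1 x}.
Proof.
move=> p po; have [p_poly xE] := slot_polyP po.
rewrite [RHS]xE; apply: (eq_poly_fun p_poly) => q qo.
by apply: point_of_mxw_UDL; exact: sub_offdiag_block qo.
Qed.

Lemma factors_mulmx U V : Ngroup U -> Ngroup V ->
  Ufactor (U *m slice_h b *m V) = U /\ Vfactor (U *m slice_h b *m V) = V.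
Proof.
move=> NU NV; have recE := recover_UDL (point_of_UV U V).
rewrite Umx_of_point_of_UV// Vmx_of_point_of_UV// in recE.
by rewrite /Ufactor /Vfactor (eq_Umx_of recE) (eq_Vmx_of recE)
  Umx_of_point_of_UV// Vmx_of_point_of_UV.
Qed.

Lemma same_orbit_factors B : same_orbit (slice_h b) B ->
  B = Ufactor B *m slice_h b *m Vfactor B.
Proof. by move=> [U [V [NU NV BE]]]; rewrite {2 3}BE; have [-> ->] := factors_mulmx NU NV. Qed.

Lemma eq_same_orbit B B' : same_orbit (slice_h b) B -> same_orbit (slice_h b) B' ->
  {in offdiag n 0, point_of_mxw B =1 point_of_mxw B'} -> B = B'.
Proof.
move=> oB oB' /eq_recover BB'; rewrite (same_orbit_factors oB) (same_orbit_factors oB').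
by rewrite /Ufactor /Vfactor (eq_Umx_of BB') (eq_Vmx_of BB').
Qed.

Lemma derivable_factors (B : R -> M) (t : R) B' : is_derive_mx B t B' ->
  (exists U', is_derive_mx (fun s => Ufactor (B s)) t U') /\
  (exists V', is_derive_mx (fun s => Vfactor (B s)) t V').
Proof.
move=> dB; have d_recover p : p \in offdiag n 0 -> derivable (fun s => recover (B s) p) t 1.
  move=> /slot_polyP[p_poly _]; apply: (poly_fun_derivable p_poly) => q /offdiagP[i [j [-> _]]].
  by under eq_fun do rewrite point_of_mxw_ord; have [] := dB j (rev_ord i).
split; apply: derivable_is_derive_mx => i j; under eq_fun do rewrite mxE; rewrite /lower /upper.
  case: ltnP => ij; last exact: derivable_cst.
  by apply/d_recover/offdiag_ord; rewrite -val_eqE /= gtn_eqF.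
case: ltnP => ij; last exact: derivable_cst.
by apply/d_recover/offdiag_ord; rewrite -val_eqE neq_ltn ij.
Qed.

Lemma strict_upper_derive (W : R -> M) t W' :
  (forall s, Ngroup (W s)) -> is_derive_mx W t W' -> strict_upper W'.
Proof.
move=> NW dW i j ji; apply: is_derive_unique (dW i j) _.
have -> : (fun s => W s i j) = cst ((i == j)%:R); last exact: is_derive_cst.
apply/funext => s; have [w0 w1] := (NgroupP _).1 (NW s); case: eqP => [<-|/eqP ij].
  by rewrite w1.
by rewrite w0// ltn_neqAle ji andbT eq_sym.
Qed.

Lemma orbit_derive (B : R -> M) (t : R) B' : is_derive_mx B t B' ->
  (\forall s \near t, same_orbit (slice_h b) (B s)) ->
  exists X1 X2, [/\ strict_upper X1, strict_upper X2, B' = X1 *m B t + B t *m X2,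
    is_derive t 1 (fun s => fchar (Ufactor (B s))) (fchar X1) &
    is_derive t 1 (fun s => fchar (Vfactor (B s))) (fchar X2)].
Proof.
move=> dB orb; have [[U' dU] [V' dV]] := derivable_factors dB.
have NU s : Ngroup (Ufactor (B s)) by exact: Ngroup_Umx_of.
have NV s : Ngroup (Vfactor (B s)) by exact: Ngroup_Vmx_of.
have sU := strict_upper_derive NU dU; have sV := strict_upper_derive NV dV.
have facE : \forall s \near t, Ufactor (B s) *m slice_h b *m Vfactor (B s) = B s.
  by apply: filterS orb => s /same_orbit_factors.
have dUbV := is_derive_mxM (is_derive_mxM dU (is_derive_mx_cst (slice_h b) t)) dV.
have BtE := same_orbit_factors (nbhs_singleton orb).
exists (U' *m invmx (Ufactor (B t))), (invmx (Vfactor (B t)) *m V'); split.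
- by apply: strict_upper_mulr => //; exact: NgroupV.
- by apply: strict_upper_mull => //; exact: NgroupV.
- rewrite (is_derive_mx_unique dB (near_eq_is_derive_mx facE dUbV)) mulmx0 addr0; congr (_ + _).
    by rewrite {3}BtE !mulmxA mulmxKV ?Ngroup_unitmx.
  by rewrite [X in _ = X *m _]BtE !mulmxA mulmxK ?Ngroup_unitmx.
- by rewrite fchar_mulr//; [exact: is_derive_fchar|exact: NgroupV].
- by rewrite fchar_mull//; [exact: is_derive_fchar|exact: NgroupV].
Qed.

Definition primitive_v (z : phase_space R n) : R := fchar (Ufactor z.1) + fchar (Vfactor z.1).
Definition primitive_h (z : phase_space R n) : R :=
  \tr (z.2 *m z.1) - fchar (Ufactor z.2) - fchar (Vfactor z.2).

Lemma derivable_fchar_factors (B : R -> M) (t : R) B' : is_derive_mx B t B' ->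
  derivable (fun s => fchar (Ufactor (B s))) t 1 /\
  derivable (fun s => fchar (Vfactor (B s))) t 1.
Proof.
move=> dB; have [[U' dU] [V' dV]] := derivable_factors dB.
by split; [have [] := is_derive_fchar dU|have [] := is_derive_fchar dV].
Qed.

Lemma primitive_along_Gv (x : phase_space R n) :
  same_orbit (slice_h b) x.1 -> primitive_along (leaf_Gv x) primitive_v.
Proof.
move=> ox gamma dg t; have [d1 d2] := is_derive_mx_pair (dg t).
split; first by have [? ?] := derivable_fchar_factors d1; exact: derivableD.
move=> near_leaf.
have [|X1 [X2 [s1 s2 gE dU dV]]] := orbit_derive d1.
  by apply: filterS near_leaf => s [_]; exact: same_orbit_trans.
have [/M_ffP[tr_r tr_l] _] := nbhs_singleton near_leaf.
apply: is_derive_eq; rewrite gE mulmxDr mxtraceD !mulmxA tr_r// -(tr_l X1)//; congr (_ + _).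
by rewrite [RHS]mxtrace_mulC mulmxA.
Qed.

Lemma primitive_along_Gh (x : phase_space R n) :
  same_orbit (slice_h b) x.2 -> primitive_along (leaf_Gh x) primitive_h.
Proof.
move=> ox gamma dg t; have [d1 d2] := is_derive_mx_pair (dg t).
have dtr := is_derive_mxtrace (is_derive_mxM d2 d1); split.
  have [dU dV] := derivable_fchar_factors d2; have [dt _] := dtr.
  by apply: derivableB dV; exact: derivableB dt dU.
move=> near_leaf.
have [|X1 [X2 [s1 s2 gE dU dV]]] := orbit_derive d2.
  by apply: filterS near_leaf => s [_]; exact: same_orbit_trans.
have [/M_ffP[tr_r tr_l] _] := nbhs_singleton near_leaf.
apply: is_derive_eq; rewrite gE mxtraceD mulmxDl mxtraceD.
have -> : \tr (X1 *m (gamma t).2 *m (gamma t).1) = fchar X1.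
  by rewrite -mulmxA mxtrace_mulC tr_r.
have -> : \tr ((gamma t).2 *m X2 *m (gamma t).1) = fchar X2.
  by rewrite mxtrace_mulC mulmxA tr_l.
by ring.
Qed.

End Factors.

Lemma primitive_along_Fv (x : phase_space R n) : primitive_along (leaf_Fv x) (fun=> 0).
Proof.
move=> gamma dg t; split=> [|near_leaf]; first exact: derivable_cst.
have [d1 _] := is_derive_mx_pair (dg t); have -> : (derive1 gamma t).1 = 0.
  apply: is_derive_mx_unique d1 _; apply: near_eq_is_derive_mx (is_derive_mx_cst x.1 t).
  by apply: filterS near_leaf => s ->.
by rewrite mulmx0 mxtrace0; exact: is_derive_cst.
Qed.

Lemma primitive_along_Fh (x : phase_space R n) :
  primitive_along (leaf_Fh x) (fun z => \tr (z.2 *m z.1)).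
Proof.
move=> gamma dg t; have [d1 d2] := is_derive_mx_pair (dg t).
have dtr := is_derive_mxtrace (is_derive_mxM d2 d1); split=> [|near_leaf]; first by have [] := dtr.
have g2 : (derive1 gamma t).2 = 0.
  apply: is_derive_mx_unique d2 _; apply: near_eq_is_derive_mx (is_derive_mx_cst x.2 t).
  by apply: filterS near_leaf => s ->.
by apply: is_derive_eq; rewrite g2 mul0mx add0r.
Qed.

End OrbitCoordinates.

Section TransportLeaves.
Variables (R : realType) (hbar : R) (n : nat).
Local Notation M := 'M[R]_n.
Local Notation psi := (@psi R hbar).
Implicit Types (x : phase_space R n) (A B u v : M).

Lemma transport_act (S : set (phase_space R n)) g x A0 u v : primitive_along S g ->
  Ngroup u -> Ngroup v ->
  (forall t, S (act (A0 + t *: (x.1 - A0), x.2) (unip_segment u t, unip_segment v t))) ->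
  transport hbar S x (act (A0, x.2) (u, v)) = psi (g x - g (act (A0, x.2) (u, v))).
Proof.
case: x => A B /= pg Nu Nv S_path; apply: (transport_psi hbar pg (C1_act_path A0 A B Nu Nv)) => //.
  by rewrite !unip_segment0 scale0r addr0.
by rewrite !unip_segment1 scale1r addrC subrK act1.
Qed.

Lemma transport_Gh b x A0 u v (tb : torus b) :
  same_orbit (slice_h b) x.2 -> M_ff x -> M_ff (A0, x.2) -> Ngroup u -> Ngroup v ->
  transport hbar (leaf_Gh x) x (act (A0, x.2) (u, v)) =
  psi (primitive_h tb x - primitive_h tb (act (A0, x.2) (u, v))).
Proof.
move=> ob xM A0M Nu Nv; apply: transport_act => // [|t]; first exact: primitive_along_Gh.
have [Nut Nvt] := (Ngroup_unip_segment t Nu, Ngroup_unip_segment t Nv).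
split; first by apply: M_ff_act => //; apply: M_ff_affine; case: x {ob} xM A0M.
by exists (invmx (unip_segment v t)), (unip_segment u t); split => //; exact: NgroupV.
Qed.

Lemma transport_Gv b x u v (tb : torus b) :
  same_orbit (slice_h b) x.1 -> M_ff x -> Ngroup u -> Ngroup v ->
  transport hbar (leaf_Gv x) x (act x (u, v)) =
  psi (primitive_v tb x - primitive_v tb (act x (u, v))).
Proof.
case: x => A B ob xM Nu Nv; apply: (@transport_act _ _ (A, B) A) => // [|t].
  exact: primitive_along_Gv.
have [Nut Nvt] := (Ngroup_unip_segment t Nu, Ngroup_unip_segment t Nv).
rewrite subrr scaler0 addr0; split; first exact: M_ff_act.
by exists (invmx (unip_segment u t)), (unip_segment v t); split => //; exact: NgroupV.
Qed.

Lemma transport_Fh x A :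
  transport hbar (leaf_Fh x) x (A, x.2) = psi (\tr (x.2 *m x.1) - \tr (x.2 *m A)).
Proof.
have seg1 (t : R) : unip_segment (1%:M : M) t = 1%:M.
  by rewrite /unip_segment subrr scaler0 addr0.
have [N1 pFh] := (@Ngroup1 R n, @primitive_along_Fh R n x).
by rewrite -{1}[(A, x.2)]act1 (transport_act pFh)// ?act1// => t; rewrite !seg1 act1.
Qed.

Lemma flat_Fv (phi : phase_space R n -> R[i]) A B :
  flat_along hbar (@leaf_Fv R n) phi -> phi (A, B) = phi (A, 0).
Proof.
move=> fl; rewrite (fl (A, B) (A, 0) 1) ?mul1r// -[X in is_transport _ _ _ _ X](psi0 hbar).
rewrite -(subrr (0 : R)).
apply: (is_transport_path (gamma := fun t => (A, t *: B)) hbar (@primitive_along_Fv R n (A, B))).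
- have := C1_path_horner (map_mx polyC A) ('X *: map_mx polyC B).
  congr C1_path; apply/funext => t; rewrite mx_horner_polyC; congr (_, _).
  by apply/matrixP => i j; rewrite !mxE /horner_eval !hornerE.
- by [].
- by rewrite scale0r.
- by rewrite scale1r.
Qed.

End TransportLeaves.

(** * Liouville and orbit measures *)

Section Liouville.
Variable R : realType.

Lemma normr_det_involution d (A : 'M[R]_d) : A *m A = 1%:M -> `|\det A| = 1.
Proof.
move=> AA; have : `|\det A| ^+ 2 = 1 by rewrite expr2 -normrM -det_mulmx AA det1 normr1.
by move/eqP; rewrite sqrp_eq1// => /eqP.
Qed.

Lemma normr_det_antiblock d (P Q : 'M[R]_d) :
  `|\det (block_mx 0 P Q 0)| = `|\det P| * `|\det Q|.
Proof.
pose S : 'M[R]_(d + d) := block_mx 0 1%:M 1%:M 0.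
have S_inv : S *m S = 1%:M.
  by rewrite mulmx_block !mul0mx !mulmx0 !mulmx1 !addr0 !add0r -scalar_mx_block.
have PQ_S : block_mx 0 P Q 0 *m S = block_mx P 0 0 Q.
  by rewrite mulmx_block !mul0mx !mulmx0 !mulmx1 !addr0 !add0r.
have := congr1 (fun A => `|\det A|) PQ_S.
by rewrite det_mulmx det_ublock !normrM (normr_det_involution S_inv) mulr1.
Qed.

Variable n : nat.

Lemma liouville_block d (sigma : 'rV[R]_d -> 'rV[R]_d -> phase_space R n) y1 y2 (P : 'M[R]_d) :
  `|\det P| = 1 ->
  (forall i j, omegaM (dsigma1 sigma y1 y2 i) (dsigma1 sigma y1 y2 j) = 0) ->
  (forall i j, omegaM (dsigma1 sigma y1 y2 i) (dsigma2 sigma y1 y2 j) = P i j) ->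
  (forall i j, omegaM (dsigma2 sigma y1 y2 i) (dsigma2 sigma y1 y2 j) = 0) ->
  liouville sigma y1 y2 = 1.
Proof.
move=> dP om11 om12 om22; rewrite /liouville.
have -> : omega_mx sigma y1 y2 = block_mx 0 P (- P^T) 0.
  rewrite /omega_mx; congr block_mx; apply/matrixP => i j; rewrite !mxE.
  - exact: om11.
  - exact: om12.
  - by rewrite -om12 /omegaM opprB.
  - exact: om22.
by rewrite normr_det_antiblock dP -scaleN1r detZ det_tr normrM normr_sign !mul1r dP sqrtr1.
Qed.

Lemma dsigma1_pair d (sigma : 'rV[R]_d -> 'rV[R]_d -> phase_space R n) y1 y2 i
    (P Q : R -> 'M[R]_n) P' Q' :
  (\forall t \near (0 : R), (P t, Q t) = sigma (y1 + t *: delta_mx 0 i) y2) ->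
  is_derive_mx P 0 P' -> is_derive_mx Q 0 Q' -> dsigma1 sigma y1 y2 i = (P', Q').
Proof.
move=> PQ dP dQ; have [_ <-] := derivable_pair_mx dP dQ.
by rewrite /dsigma1 !derive1E; exact/esym/near_eq_derive.
Qed.

Lemma dsigma2_pair d (sigma : 'rV[R]_d -> 'rV[R]_d -> phase_space R n) y1 y2 i
    (P Q : R -> 'M[R]_n) P' Q' :
  (\forall t \near (0 : R), (P t, Q t) = sigma y1 (y2 + t *: delta_mx 0 i)) ->
  is_derive_mx P 0 P' -> is_derive_mx Q 0 Q' -> dsigma2 sigma y1 y2 i = (P', Q').
Proof.
move=> PQ dP dQ; have [_ <-] := derivable_pair_mx dP dQ.
by rewrite /dsigma2 !derive1E; exact/esym/near_eq_derive.
Qed.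

Definition vec_pair (y1 y2 : 'rV[R]_(n * n)) : phase_space R n := (vec_mx y1, vec_mx y2).

Lemma dsigma_vec_pair y1 y2 i : dsigma1 vec_pair y1 y2 i = (vec_mx (delta_mx 0 i), 0) /\
  dsigma2 vec_pair y1 y2 i = (0, vec_mx (delta_mx 0 i)).
Proof.
have vec_mxD y (t : R) : vec_mx (y + t *: delta_mx 0 i) =
    vec_mx y + t *: vec_mx (delta_mx 0 i) :> 'M[R]_n by rewrite linearD linearZ.
split.
  apply: dsigma1_pair (is_derive_mx_affine _ _ 0) (is_derive_mx_cst (vec_mx y2) 0).
  by apply: filterE => t; rewrite /vec_pair vec_mxD.
apply: dsigma2_pair (is_derive_mx_cst (vec_mx y1) 0) (is_derive_mx_affine _ _ 0).
by apply: filterE => t; rewrite /vec_pair vec_mxD.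
Qed.

Lemma mxtrace_mul_delta_mx (i j k l : 'I_n) :
  \tr (delta_mx i j *m delta_mx k l : 'M[R]_n) = ((i, j) == (l, k))%:R.
Proof.
rewrite mul_delta_mx_cond xpair_eqE.
have [_|_] := eqVneq j k; last by rewrite mulr0n mxtrace0 andbF.
rewrite mulr1n andbT /mxtrace (bigD1 i)//= mxE eqxx big1 ?addr0// => q qi.
by rewrite mxE (negPf qi).
Qed.

Lemma liouville_vec_pair y1 y2 : liouville vec_pair y1 y2 = 1.
Proof.
pose T : 'M[R]_(n * n) := lin_mx (@trmx R n n).
have T_inv : T *m T = 1%:M.
  apply/row_matrixP => i; rewrite !rowE mulmxA mulmx1.
  by rewrite -[delta_mx 0 i]vec_mxK /T !mul_vec_lin /= trmxK.
have [d1 d2] : (forall i, dsigma1 vec_pair y1 y2 i = (vec_mx (delta_mx 0 i), 0)) /\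
    (forall i, dsigma2 vec_pair y1 y2 i = (0, vec_mx (delta_mx 0 i))).
  by split=> i; have [] := dsigma_vec_pair y1 y2 i.
apply: (liouville_block (normr_det_involution T_inv)) => i j; rewrite ?d1 ?d2 /omegaM /=.
- by rewrite !mulmx0 mxtrace0 subrr.
- rewrite mul0mx mxtrace0 subr0; case/mxvec_indexP: i => i k; case/mxvec_indexP: j => j l.
  rewrite !vec_mx_delta mxtrace_mul_delta_mx /T.
  have -> : lin_mx (@trmx R n n) (mxvec_index i k) (mxvec_index j l) =
      (mxvec (delta_mx i k : 'M[R]_n)^T) 0 (mxvec_index j l).
    by rewrite -mul_vec_lin mxvec_delta -rowE [in RHS]mxE.
  by rewrite mxvecE !mxE xpair_eqE [i == l]eq_sym [k == j]eq_sym.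
- by rewrite !mul0mx mxtrace0 subrr.
Qed.

End Liouville.

Section OrbitJacobian.
Variables (R : realType) (n : nat).
Local Notation M := 'M[R]_n.

Lemma normr_det_monomial m (A : 'M[R]_m) (c : 'I_m -> R) (s : 'I_m -> 'I_m) :
  injective s -> (forall i j, A i j = c i * (j == s i)%:R) -> `|\det A| = \prod_i `|c i|.
Proof.
move=> s_inj AE; have -> : A = diag_mx (\row_i c i) *m perm_mx (perm.perm s_inj).
  by apply/matrixP => i j; rewrite mul_diag_mx !mxE perm.permE AE eq_sym.
rewrite det_mulmx det_perm det_diag normrM normr_sign mulr1 normr_prod.
by apply: eq_bigr => i _; rewrite mxE.
Qed.

Lemma orbit_jac_monomial (A : M) (v : 'I_n -> M) (c : 'I_n -> 'I_n -> R)
    (tau : 'I_n * 'I_n -> 'I_n * 'I_n) : injective tau ->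
  (forall i j, orbit_frame A v i j = c i j *: delta_mx (tau (i, j)).1 (tau (i, j)).2) ->
  orbit_jac A v = \prod_(i < n) \prod_(j < n) `|c i j|.
Proof.
move=> tau_inj frameE; rewrite /orbit_jac; set f := fun X : M => _.
have [ij_of ij_ofK ij_ofKV] := curry_mxvec_bij n n.
pose index_of := uncurry (@mxvec_index n n); pose s q := index_of (tau (ij_of q)).
have s_inj : injective s.
  move=> p q /(congr1 ij_of); rewrite !ij_ofK// => /tau_inj/(congr1 index_of).
  by rewrite /index_of !ij_ofKV.
rewrite (normr_det_monomial (c := fun q => uncurry c (ij_of q)) s_inj) => [|p q].
  rewrite (reindex _ (curry_mxvec_bij n n)) (pair_bigA _ (fun i j => `|c i j|)) /=.
  by apply: eq_bigr => ij _; rewrite ij_ofK//; case: ij.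
case/mxvec_indexP: p => i j.
have ijE : ij_of (mxvec_index i j) = (i, j) by exact: (ij_ofK (i, j)).
rewrite mxE /= vec_mx_delta /s ijE /=; have -> : f (delta_mx i j) = orbit_frame A v i j.
  rewrite /f (bigD1 i)//= (bigD1 j)//= mxE !eqxx scale1r.
  rewrite big1 ?addr0 => [|l lj]; last by rewrite mxE (negPf lj) andbF scale0r.
  by rewrite big1 ?addr0// => k ki; rewrite big1// => l _; rewrite mxE (negPf ki) scale0r.
by rewrite frameE linearZ /=; case: (tau (i, j)) => k l; rewrite mxvec_delta !mxE eqxx.
Qed.

Lemma prod_prod_ltn (f : 'I_n -> R) :
  \prod_(i < n) \prod_(j < n) (if (i < j)%N then f j else 1) = \prod_(j < n) f j ^+ j.
Proof.
rewrite exchange_big; apply: eq_bigr => j _ /=; rewrite -big_mkcond prodr_const.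
by congr (_ ^+ _); rewrite -[RHS]card_ord -!sum1_card (big_ord_widen n (fun=> 1%N))// ltnW.
Qed.

Lemma mulmx_slice_hl (b : 'rV[R]_n) (X : M) i j :
  (slice_h b *m X) i j = b 0 i * X (rev_ord i) j.
Proof.
rewrite /slice_h -mulmxA mul_diag_mx mxE; congr (_ * _); rewrite mxE (bigD1 (rev_ord i))//= big1.
  by rewrite addr0 mxE eqxx mul1r.
by move=> k ki; rewrite mxE (negPf ki) mul0r.
Qed.

Lemma mulmx_slice_vl (a : 'rV[R]_n) (X : M) i j :
  (slice_v a *m X) i j = a 0 (rev_ord i) * X (rev_ord i) j.
Proof. by rewrite slice_vE mulmx_slice_hl mxE. Qed.

Lemma delta_mx_slice_h (b : 'rV[R]_n) (i j : 'I_n) :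
  delta_mx i j *m slice_h b = b 0 j *: delta_mx i (rev_ord j).
Proof.
apply/matrixP => k l; rewrite mul_slice_h !mxE mulrC.
rewrite -[l == _](inj_eq rev_ord_inj) rev_ordK.
by have [->|_] := eqVneq (rev_ord l) j; rewrite ?andbT// andbF !mulr0.
Qed.

Lemma slice_h_delta_mx (b : 'rV[R]_n) (i j : 'I_n) :
  slice_h b *m delta_mx i j = b 0 (rev_ord i) *: delta_mx (rev_ord i) j.
Proof.
apply/matrixP => k l; rewrite mulmx_slice_hl !mxE -[k == _](inj_eq rev_ord_inj) rev_ordK.
by have [<-|_] := eqVneq (rev_ord k) i; rewrite ?rev_ordK//= !mulr0.
Qed.

Lemma orbit_jac_slice (b : 'rV[R]_n) (v : 'I_n -> M) (rho : 'I_n -> 'I_n) : injective rho ->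
  (forall i, v i = delta_mx (rho i) (rev_ord (rho i))) ->
  orbit_jac (slice_h b) v = (\prod_(k < n) `|b 0 k| ^+ k) ^+ 2.
Proof.
move=> rho_inj vE.
pose c (i j : 'I_n) : R :=
  if (i < j)%N then b 0 j else if (j < i)%N then b 0 (rev_ord j) else 1.
pose tau (p : 'I_n * 'I_n) := if (p.1 < p.2)%N then (p.1, rev_ord p.2) else
  if (p.2 < p.1)%N then (rev_ord p.2, p.1) else (rho p.1, rev_ord (rho p.1)).
have tau_inj : injective tau.
  move=> [i j] [k l]; rewrite /tau /=.
  have [[? ?] [? ?]] := ((ltn_ord i, ltn_ord j), (ltn_ord k, ltn_ord l)).
  have [? ?] := (ltn_ord (rho i), ltn_ord (rho k)).
  case: (ltngtP i j) => ij; case: (ltngtP k l) => kl tauE;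
    move: (congr1 (fun p => val p.1) tauE) (congr1 (fun p => val p.2) tauE) => /= e1 e2;
    try by (exfalso; lia).
  + by congr (_, _); apply: val_inj => /=; lia.
  + by congr (_, _); apply: val_inj => /=; lia.
  + have ik : i = k by apply: rho_inj; exact: val_inj.
    by rewrite ik in ij *; congr (_, _); apply: val_inj; rewrite /= -ij -kl.
rewrite (@orbit_jac_monomial _ _ c tau)// => [|i j].
  have -> : \prod_(i < n) \prod_(j < n) `|c i j| =
    (\prod_(i < n) \prod_(j < n) if (i < j)%N then `|b 0 j| else 1) *
    (\prod_(i < n) \prod_(j < n) if (j < i)%N then `|b 0 (rev_ord j)| else 1).
    rewrite -big_split; apply: eq_bigr => i _; rewrite -big_split; apply: eq_bigr => j _ /=.
    by rewrite /c; case: ltngtP => _; rewrite ?mulr1 ?mul1r ?normr1.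
  rewrite expr2 -prod_prod_ltn; congr (_ * _); rewrite (reindex_inj rev_ord_inj).
  apply: eq_bigr => i _; rewrite (reindex_inj rev_ord_inj); apply: eq_bigr => j _ /=.
  by rewrite ltn_rev rev_ordK.
rewrite /orbit_frame /c /tau /=; case: (ltngtP i j) => ij /=; first exact: delta_mx_slice_h.
  by rewrite slice_h_delta_mx.
by rewrite vE scale1r.
Qed.

Lemma jac_hE (b : 'rV[R]_n) : jac_h b = (\prod_(k < n) `|b 0 k| ^+ k) ^+ 2.
Proof.
apply: (@orbit_jac_slice _ _ id) => // i; apply/matrixP => k l.
rewrite /slice_h mul_diag_mx !mxE eqxx /=.
by have [->|ki] := eqVneq k i; rewrite ?mul1r// mul0r.
Qed.

Lemma jac_vE (a : 'rV[R]_n) : jac_v a = (\prod_(k < n) `|a 0 k| ^+ (n.-1 - k)) ^+ 2.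
Proof.
rewrite /jac_v slice_vE (@orbit_jac_slice _ _ (@rev_ord n)) => [||i]; last 2 first.
- exact: rev_ord_inj.
- rewrite rev_ordK; apply/matrixP => k l; rewrite /slice_v mul_mx_diag !mxE eqxx /=.
  have [->|li] := eqVneq l i; last by rewrite mulr0 andbF.
  by rewrite mulr1 andbT -(inj_eq rev_ord_inj) rev_ordK eq_sym.
congr (_ ^+ 2); rewrite (reindex_inj rev_ord_inj); apply: eq_bigr => k _ /=.
by rewrite mxE rev_ordK; congr (_ ^+ _); have := ltn_ord k; lia.
Qed.

End OrbitJacobian.

(** * The slice of the reduced space *)

Section SliceLift.
Variables (R : realType) (n : nat).
Local Notation M := 'M[R]_n.
Local Notation pt := ((nat * nat)%type -> R).
Local Notation sigma_J := (@sigma_J R n).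
Local Notation Umx_of := (@Umx_of R n).
Local Notation Vmx_of := (@Vmx_of R n).
Implicit Types (a b : 'rV[R]_n) (B X Y : M) (i j k r : 'I_n).

Definition adjacent (i j : nat) : bool := (i == j.+1) || (j == i.+1).

(* On the slice [A = w a] the moment map conditions prescribe the offdiagonal entries of [B w]. *)
Definition offdiag_J a (p : nat * nat) : R :=
  if adjacent p.1 p.2 then (rv_entry a (minn p.1 p.2))^-1 else 0.
Definition diag_J a b (i : nat) : R := rv_entry b i +
  (if (i.+1 < n)%N then (rv_entry a i ^+ 2 * rv_entry b i.+1)^-1 else 0).
Definition mx_J a b : M := \matrix_(i, j) if rev_ord j == i then diag_J a b i
  else offdiag_J a (nat_of_ord (rev_ord j), nat_of_ord i).
Definition unip_J a b : pt := fun p =>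
  if adjacent p.1 p.2 then (rv_entry a (minn p.1 p.2) * rv_entry b (maxn p.1 p.2))^-1 else 0.

Lemma strict_upper_delta r i : (r < i)%N -> strict_upper (delta_mx r i : M).
Proof.
move=> ri k l lk; rewrite mxE; case: eqP => [kr|]; case: eqP => [li|] //=.
by exfalso; move: lk; rewrite kr li; lia.
Qed.

Lemma mxtrace_mulmxE X Y : \tr (X *m Y) = \sum_k \sum_i X i k * Y k i.
Proof. by rewrite exchange_big; apply: eq_bigr => i _; rewrite mxE. Qed.

Lemma mxtrace_mul_delta X r i : \tr (X *m delta_mx r i) = X i r.
Proof.
rewrite mxtrace_mulmxE (bigD1 r)//= [X in _ + X]big1 ?addr0 => [|k kr]; last first.
  by rewrite big1// => l _; rewrite mxE (negPf kr) mulr0.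
rewrite (bigD1 i)//= big1 ?addr0 => [|k ki]; first by rewrite mxE !eqxx mulr1.
by rewrite [delta_mx _ _ _ _]mxE (negPf ki) andbF mulr0.
Qed.

Lemma fchar_delta r i : fchar (delta_mx r i : M) = (i == r.+1 :> nat)%:R.
Proof.
rewrite /fchar (bigD1 r)//= [X in _ + X]big1 ?addr0 => [|k kr]; last first.
  by rewrite big1// => l _; rewrite mxE (negPf kr).
case: eqP => ir.
  rewrite (bigD1 i) ?ir//= mxE !eqxx big1 ?addr0// => k /andP[_ ki].
  by rewrite mxE (negPf ki) andbF.
rewrite big1// => k /eqP kr; rewrite mxE (_ : (k == i) = false) ?andbF//.
by apply/eqP => ki; apply: ir; rewrite -ki kr.
Qed.

Lemma mxtrace_fcharP Y : (forall X, strict_upper X -> \tr (Y *m X) = fchar X) <->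
  forall r i, (r < i)%N -> Y i r = (i == r.+1 :> nat)%:R.
Proof.
split=> [trY r i ri|Y_lower X sX].
  by rewrite -mxtrace_mul_delta trY ?fchar_delta//; exact: strict_upper_delta.
rewrite mxtrace_mulmxE; apply: eq_bigr => k _; rewrite [RHS]big_mkcond; apply: eq_bigr => i _.
have [ki|ik] := ltnP k i; first by rewrite Y_lower//; case: eqP; rewrite ?mul1r ?mul0r.
by rewrite sX// mulr0; case: eqP.
Qed.

Lemma offdiag_J_upper a r i : (r < i)%N ->
  offdiag_J a (nat_of_ord r, nat_of_ord i) = (i == r.+1 :> nat)%:R / a 0 r.
Proof.
move=> ri; rewrite /offdiag_J /adjacent /= ltn_eqF /=; last by lia.
by rewrite (minn_idPl (ltnW ri)) rv_entryE; case: eqP; rewrite ?mul1r ?mul0r.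
Qed.

Lemma offdiag_JC a (p q : nat) : offdiag_J a (p, q) = offdiag_J a (q, p).
Proof. by rewrite /offdiag_J /adjacent /= orbC minnC. Qed.

Lemma M_ff_slice a B : torus a ->
  M_ff (slice_v a, B) <-> {in offdiag n 0, point_of_mxw B =1 offdiag_J a}.
Proof.
move=> ta; have rev_succ (r i : 'I_n) : (rev_ord r == (rev_ord i).+1 :> nat) = (i == r.+1 :> nat).
  by rewrite /=; have := ltn_ord i; have := ltn_ord r; lia.
rewrite M_ffP !mxtrace_fcharP /=; split=> [[lowBa lowaB] p /offdiagP[r [i [-> ri]]]|BJ].
  rewrite point_of_mxw_ord; have [lt_ri|lt_ir|/val_inj e] := ltngtP r i.
  - by rewrite offdiag_J_upper// -lowBa// mul_slice_v mulfK.
  - rewrite offdiag_JC offdiag_J_upper// -rev_succ -lowaB ?ltn_rev//.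
    by rewrite mulmx_slice_vl rev_ordK mulrAC divff ?mul1r//; exact: ta.
  - by rewrite e eqxx in ri.
split=> r i ri.
  rewrite mul_slice_v -point_of_mxw_ord BJ; last by rewrite offdiag_ord// -val_eqE /= ltn_eqF.
  by rewrite offdiag_J_upper// divfK ?ta.
rewrite mulmx_slice_vl -[r in LHS]rev_ordK -point_of_mxw_ord BJ; last first.
  by rewrite offdiag_ord// (inj_eq rev_ord_inj) -val_eqE /= ltn_eqF.
by rewrite offdiag_JC offdiag_J_upper ?ltn_rev// rev_succ mulrC divfK ?ta.
Qed.

Lemma adjacent_S (i : nat) : adjacent i i.+1 /\ adjacent i.+1 i.
Proof. by rewrite /adjacent eqxx orbT. Qed.

Lemma UDL_unip_J a b (r i : nat) : torus a -> torus b -> (r < n)%N -> (i < n)%N ->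
  UDL n (rv_entry b) 0 (unip_J a b) (r, i) =
  if r == i then diag_J a b i else offdiag_J a (r, i).
Proof.
move=> ta tb rn i_n; have [a0 b0] := (@rv_entry_neq0 _ _ a ^~ ta, @rv_entry_neq0 _ _ b ^~ tb).
rewrite UDL_maxn /in_block /= ?rn//; case: eqP => [->|ri]; last first.
  rewrite big_nat_cond big1 ?addr0 => [|q /andP[/andP[riq _] _]]; last first.
    have [rq|iq] : ~~ adjacent r q \/ ~~ adjacent q i by rewrite /adjacent; lia.
      by rewrite {1}/unip_J /= (negPf rq) mul0r mulr0.
    by rewrite [unip_J a b (q, i)]/unip_J /= (negPf iq) !mulr0.
  rewrite /unip_J /offdiag_J /=; case: ifP => _; last by rewrite mulr0.
  by rewrite invfM mulrCA mulfV ?mulr1// b0//; lia.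
rewrite maxnn mulr1 /diag_J; congr (_ + _); case: ltnP => i1; last by rewrite big_geq.
rewrite big_ltn// big_nat_cond big1 ?addr0 => [|q /andP[/andP[iq _] _]]; last first.
  by rewrite {1}/unip_J /= ifF ?mul0r ?mulr0// /adjacent; lia.
rewrite /unip_J /=; have [-> ->] := adjacent_S i.
have [-> ->] : minn i i.+1 = i /\ minn i.+1 i = i by split; lia.
have [-> ->] : maxn i i.+1 = i.+1 /\ maxn i.+1 i = i.+1 by split; lia.
by field; rewrite a0 ?b0.
Qed.

Lemma mx_J_UDL a b : torus a -> torus b ->
  mx_J a b = Umx_of (unip_J a b) *m slice_h b *m Vmx_of (unip_J a b).
Proof.
by move=> ta tb; apply/matrixP => i j; rewrite UDL_mulmx UDL_unip_J ?ltn_ord// mxE.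
Qed.

Lemma point_of_mxw_J a b : {in offdiag n 0, point_of_mxw (mx_J a b) =1 offdiag_J a}.
Proof.
by move=> p /offdiagP[r [i [-> ri]]]; rewrite point_of_mxw_ord mxE rev_ordK (negPf ri).
Qed.

Lemma M_ff_J a b : torus a -> M_ff (slice_v a, mx_J a b).
Proof. by move=> ta; apply/M_ff_slice => //; exact: point_of_mxw_J. Qed.

Lemma same_orbit_J a b : torus a -> torus b -> same_orbit (slice_h b) (mx_J a b).
Proof.
move=> ta tb; exists (Umx_of (unip_J a b)), (Vmx_of (unip_J a b)).
by split; [exact: Ngroup_Umx_of|exact: Ngroup_Vmx_of|exact: mx_J_UDL].
Qed.

Lemma sigma_JE a b : torus a -> torus b -> sigma_J a b = (slice_v a, mx_J a b).
Proof.
move=> ta tb; pose lifts := [set z : phase_space R n |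
  [/\ M_ff z, z.1 = slice_v a & same_orbit (slice_h b) z.2]].
have liftJ : lifts (slice_v a, mx_J a b) by split; [exact: M_ff_J| |exact: same_orbit_J].
rewrite /sigma_J; have [] := xgetPex (0, 0) (ex_intro lifts _ liftJ).
case: (xget _ _) => A B /= zM AE oB; rewrite AE in zM *; congr (_, _).
apply: (eq_same_orbit tb oB (same_orbit_J ta tb)) => p po.
by rewrite point_of_mxw_J// ((M_ff_slice B ta).1 zM).
Qed.

Lemma same_orbit_slice_h_inj b b' : torus b -> same_orbit (slice_h b) (slice_h b') -> b = b'.
Proof.
move=> tb ob; have slice_entry c i k : slice_h c i k = (k == rev_ord i)%:R * c 0 i.
  by rewrite /slice_h mul_diag_mx !mxE mulrC.
have : slice_h b = slice_h b'.
  apply: (eq_same_orbit tb (same_orbit_refl _) ob) => p /offdiagP[i [j [-> ij]]].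
  by rewrite !point_of_mxw_ord !slice_entry (inj_eq rev_ord_inj) (negPf ij) !mul0r.
move=> /matrixP bb'; apply/rowP => i; have := bb' i (rev_ord i).
by rewrite !slice_entry eqxx !mul1r.
Qed.

Lemma coord_A1_slice a : torus a -> coord_A1 (slice_v a) = a.
Proof.
move=> ta; rewrite /coord_A1.
have [] := xgetPex 0 (ex_intro [set a' | torus a' /\ same_orbit (slice_v a') (slice_v a)] a
  (conj ta (same_orbit_refl _))).
set a' := xget _ _ => ta'; rewrite !slice_vE => /same_orbit_slice_h_inj aa'.
have ta'_rev : torus (\row_i a' 0 (rev_ord i)) by move=> i; rewrite mxE.
have /rowP rev_aa' := aa' ta'_rev.
by apply/rowP => i; have := rev_aa' (rev_ord i); rewrite !mxE rev_ordK.
Qed.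

Lemma coord_A2P (x : phase_space R n) : M_circ_ff x ->
  torus (coord_A2 x.2) /\ same_orbit (slice_h (coord_A2 x.2)) x.2.
Proof.
case=> _ _ [b tb ob].
exact: (xgetPex 0 (ex_intro [set b | torus b /\ same_orbit (slice_h b) x.2] b (conj tb ob))).
Qed.

Lemma mxtrace_slice_delta X i : \tr (slice_v (delta_mx 0 i) *m X) = X i (rev_ord i).
Proof.
rewrite /mxtrace (bigD1 (rev_ord i))//= big1 ?addr0 => [|k ki].
  by rewrite mulmx_slice_vl rev_ordK mxE !eqxx mul1r.
rewrite mulmx_slice_vl mxE eqxx /= (_ : (rev_ord k == i) = false) ?mul0r//.
by apply: contraNF ki => /eqP <-; rewrite rev_ordK.
Qed.

Lemma near_torus a i : torus a -> \forall t \near (0 : R), torus (a + t *: delta_mx 0 i).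
Proof.
move=> ta; have : \forall t \near (0 : R), a 0 i + t != 0.
  have cvg_ai : (a 0 i + t @[t --> (0 : R)]) --> a 0 i + 0.
    by apply: cvgD; [exact: cvg_cst|exact: cvg_id].
  rewrite addr0 in cvg_ai.
  by apply: (cvg_ai _ (open_nbhs_nbhs (conj (open_neq (y := 0)) (ta i)))).
apply: filterS => t t0 j; rewrite !mxE eqxx /=.
by have [->|_] := eqVneq j i; rewrite ?mulr1 ?mulr0 ?addr0.
Qed.

Lemma rv_entry_shift a i t (k : nat) :
  rv_entry (a + t *: delta_mx 0 i) k = rv_entry a k + t * (k == i :> nat)%:R.
Proof.
rewrite /rv_entry; case: insubP => [k' _ <-|kn]; first by rewrite !mxE eqxx.
rewrite (_ : (k == i :> nat) = false) ?mulr0 ?addr0//.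
by apply: contraNF kn => /eqP ->; exact: ltn_ord.
Qed.

Lemma derivable_rv_entry_shift a i (k : nat) :
  derivable (fun t : R => rv_entry (a + t *: delta_mx 0 i) k) 0 1.
Proof.
under eq_fun do rewrite rv_entry_shift; apply: derivableD; first exact: derivable_cst.
by apply: derivableM; [exact: derivable_id|exact: derivable_cst].
Qed.

Lemma is_derive_mx_J (a b : R -> 'rV[R]_n) : torus (a 0) -> torus (b 0) ->
  (forall k : nat, derivable (fun t => rv_entry (a t) k) 0 1) ->
  (forall k : nat, derivable (fun t => rv_entry (b t) k) 0 1) ->
  exists2 B', is_derive_mx (fun t => mx_J (a t) (b t)) 0 B' &
    forall j, is_derive (0 : R) 1 (fun t => diag_J (a t) (b t) j) (B' j (rev_ord j)).
Proof.
move=> ta tb da db.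
have [a0 b0] := (@rv_entry_neq0 _ _ (a 0) ^~ ta, @rv_entry_neq0 _ _ (b 0) ^~ tb).
have d_diag j : derivable (fun t => diag_J (a t) (b t) j) 0 1.
  apply: derivableD; first exact: db.
  case: ltnP => j1; last exact: derivable_cst.
  apply: derivableV; first by rewrite mulf_neq0 ?expf_neq0 ?a0 ?b0.
  under eq_fun do rewrite expr2; apply: derivableM; last exact: db.
  by apply: derivableM; exact: da.
have d_offdiag i j : derivable (fun t => offdiag_J (a t) (nat_of_ord i, nat_of_ord j)) 0 1.
  rewrite /offdiag_J; case: adjacent; last exact: derivable_cst.
  by apply: derivableV; [apply: a0; rewrite gtn_min ltn_ord|exact: da].
have [|B' dB'] := derivable_is_derive_mx (P := fun t => mx_J (a t) (b t)) (t := 0).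
  move=> i j; under eq_fun do rewrite mxE; case: eqP => _; [exact: d_diag|exact: d_offdiag].
exists B' => [|j]; first exact: dB'.
by have := dB' j (rev_ord j); under eq_fun do rewrite mxE rev_ordK eqxx.
Qed.

Lemma dsigma1_J a b i : torus a -> torus b ->
  exists2 B', dsigma1 sigma_J a b i = (slice_v (delta_mx 0 i), B') &
    forall j, j != i -> B' j (rev_ord j) = 0.
Proof.
move=> ta tb; pose a_ (t : R) := a + t *: delta_mx 0 i.
have a_0 : a_ 0 = a by rewrite /a_ scale0r addr0.
have [||k|k|B' dB' diagB'] := @is_derive_mx_J a_ (fun=> b); rewrite ?a_0//.
  exact: derivable_rv_entry_shift.
exists B' => [|j ji].
  apply: dsigma1_pair dB'; first by apply: filterS (near_torus i ta) => t ta_; rewrite sigma_JE.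
  move=> k l; have := @is_derive_mx_affine _ _ _ (slice_v a) (slice_v (delta_mx 0 i)) 0 k l.
  by congr is_derive; apply/funext => t; rewrite /slice_v !mul_mx_diag !mxE; ring.
apply: is_derive_unique (diagB' j) _.
have nat_ji : (j == i :> nat) = false by exact: negbTE ji.
under eq_fun do rewrite /diag_J /a_ rv_entry_shift nat_ji mulr0 addr0.
exact: is_derive_cst.
Qed.

Lemma dsigma2_J a b i : torus a -> torus b ->
  exists2 B', dsigma2 sigma_J a b i = (0, B') &
    B' i (rev_ord i) = 1 /\ forall j, (i < j)%N -> B' j (rev_ord j) = 0.
Proof.
move=> ta tb; pose b_ (t : R) := b + t *: delta_mx 0 i.
have b_0 : b_ 0 = b by rewrite /b_ scale0r addr0.
have [||k|k|B' dB' diagB'] := @is_derive_mx_J (fun=> a) b_; rewrite ?b_0//.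
  exact: derivable_rv_entry_shift.
exists B'.
  apply: dsigma2_pair (is_derive_mx_cst (slice_v a) 0) dB'.
  by apply: filterS (near_torus i tb) => t tb_; rewrite sigma_JE.
split=> [|j ij]; apply: is_derive_unique (diagB' _) _.
  under eq_fun do rewrite /diag_J /b_ !rv_entry_shift eqxx gtn_eqF// mulr1 mulr0 addr0 addrAC.
  by apply: is_derive_eq; rewrite add0r mulr1.
under eq_fun do rewrite /diag_J /b_ !rv_entry_shift !gtn_eqF ?ltnS ?(ltnW ij)// !mulr0 !addr0.
exact: is_derive_cst.
Qed.

Lemma liouville_J a b : torus a -> torus b -> liouville sigma_J a b = 1.
Proof.
move=> ta tb; pose D := \matrix_(i, j) (dsigma2 sigma_J a b j).2 i (rev_ord i).
apply: (@liouville_block _ _ _ _ _ _ D) => [|i j|i j|i j].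
- rewrite det_Ngroup ?normr1//; apply/NgroupP; split=> [i j ji|i]; rewrite mxE.
    by have [B2 -> [_ B2_0]] := dsigma2_J j ta tb; exact: B2_0.
  by have [B2 -> [B2_1 _]] := dsigma2_J i ta tb.
- have [<-|ij] := eqVneq i j; first by rewrite /omegaM subrr.
  have [[B1 -> B1_0] [B2 -> B2_0]] := (dsigma1_J i ta tb, dsigma1_J j ta tb).
  by rewrite /omegaM /= !mxtrace_slice_delta B2_0// B1_0 ?subrr// eq_sym.
- rewrite mxE; have [[B1 -> _] [B2 -> _]] := (dsigma1_J i ta tb, dsigma2_J j ta tb).
  by rewrite /omegaM /= mul0mx mxtrace0 subr0 mxtrace_slice_delta.
- have [[B1 -> _] [B2 -> _]] := (dsigma2_J i ta tb, dsigma2_J j ta tb).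
  by rewrite /omegaM /= !mul0mx mxtrace0 subrr.
Qed.

End SliceLift.

(** * Changes of variables in the unipotent integrals *)

Section IteratedIntegralSlots.
Variables (R : realType) (V : lmodType R) (I J : eqType).

Fixpoint affine_point (x : V) (vs : seq V) (ts : seq R) : V :=
  match vs, ts with v :: vs', t :: ts' => affine_point (x + t *: v) vs' ts' | _, _ => x end.

Lemma iter_intC_int_vars (vs : seq V) (F : V -> R[i]) (x : V) (s : seq I) (G : (I -> R) -> R[i]) y :
  size vs = size s ->
  (forall ts, size ts = size s -> F (affine_point x vs ts) = G (upds y s ts)) ->
  iter_intC vs F x = int_vars s G y.
Proof.
elim: vs s x y => [|v vs IH] [|i s] x y //=.
  by move=> _ FG; rewrite /int_vars /= -(FG [::] erefl) /iter_intC /=; case: (F x).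
move=> [vs_s] FG; rewrite int_vars_cons /iter_intC /= /cint.
have int_tail t : int_vars s G (upd y i t) = iter_intC vs F (x + t *: v).
  by apply/esym/IH => // ts sts; exact: (FG (t :: ts) (congr1 S sts)).
by congr (_ +i* _); apply: eq_Rintegral => t _; rewrite int_tail.
Qed.

Lemma iter_intC_slots (r : seq J) (v : J -> V) (slot : J -> I) (mu : (I -> R) -> V) F y :
  uniq (map slot r) ->
  (forall x j t, j \in r -> mu (upd x (slot j) t) = mu x + (t - x (slot j)) *: v j) ->
  (forall j, j \in r -> y (slot j) = 0) ->
  iter_intC (map v r) F (mu y) = int_vars (map slot r) (fun x => F (mu x)) y.
Proof.
move=> ur mu_upd y0; apply: iter_intC_int_vars => [|ts sts]; first by rewrite !size_map.
congr F; elim: r y ts sts ur mu_upd y0 => [|j r IH] y [|t ts] //= [sts] /andP[jr ur] mu_upd y0.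
have -> : mu y + t *: v j = mu (upd y (slot j) t).
  by rewrite mu_upd ?mem_head// y0 ?mem_head// subr0.
apply: IH => // [x k u kr|k kr]; first by apply: mu_upd; rewrite inE kr orbT.
rewrite upd_other ?y0//; first by rewrite inE kr orbT.
by apply: contraNneq jr => <-; exact: map_f.
Qed.

End IteratedIntegralSlots.

Section PolynomialMatrices.
Variables (R : realType) (I : eqType) (A : {pred I}).

Definition poly_mx m k (P : (I -> R) -> 'M[R]_(m, k)) :=
  forall i j, poly_fun A (fun x => P x i j).

Lemma poly_mx_cst m k (B : 'M[R]_(m, k)) : poly_mx (fun=> B).
Proof. by move=> i j; exact: poly_fun_cst. Qed.

Lemma poly_mxM m k l (P : (I -> R) -> 'M[R]_(m, k)) (Q : (I -> R) -> 'M[R]_(k, l)) :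
  poly_mx P -> poly_mx Q -> poly_mx (fun x => P x *m Q x).
Proof.
move=> mP mQ i j; under eq_fun do rewrite mxE.
by apply: poly_fun_sum => q _; apply: poly_funM; [exact: mP|exact: mQ].
Qed.

Lemma poly_fun_det m (P : (I -> R) -> 'M[R]_m) : poly_mx P -> poly_fun A (fun x => \det (P x)).
Proof.
move=> mP; apply: poly_fun_sum => s _; apply: poly_funM; first exact: poly_fun_cst.
by apply: poly_fun_prod => i _; exact: mP.
Qed.

Lemma poly_mx_adj m (P : (I -> R) -> 'M[R]_m) : poly_mx P -> poly_mx (fun x => \adj (P x)).
Proof.
move=> mP i j; under eq_fun do rewrite mxE.
apply: poly_funM; first exact: poly_fun_cst.
by apply: poly_fun_det => k l; under eq_fun do rewrite !mxE; exact: mP.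
Qed.

End PolynomialMatrices.

Section UnipotentMaps.
Variables (R : realType) (n : nat).
Local Notation M := 'M[R]_n.
Local Notation slot := (nat * nat)%type.
Local Notation pt := (slot -> R).
Local Notation Umx_of := (@Umx_of R n).
Local Notation Vmx_of := (@Vmx_of R n).
Implicit Types (u v : M) (x y : pt) (i j k l : 'I_n) (p q : slot).

Definition agree_below d u v := forall k l, (l < k + d)%N -> u k l = v k l.

(* When the entries are ordered by their distance to the diagonal, the last clause makes [theta]
   triangular with diagonal coefficients [c]; hence it preserves the Haar measure. *)
Definition graded_unip_map (c : R) (theta : M -> M) := exists eta : M -> M,
  [/\ `|c| = 1, forall u, Ngroup u -> Ngroup (theta u) /\ eta (theta u) = u,
      forall P : pt -> M, poly_mx [in offdiag n 0] P ->
        poly_mx [in offdiag n 0] (fun x => theta (P x)) /\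
        poly_mx [in offdiag n 0] (fun x => eta (P x)) &
      forall u v i j, Ngroup u -> Ngroup v -> (i < j)%N -> agree_below (j - i) u v ->
        theta u i j - c * u i j = theta v i j - c * v i j].

Lemma graded_unip_map_id : graded_unip_map 1 id.
Proof.
exists id; split=> //; first by rewrite normr1.
by move=> u v i j _ _ _ _; rewrite !mul1r !subrr.
Qed.

Lemma graded_unip_map_mull (V0 : M) : Ngroup V0 -> graded_unip_map 1 (mulmx V0).
Proof.
move=> NV; exists (mulmx (invmx V0)); split; first by rewrite normr1.
- by move=> u Nu; split; [exact: NgroupM|rewrite mulKmx// Ngroup_unitmx].
- by move=> P mP; split; apply: poly_mxM => //; exact: poly_mx_cst.
move=> u v i j Nu Nv ij uv; rewrite !Ngroup_mulmx// !mul1r ![_ + _ - _]addrAC !subrr !add0r.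
by apply: eq_bigr => k ik; rewrite uv//; lia.
Qed.

Lemma agree_below_invmx d u v : Ngroup u -> Ngroup v ->
  agree_below d u v -> agree_below d (invmx u) (invmx v).
Proof.
move=> Nu Nv; have [/NgroupP[u0 _] /NgroupP[v0 _]] := (NgroupV Nu, NgroupV Nv).
elim: d => [|d IH] uv k l; first by rewrite addn0 => lk; rewrite u0// v0.
have {}IH : agree_below d (invmx u) (invmx v) by apply: IH => q r qr; apply: uv; lia.
rewrite addnS ltnS leq_eqVlt => /predU1P[lk|]; last exact: IH.
rewrite !invmx_Ngroup_rec//; congr (_ - _); apply: eq_bigr => q ql.
have [qk|kq] := ltnP q k; first by rewrite u0// v0// !mul0r.
by rewrite IH ?uv//; lia.
Qed.

Lemma invmx_Ngroup_entry u i j : Ngroup u -> (i < j)%N ->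
  invmx u i j = - u i j - \sum_(k < n | (i < k < j)%N) invmx u i k * u k j.
Proof.
move=> Nu ij; have /NgroupP[w0 w1] := NgroupV Nu.
rewrite invmx_Ngroup_rec// -val_eqE /= ltn_eqF// sub0r (bigD1 i)//= w1 mul1r opprD; congr (_ - _).
rewrite (bigID (fun k : 'I_n => (i < k)%N)) /= [X in _ + X]big1 ?addr0.
  by apply: eq_bigl => k; rewrite -val_eqE /=; lia.
move=> k /andP[/andP[_ ki] ik]; rewrite w0 ?mul0r//.
by rewrite ltn_neqAle ki leqNgt.
Qed.

Lemma graded_unip_map_invr (U0 : M) : Ngroup U0 -> graded_unip_map (-1) (fun u => \adj u *m U0).
Proof.
move=> NU; exists (fun u => U0 *m \adj u); split; first by rewrite normrN1.
- move=> u Nu; rewrite -invmx_Ngroup//; have NW := NgroupM (NgroupV Nu) NU; split=> //.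
  by rewrite -invmx_Ngroup// -{1}(mulKVmx (Ngroup_unitmx Nu) U0) mulmxK// Ngroup_unitmx.
- by move=> P mP; split; apply: poly_mxM; (exact: poly_mx_cst || exact: poly_mx_adj).
move=> u v i j Nu Nv ij /[dup] uv /(agree_below_invmx Nu Nv) inv_uv.
rewrite -!invmx_Ngroup// !mulmx_Ngroup// !invmx_Ngroup_entry// !mulN1r !opprK.
have cancel (a b c : R) : - a - b + c + a = c - b by ring.
rewrite !cancel; congr (_ - _); apply: eq_bigr => k; first by move=> kj; rewrite inv_uv//; lia.
by move=> /andP[ik kj]; rewrite inv_uv ?uv//; lia.
Qed.

Definition slot_rank p : nat := (p.1 - p.2) + (p.2 - p.1).

Definition unip_coords (s : 'I_n -> 'I_n -> slot) (W : pt -> M) :=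
  [/\ forall x, Ngroup (W x), forall x i j, (i < j)%N -> W x i j = x (s i j),
      forall i j k l, (s i j == s k l) = ((i, j) == (k, l)) &
      forall i j, (i < j)%N -> s i j \in offdiag n 0 /\ slot_rank (s i j) = (j - i)%N].

Lemma unip_coords_Umx_of : unip_coords (@lower_slot n) Umx_of.
Proof.
split=> [x|x i j|i j k l|i j ij]; [exact: Ngroup_Umx_of|exact: Umx_of_lt| |].
  by rewrite !xpair_eqE !(inj_eq val_inj) andbC.
by split; [exact: lower_slot_offdiag|rewrite /slot_rank /=; lia].
Qed.

Lemma unip_coords_Vmx_of : unip_coords (@upper_slot n) Vmx_of.
Proof.
split=> [x|x i j|i j k l|i j ij]; [exact: Ngroup_Vmx_of|exact: Vmx_of_lt| |].
  by rewrite !xpair_eqE !(inj_eq val_inj) !(inj_eq rev_ord_inj) andbC.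
split; first exact: upper_slot_offdiag.
by rewrite /slot_rank /=; have := ltn_ord i; have := ltn_ord j; lia.
Qed.

Section UnipCoords.
Variables (s : 'I_n -> 'I_n -> slot) (W : pt -> M).
Hypothesis sW : unip_coords s W.

Lemma unip_coords_upd x i j t : (i < j)%N ->
  W (upd x (s i j) t) = W x + (t - x (s i j)) *: delta_mx i j.
Proof.
have [NW WE s_eq _] := sW; move=> ij; apply: eq_Ngroup => // [|k l kl].
  apply: NgroupD => // k l lk; rewrite !mxE.
  by rewrite (_ : _ && _ = false) ?mulr0//; rewrite -!val_eqE /=; lia.
rewrite [RHS]mxE [X in _ + X]mxE [X in _ * X]mxE !WE// /upd s_eq xpair_eqE.
by case: andP => [[/eqP -> /eqP ->]|_]; rewrite ?mulr1 ?mulr0 ?addr0// addrC subrK.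
Qed.

Lemma unip_coords_upd_other x p t : (forall i j, (i < j)%N -> s i j != p) -> W (upd x p t) = W x.
Proof.
by have [NW WE _ _] := sW; move=> sp; apply: eq_Ngroup => // i j ij; rewrite !WE// upd_other ?sp.
Qed.

Lemma agree_below_upd x p t d : (d <= slot_rank p)%N -> agree_below d (W (upd x p t)) (W x).
Proof.
have [NW WE _ sP] := sW; move=> dp k l lk.
have [/NgroupP[u0 u1] /NgroupP[v0 v1]] := (NW (upd x p t), NW x).
have [kl|lk'|/val_inj ->] := ltngtP k l; [|by rewrite u0 ?v0|by rewrite u1 v1].
rewrite !WE// upd_other//; apply: contraTneq dp => <-; have [_ ->] := sP _ _ kl.
by rewrite -ltnNge; lia.
Qed.

Lemma poly_mx_unip_coords : poly_mx [in offdiag n 0] W.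
Proof.
have [NW WE _ sP] := sW; move=> i j; have W0 := fun x => (NgroupP _).1 (NW x).
have [ij|ji|/val_inj ->] := ltngtP i j.
- rewrite (_ : (fun x => W x i j) = fun x => x (s i j)); last by apply/funext => x; exact: WE.
  exact: poly_fun_coord (sP i j ij).1.
- rewrite (_ : (fun x => W x i j) = fun=> 0); first exact: poly_fun_cst.
  by apply/funext => x; exact: (W0 x).1.
- rewrite (_ : (fun x => W x j j) = fun=> 1); first exact: poly_fun_cst.
  by apply/funext => x; exact: (W0 x).2.
Qed.

End UnipCoords.

Section FactorwiseMap.
Variables (cV cU : R) (thetaV thetaU : M -> M).
Hypotheses (gV : graded_unip_map cV thetaV) (gU : graded_unip_map cU thetaU).

Definition factorwise x : pt := fun p =>
  if p \in offdiag n 0 then point_of_UV (thetaU (Umx_of x)) (thetaV (Vmx_of x)) p else x p.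

Lemma factorwise_lower x i j : (i < j)%N ->
  factorwise x (lower_slot i j) = thetaU (Umx_of x) i j.
Proof. by move=> ij; rewrite /factorwise lower_slot_offdiag// point_of_UV_lower. Qed.

Lemma factorwise_upper x i j : (i < j)%N ->
  factorwise x (upper_slot i j) = thetaV (Vmx_of x) i j.
Proof. by move=> ij; rewrite /factorwise upper_slot_offdiag// point_of_UV_upper. Qed.

Lemma Umx_of_factorwise x : Umx_of (factorwise x) = thetaU (Umx_of x).
Proof.
have [eta [_ NthetaU _ _]] := gU; apply: eq_Ngroup => [||i j ij]; first exact: Ngroup_Umx_of.
  exact: (NthetaU _ (Ngroup_Umx_of x)).1.
by rewrite Umx_of_lt// factorwise_lower.
Qed.

Lemma Vmx_of_factorwise x : Vmx_of (factorwise x) = thetaV (Vmx_of x).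
Proof.
have [eta [_ NthetaV _ _]] := gV; apply: eq_Ngroup => [||i j ij]; first exact: Ngroup_Vmx_of.
  exact: (NthetaV _ (Ngroup_Vmx_of x)).1.
by rewrite Vmx_of_lt// factorwise_upper.
Qed.

Lemma seqcont_factorwise p : seqcont (fun x => factorwise x p).
Proof.
have [p_off|/negPf p_off] := boolP (p \in offdiag n 0); last first.
  by rewrite /factorwise p_off; exact: seqcont_coord.
have [[etaV [_ _ polyV _]] [etaU [_ _ polyU _]]] := (gV, gU).
have [i [j [ij [->|->]]]] := offdiag_slotP p_off.
  under eq_fun do rewrite factorwise_lower//.
  exact: poly_fun_seqcont ((polyU _ (poly_mx_unip_coords unip_coords_Umx_of)).1 i j).
under eq_fun do rewrite factorwise_upper//.
exact: poly_fun_seqcont ((polyV _ (poly_mx_unip_coords unip_coords_Vmx_of)).1 i j).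
Qed.

Lemma rapid_factorwise (F : pt -> R[i]) :
  rapid (offdiag n 0) F -> rapid (offdiag n 0) (fun x => F (factorwise x)).
Proof.
apply: rapid_comp => [p|p p_off]; first exact: seqcont_factorwise.
have [i [j [ij [->|->]]]] := offdiag_slotP p_off.
  have [etaU [_ NthetaU polyU _]] := gU; exists (fun x => etaU (Umx_of x) i j) => [|x].
    exact: (polyU _ (poly_mx_unip_coords unip_coords_Umx_of)).2.
  by rewrite Umx_of_factorwise (NthetaU _ (Ngroup_Umx_of x)).2 Umx_of_lt.
have [etaV [_ NthetaV polyV _]] := gV; exists (fun x => etaV (Vmx_of x) i j) => [|x].
  exact: (polyV _ (poly_mx_unip_coords unip_coords_Vmx_of)).2.
by rewrite Vmx_of_factorwise (NthetaV _ (Ngroup_Vmx_of x)).2 Vmx_of_lt.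
Qed.

Definition factorwise_coef p : R := if (p.2 < p.1)%N then cU else cV.

Lemma factorwise_ranked p q x t : p \in offdiag n 0 -> (slot_rank p <= slot_rank q)%N ->
  factorwise (upd x q t) p - factorwise_coef p * upd x q t p =
  factorwise x p - factorwise_coef p * x p.
Proof.
have [[_ [_ _ _ thetaV_ranked]] [_ [_ _ _ thetaU_ranked]]] := (gV, gU).
have [[_ _ _ lowerP] [_ _ _ upperP]] := (unip_coords_Umx_of, unip_coords_Vmx_of).
move=> /offdiag_slotP[i [j [ij [->|->]]]].
  rewrite (lowerP _ _ ij).2 => ranks; rewrite !factorwise_lower// /factorwise_coef ij.
  rewrite -!(Umx_of_lt _ ij); apply: thetaU_ranked => //; [exact: Ngroup_Umx_of..|].
  exact: agree_below_upd unip_coords_Umx_of _ _ _ _ ranks.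
rewrite (upperP _ _ ij).2 => ranks; rewrite !factorwise_upper//.
rewrite /factorwise_coef ltn_rev ltnNge ltnW//= -!(Vmx_of_lt _ ij).
apply: thetaV_ranked => //; [exact: Ngroup_Vmx_of..|].
exact: agree_below_upd unip_coords_Vmx_of _ _ _ _ ranks.
Qed.

Lemma int_vars_factorwise (F : pt -> R[i]) x : rapid (offdiag n 0) F ->
  int_vars (offdiag n 0) (fun y => F (factorwise y)) x = int_vars (offdiag n 0) F x.
Proof.
move=> rF; have [[_ [cV1 _ _ _]] [_ [cU1 _ _ _]]] := (gV, gU); apply/esym.
apply: (int_vars_ranked (rank := slot_rank) (c := factorwise_coef)) => //.
- exact: uniq_offdiag.
- by move=> p; rewrite /factorwise_coef; case: ifP.
- exact: seqcont_factorwise.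
- by move=> y p /negPf p_off; rewrite /factorwise p_off.
- by move=> p q y t p_off _; exact: factorwise_ranked.
- exact: rapid_factorwise.
Qed.

End FactorwiseMap.

(* [true] marks the slots of the first factor of N x N. *)
Local Notation NN_index := (bool * ('I_n * 'I_n))%type.
Implicit Type r : NN_index.

Definition upper_pairs := enum [pred ij : 'I_n * 'I_n | (ij.1 < ij.2)%N].
Definition NN_indices : seq NN_index := map (pair true) upper_pairs ++ map (pair false) upper_pairs.
Definition NN_slot r : slot := if r.1 then upper_slot r.2.1 r.2.2 else lower_slot r.2.1 r.2.2.
Definition NN_vector r : M * M :=
  if r.1 then (delta_mx r.2.1 r.2.2, 0) else (0, delta_mx r.2.1 r.2.2).

Lemma mem_NN_indices r : (r \in NN_indices) = (r.2.1 < r.2.2)%N.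
Proof.
case: r => b ij; rewrite mem_cat; have pair_inj c : injective (pair c : 'I_n * 'I_n -> NN_index).
  by move=> ? ? [].
have other c : c != b -> ((b, ij) \in map (pair c) upper_pairs) = false.
  by move=> cb; apply/negP => /mapP[? _ [bc _]]; rewrite bc eqxx in cb.
by case: b other => other; rewrite (mem_map (pair_inj _)) other// ?orbF mem_enum inE.
Qed.

Lemma lower_upper_slot_neq i j k l : (i < j)%N -> (k < l)%N -> lower_slot i j != upper_slot k l.
Proof. by move=> ij kl; apply/eqP => -[]; have := ltn_ord k; have := ltn_ord l; lia. Qed.

Lemma uniq_NN_slots : uniq (map NN_slot NN_indices).
Proof.
rewrite map_inj_in_uniq => [|[b [i j]] [c [k l]]].
  rewrite cat_uniq !map_inj_uniq ?enum_uniq; try by move=> ? ? [].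
  by rewrite andbT; apply/hasPn => _ /mapP[? _ ->]; apply/negP => /mapP[? _ []].
rewrite !mem_NN_indices /NN_slot /= => ij kl.
have [[_ _ lower_eq _] [_ _ upper_eq _]] := (unip_coords_Umx_of, unip_coords_Vmx_of).
case: b; case: c => /eqP.
- by rewrite upper_eq => /eqP ->.
- by rewrite eq_sym (negPf (lower_upper_slot_neq kl ij)).
- by rewrite (negPf (lower_upper_slot_neq ij kl)).
- by rewrite lower_eq => /eqP ->.
Qed.

Lemma perm_NN_slots : perm_eq (map NN_slot NN_indices) (offdiag n 0).
Proof.
apply: uniq_perm; [exact: uniq_NN_slots|exact: uniq_offdiag|move=> p].
apply/mapP/idP => [[[b [i j]]]|/offdiag_slotP[i [j [ij]]]].
  rewrite mem_NN_indices /= => ij ->.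
  by case: b; [exact: upper_slot_offdiag|exact: lower_slot_offdiag].
by case=> ->; [exists (false, (i, j))|exists (true, (i, j))]; rewrite ?mem_NN_indices.
Qed.

Lemma int_NN_int_vars (F : M * M -> R[i]) x :
  int_NN F = int_vars (map NN_slot NN_indices) (fun y => F (Vmx_of y, Umx_of y)) x.
Proof.
transitivity (int_vars (map NN_slot NN_indices) (fun y => F (Vmx_of y, Umx_of y)) (fun=> 0)).
  rewrite -(iter_intC_slots (v := NN_vector) (mu := fun y => (Vmx_of y, Umx_of y))) //.
  - by rewrite /int_NN Umx_of0 Vmx_of0 /NN_indices map_cat -!map_comp.
  - exact: uniq_NN_slots.
  move=> y [b [i j]] t; rewrite mem_NN_indices /NN_slot /NN_vector /= => ij; case: b => /=.
    rewrite (unip_coords_upd unip_coords_Vmx_of)// (unip_coords_upd_other unip_coords_Umx_of).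
      by congr (_, _); rewrite /= scaler0 addr0.
    by move=> k l kl; exact: lower_upper_slot_neq.
  rewrite (unip_coords_upd unip_coords_Umx_of)// (unip_coords_upd_other unip_coords_Vmx_of).
    by congr (_, _); rewrite /= scaler0 addr0.
  by move=> k l kl; rewrite eq_sym; exact: lower_upper_slot_neq.
apply: int_vars_agree => y z yz; have yz_off : {in offdiag n 0, y =1 z}.
  by move=> p p_off; apply: yz; rewrite (perm_mem perm_NN_slots).
by rewrite (eq_Umx_of yz_off) (eq_Vmx_of yz_off).
Qed.

Lemma int_NN_change cV cU thetaV thetaU (F : M * M -> R[i]) (G : M -> M -> R[i]) x :
  graded_unip_map cV thetaV -> graded_unip_map cU thetaU ->
  (forall u v, Ngroup u -> Ngroup v -> F (u, v) = G (thetaV u) (thetaU v)) ->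
  rapid (offdiag n 0) (fun y => G (Vmx_of y) (Umx_of y)) ->
  int_NN F = int_vars (offdiag n 0) (fun y => G (Vmx_of y) (Umx_of y)) x.
Proof.
move=> gV gU FG rG; rewrite (int_NN_int_vars _ x) -(int_vars_factorwise gV gU x rG).
have -> : (fun y => F (Vmx_of y, Umx_of y)) =
    (fun y => G (Vmx_of (factorwise thetaV thetaU y)) (Umx_of (factorwise thetaV thetaU y))).
  apply/funext => y; rewrite (Vmx_of_factorwise _ gV) (Umx_of_factorwise _ gU).
  by apply: FG; [exact: Ngroup_Vmx_of|exact: Ngroup_Umx_of].
rewrite (perm_int_vars perm_NN_slots uniq_NN_slots)//.
by apply: rapidS (rapid_factorwise gV gU rG) => p; rewrite (perm_mem perm_NN_slots).
Qed.

End UnipotentMaps.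
(** * Comparison of the two sides *)

Section SuperdiagonalSums.
Variables (R : realType) (n : nat).
Local Notation pt := ((nat * nat)%type -> R).
Implicit Types (X : 'M[R]_n) (y : pt) (a b : 'rV[R]_n).

Lemma fchar_mx_entry X : fchar X = \sum_(0 <= i < n.-1) mx_entry X i i.+1.
Proof.
transitivity (\sum_(0 <= i < n) mx_entry X i i.+1).
  rewrite big_mkord; apply: eq_bigr => i _; have [i1|i1] := ltnP i.+1 n.
    rewrite (big_pred1 (Ordinal i1)) => [|j]; first by rewrite -mx_entryE.
    by rewrite /= -val_eqE.
  rewrite big_pred0 => [|j]; last by have := ltn_ord j; lia.
  by rewrite /mx_entry valK insubN// -leqNgt.
case: n X => [X|m X]; first by rewrite !big_geq.
rewrite big_nat_recr//= [X in _ + X](_ : _ = 0) ?addr0// /mx_entry.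
by case: insub => // i; rewrite insubN// ltnn.
Qed.

Lemma mx_entry_lt X (i : nat) : (i < n.-1)%N ->
  exists k l : 'I_n,
    [/\ (k < l)%N, nat_of_ord k = i, nat_of_ord l = i.+1 & mx_entry X i i.+1 = X k l].
Proof.
move=> im; have [i0 i1] : (i < n)%N /\ (i.+1 < n)%N by lia.
by exists (Ordinal i0), (Ordinal i1); split; rewrite -?mx_entryE.
Qed.

Lemma adjacent_sum_fchar y : adjacent_sum n 0 y = fchar (@Umx_of R n y) + fchar (@Vmx_of R n y).
Proof.
rewrite !fchar_mx_entry /adjacent_sum big_split /= addrC; congr (_ + _).
  apply: congr_big_nat => // i /andP[_ im].
  have [k [l [kl <- li ->]]] := mx_entry_lt (Umx_of n y) im.
  by rewrite Umx_of_lt// /lower_slot li.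
rewrite [LHS]big_nat_rev /= add0n; apply: congr_big_nat => // i /andP[_ im].
have [k [l [kl ki li ->]]] := mx_entry_lt (Vmx_of n y) im.
by rewrite Vmx_of_lt// /upper_slot /= ki li; congr (y (_, _)); lia.
Qed.

Lemma adjacent_sum_set_diag (d : nat -> R) y :
  adjacent_sum n 0 (set_diag d y) = adjacent_sum n 0 y.
Proof.
by apply: eq_bigr => i _; rewrite !set_diag_offdiag//= neq_ltn ltnSn ?orbT.
Qed.

Lemma adjacent_sum_unip_J a b : adjacent_sum n 0 (unip_J a b) =
  (\sum_(0 <= i < n.-1) (rv_entry a i * rv_entry b i.+1)^-1) *+ 2.
Proof.
rewrite mulr2n -big_split; apply: eq_bigr => i _; rewrite /unip_J.
have [-> ->] := adjacent_S i; rewrite (minn_idPl (leqnSn i)) (maxn_idPr (leqnSn i)).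
by rewrite (minn_idPr (leqnSn i)) (maxn_idPl (leqnSn i)).
Qed.

Lemma sum_if_succ_lt m (f : nat -> R) :
  \sum_(0 <= i < m) (if (i.+1 < m)%N then f i else 0) = \sum_(0 <= i < m.-1) f i.
Proof.
case: m => [|m]; first by rewrite !big_geq.
rewrite big_nat_recr//= ltnn addr0; apply: eq_big_nat => i /andP[_ im].
by rewrite ltnS im.
Qed.

Lemma mxtrace_J_slice a b : torus a -> torus b -> \tr (mx_J a b *m slice_v a) =
  \sum_(0 <= i < n) rv_entry a i * rv_entry b i +
  \sum_(0 <= i < n.-1) (rv_entry a i * rv_entry b i.+1)^-1.
Proof.
move=> ta tb; transitivity (\sum_(0 <= i < n) (rv_entry a i * rv_entry b i +
    if (i.+1 < n)%N then (rv_entry a i * rv_entry b i.+1)^-1 else 0)).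
  rewrite big_mkord; apply: eq_bigr => i _; rewrite mul_slice_v mxE rev_ordK eqxx -rv_entryE.
  rewrite mulrDl mulrC; congr (_ + _); case: ltnP => i1; last by rewrite mul0r.
  have [ai bi] := (rv_entry_neq0 ta (ltn_ord i), rv_entry_neq0 tb i1).
  by field; rewrite ai bi.
by rewrite big_split; congr (_ + _); exact: sum_if_succ_lt.
Qed.

Definition diag_row y : 'rV[R]_n := \row_i y (nat_of_ord i, nat_of_ord i).

Lemma rv_entry_diag_row y (i : nat) : (i < n)%N -> rv_entry (diag_row y) i = y (i, i).
Proof. by move=> im; have := rv_entryE (diag_row y) (Ordinal im); rewrite mxE. Qed.

Lemma torus_diag_row y : torus (diag_row y) <-> diag_neq0 n 0 y.
Proof.
split=> [ty|/diag_neq0P y0 i]; last by rewrite mxE y0/=.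
by apply/allP => i; rewrite mem_index_iota => /andP[_ im]; have := ty (Ordinal im); rewrite mxE.
Qed.

Lemma primitive_h_sigma_J b (tb : torus b) y : torus (diag_row y) ->
  primitive_h tb (sigma_J (diag_row y) b) = - slice_phase n (rv_entry b) 0 y.
Proof.
move=> ty; rewrite sigma_JE// /primitive_h /= mxtrace_J_slice//.
rewrite mx_J_UDL//; set V := Vmx_of _ _; set U := Umx_of _ _.
have [-> ->] := factors_mulmx tb (Ngroup_Umx_of _ : Ngroup U) (Ngroup_Vmx_of _ : Ngroup V).
rewrite -addrA -opprD -adjacent_sum_fchar adjacent_sum_unip_J /slice_phase.
have -> : \sum_(0 <= i < n) rv_entry (diag_row y) i * rv_entry b i =
    \sum_(0 <= i < n) y (i, i) * rv_entry b i.
  by apply: eq_big_nat => i /andP[_ im]; rewrite rv_entry_diag_row.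
have -> : \sum_(0 <= i < n.-1) (rv_entry (diag_row y) i * rv_entry b i.+1)^-1 =
    \sum_(0 <= i < n.-1) (y (i, i) * rv_entry b i.+1)^-1.
  by apply: eq_big_nat => i /andP[_ im]; rewrite rv_entry_diag_row//; lia.
by ring.
Qed.

End SuperdiagonalSums.

Section CoordinateIntegrals.
Variables (R : realType) (n : nat).

Definition mxvec_slot (q : 'I_(n * n)) : nat * nat :=
  let p := enum_val (cast_ord (esym (mxvec_cast n n)) q) in entry_slot p.1 p.2.

Lemma mxvec_slotE (i j : 'I_n) : mxvec_slot (mxvec_index i j) = entry_slot i j.
Proof. by rewrite /mxvec_slot /mxvec_index cast_ordK enum_rankK. Qed.

Lemma perm_mxvec_slots : perm_eq (map mxvec_slot (enum 'I_(n * n))) (block n 0).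
Proof.
apply: uniq_perm; [|exact: uniq_block|move=> p].
  rewrite map_inj_uniq ?enum_uniq// => q r; case/mxvec_indexP: q => i j.
  case/mxvec_indexP: r => k l; rewrite !mxvec_slotE => /eqP.
  by rewrite entry_slot_eq => /eqP[-> ->].
apply/mapP/idP => [[q _ ->]|/mem_block_slotP[i [j ->]]].
  by case/mxvec_indexP: q => i j; rewrite mxvec_slotE; exact: mem_block_ord.
by exists (mxvec_index i j); rewrite ?mem_enum// mxvec_slotE.
Qed.

Lemma coord_int_mxvec (G : 'rV[R]_(n * n) -> R[i]) x :
  rapid (block n 0) (fun y => G (mxvec (wmx_of_point n y))) ->
  coord_int setT G = int_vars (block n 0) (fun y => G (mxvec (wmx_of_point n y))) x.
Proof.
move=> rG; have perm_slots := perm_mxvec_slots.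
have u_slots : uniq (map mxvec_slot (enum 'I_(n * n))).
  by rewrite (perm_uniq perm_slots) uniq_block.
rewrite (@int_vars_agree _ _ _ _ x (fun=> 0)) => [|y z yz]; last first.
  by rewrite (eq_wmx_of_point yz).
rewrite -(perm_int_vars perm_slots u_slots); last first.
  by apply: rapidS rG => p; rewrite (perm_mem perm_slots).
rewrite /coord_int /rV_basis.
have -> : (fun y => if `[< setT y >] then G y else 0) = G by apply/funext => y; rewrite asboolT.
have -> : (0 : 'rV[R]_(n * n)) = mxvec (wmx_of_point n (fun=> 0)).
  by rewrite (_ : wmx_of_point _ _ = 0) ?linear0//; apply/matrixP => i j; rewrite !mxE.
apply: (iter_intC_slots (mu := fun y => mxvec (wmx_of_point n y))) => // y q t _.
case/mxvec_indexP: q => i j; rewrite mxvec_slotE -{1}(subrK (y (entry_slot i j)) t).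
by rewrite wmx_of_point_upd upd_id linearD linearZ /= mxvec_delta addrC.
Qed.

Lemma coord_int_torus (G : 'rV[R]_n -> R[i]) : coord_int (@torus R n) G =
  int_vars (diagonal n 0) (fun y => if diag_neq0 n 0 y then G (diag_row n y) else 0) (fun=> 0).
Proof.
have diagE : diagonal n 0 = [seq (nat_of_ord i, nat_of_ord i) | i <- enum 'I_n].
  by rewrite /diagonal /index_iota subn0 -val_enum_ord -map_comp.
rewrite /coord_int /rV_basis.
have -> : (0 : 'rV[R]_n) = diag_row n (fun=> 0) by apply/matrixP => i j; rewrite !mxE.
rewrite (iter_intC_slots (slot := fun i : 'I_n => (nat_of_ord i, nat_of_ord i)) (mu := diag_row n)).
- rewrite diagE; congr (int_vars _ _ _); apply/funext => y.
  by rewrite (asbool_equiv_eq (torus_diag_row n y)) asboolb.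
- by rewrite -diagE uniq_diagonal.
- move=> y i t _; apply/matrixP => k j; rewrite ord1 !mxE eqxx /upd xpair_eqE andbb /=.
  have [->|ji] := eqVneq j i; first by rewrite eqxx mulr1 addrC subrK.
  by rewrite ifF ?mulr0 ?addr0//; apply/negbTE; exact: ji.
- by [].
Qed.

End CoordinateIntegrals.

Section Pushforwards.
Variables (R : realType) (hbar : R) (n : nat) (phi : phase_space R n -> R[i]).
Hypotheses (hbar0 : hbar != 0) (phi_D : D_Fv hbar phi).
Local Notation M := 'M[R]_n.
Local Notation C := R[i].
Local Notation pt := ((nat * nat)%type -> R).
Local Notation psi := (@psi R hbar).
Local Notation Umx_of := (@Umx_of R n).
Local Notation Vmx_of := (@Vmx_of R n).
Implicit Types (x : phase_space R n) (y z : pt) (a b : 'rV[R]_n).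

Definition phi_slots y : C := phi (wmx_of_point n y, 0).
Definition phi_hat : pt -> C := fourier_vars hbar (block n 0) phi_slots.

Lemma phi_fst (A B : M) : phi (A, B) = phi (A, 0).
Proof. exact: flat_Fv phi_D.1. Qed.

Lemma fourier_rapid_phi : fourier_rapid hbar (block n 0) phi_slots.
Proof. exact: (schwartz_fourier_rapid hbar0 phi_D.2). Qed.

Lemma rapid_phi : rapid (block n 0) phi_slots.
Proof. exact: fourier_rapid_rapid fourier_rapid_phi. Qed.

Lemma rapid_phi_hat : rapid (block n 0) phi_hat.
Proof. exact: (fourier_rapid_phi (uniq_block n 0)). Qed.

Lemma phi_hat_eq_on y z : {in block n 0, y =1 z} -> phi_hat y = phi_hat z.
Proof.
apply: fourier_vars_eq_on (uniq_block n 0) rapid_phi _ => u v uv.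
by rewrite /phi_slots (eq_wmx_of_point uv).
Qed.

Lemma sum_point_of_mxw (B : M) y :
  \sum_(p <- block n 0) point_of_mxw B p * y p = \tr (B *m wmx_of_point n y).
Proof.
rewrite mxtrace_mulmxE (reindex_inj rev_ord_inj) /= /block big_allpairs big_mkord.
apply: eq_bigr => r _; rewrite big_mkord; apply: eq_bigr => i _.
by rewrite point_of_mxw_ord !mxE /entry_slot !rev_ordK.
Qed.

Lemma fourierE x : fourier hbar phi x = (self_dual hbar ^+ (n * n))%:C *
  (psi (\tr (x.2 *m x.1)) * phi_hat (point_of_mxw x.2)).
Proof.
pose trB := \tr (x.2 *m x.1); pose B := point_of_mxw x.2.
rewrite /fourier /leaf_integral; congr (_ * _); set G := (X in coord_int _ X).
have GE : (fun y => G (mxvec (wmx_of_point n y))) =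
    (fun y => psi trB * (psi (- \sum_(p <- block n 0) B p * y p) * phi_slots y)).
  apply/funext => y; rewrite /G -/(@vec_pair R n) liouville_vec_pair sqrtr1 mulr1 !mxvecK.
  by rewrite transport_Fh phi_fst sum_point_of_mxw psiD mulrA.
have r_psi : rapid (block n 0) (fun y => psi (- \sum_(p <- block n 0) B p * y p) * phi_slots y).
  apply: rapid_psiM rapid_phi; apply/seqcontN/seqcont_sum => p _.
  by apply: seqcontM; [exact: seqcont_cst|exact: seqcont_coord].
rewrite (coord_int_mxvec B) GE; last exact: rapidZ.
rewrite (int_varsZl _ _ (uniq_block n 0) r_psi) /phi_hat fourier_varsE ?uniq_block//.
exact: rapid_phi.
Qed.

Lemma int_NN_slice y : torus (diag_row n y) ->
  int_NN (fun u => psi (- (fchar (invmx u.1) + fchar u.2)) *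
    phi (invmx u.1 *m slice_v (diag_row n y) *m u.2, 0)) = orbital_int hbar n 0 phi_slots y.
Proof.
move=> ty; pose d i := y (i, i).
pose G (V U : M) : C := psi (- (fchar V + fchar U)) * phi (V *m slice_v (diag_row n y) *m U, 0).
have GE : (fun z => G (Vmx_of z) (Umx_of z)) =
    (fun z => orbital_integrand hbar n 0 phi_slots (set_diag d z)).
  apply/funext => z; rewrite /orbital_integrand adjacent_sum_set_diag adjacent_sum_fchar.
  rewrite [fchar (Umx_of z) + _]addrC; congr (_ * phi (_, _)); apply/matrixP => i j.
  rewrite [RHS]mxE -(LDU_mulmx (a := diag_row n y)) => [|k]; last by rewrite set_diagE mxE.
  have off_diag : {in offdiag n 0, z =1 set_diag d z}.
    by move=> p; rewrite mem_offdiag => /andP[p12 _]; rewrite set_diag_offdiag.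
  by rewrite (eq_Umx_of off_diag) (eq_Vmx_of off_diag).
have rG : rapid (offdiag n 0) (fun z => G (Vmx_of z) (Umx_of z)).
  rewrite GE; apply: rapid_orbital_integrand rapid_phi => i im.
  exact: diag_neq0P ((torus_diag_row n y).1 ty) im.
rewrite orbital_int_set_diag -GE.
apply: int_NN_change (graded_unip_map_invr (@Ngroup1 R n)) (graded_unip_map_id R n) _ rG.
by move=> u v Nu _; rewrite /G mulmx1 -invmx_Ngroup.
Qed.

Lemma p_v_sigma_J c b y : 0 < c -> torus (diag_row n y) -> torus b ->
  p_v hbar c phi (sigma_J (diag_row n y) b) =
  (Num.sqrt c * slice_weight n 0 y)%:C * orbital_int hbar n 0 phi_slots y.
Proof.
set a := diag_row n y; move=> c0 ta tb; rewrite /p_v sigma_JE//= coord_A1_slice// jac_vE.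
rewrite sqrtrM ?ltW// sqrtr_sqr ger0_norm; last by apply: prodr_ge0 => k _; rewrite exprn_ge0.
have -> : \prod_(k < n) `|a 0 k| ^+ (n.-1 - k) = slice_weight n 0 y.
  by rewrite /slice_weight big_mkord; apply: eq_bigr => k _; rewrite mxE.
rewrite -int_NN_slice// -/a; congr (_ * _); pose ra : 'rV[R]_n := \row_i a 0 (rev_ord i).
have tra : torus ra by move=> i; rewrite mxE.
rewrite !(int_NN_int_vars _ (fun=> 0)); congr (int_vars _ _ _); apply/funext => z /=.
have [NV NU] := (@Ngroup_Vmx_of R n z, @Ngroup_Umx_of R n z).
have oa : same_orbit (slice_h ra) (slice_v a) by rewrite slice_vE; exact: same_orbit_refl.
rewrite (transport_Gv (x := (slice_v a, mx_J a b)) hbar tra oa (M_ff_J b ta) NV NU) /act /= phi_fst.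
congr (psi _ * _); rewrite /primitive_v /= slice_vE.
have [-> ->] := factors_mulmx tra (NgroupV NV) NU.
have := factors_mulmx tra (@Ngroup1 R n) (@Ngroup1 R n); rewrite mul1mx mulmx1 => -[-> ->].
by rewrite fchar1 addr0 sub0r.
Qed.

Section OrbitPoint.
Variables (c : R) (x : phase_space R n).
Local Notation b := (coord_A2 x.2).
Hypotheses (c0 : 0 < c) (xM : M_ff x) (tb : torus b) (ob : same_orbit (slice_h b) x.2).

Lemma p_h_integrandE (U0 V0 u v : M) : Ngroup U0 -> Ngroup V0 -> Ngroup u -> Ngroup v ->
  x.2 = U0 *m slice_h b *m V0 -> let U := invmx v *m U0 in let V := V0 *m u in
  transport hbar (leaf_Gh x) x (act x (u, v)) * fourier hbar phi (act x (u, v)) =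
  (self_dual hbar ^+ (n * n))%:C * psi (primitive_h tb x) *
  (psi (fchar U + fchar V) * phi_hat (point_of_mxw (U *m slice_h b *m V))).
Proof.
move=> NU0 NV0 Nu Nv xE U V.
have actE : (act x (u, v)).2 = U *m slice_h b *m V by rewrite /act /= {1}xE !mulmxA.
have NU : Ngroup U by apply: NgroupM => //; exact: NgroupV.
have NV : Ngroup V by exact: NgroupM.
have -> : transport hbar (leaf_Gh x) x (act x (u, v)) =
    psi (primitive_h tb x - primitive_h tb (act x (u, v))).
  by have := transport_Gh hbar (A0 := x.1) tb ob xM; rewrite -surjective_pairing; apply.
rewrite fourierE [primitive_h tb (act x _)]/primitive_h actE.
have [-> ->] := factors_mulmx tb NU NV.
set t := \tr _; set f := fchar U; set g := fchar V; set P := primitive_h tb x.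
have psiE : psi P * psi (f + g) = psi (P - (t - f - g)) * psi t.
  by rewrite -!psiD; congr psi; ring.
by rewrite -[RHS]mulrA [psi P * _]mulrA psiE -!mulrA mulrCA.
Qed.

Lemma p_h_fourier y : p_h hbar c (fourier hbar phi) x =
  (Num.sqrt c * \prod_(k < n) `|b 0 k| ^+ k * self_dual hbar ^+ (n * n))%:C *
  psi (primitive_h tb x) * dual_orbital_int hbar n (rv_entry b) 0 phi_hat y.
Proof.
rewrite /p_h jac_hE sqrtrM ?ltW// sqrtr_sqr ger0_norm; last first.
  by apply: prodr_ge0 => k _; rewrite exprn_ge0.
have [U0 [V0 [NU NV xE]]] := ob; rewrite [X in _ = X * _ * _]rmorphM -!mulrA; congr (_ * _).
pose k : C := (self_dual hbar ^+ (n * n))%:C * psi (primitive_h tb x).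
pose G (V U : M) : C :=
  k * (psi (fchar U + fchar V) * phi_hat (point_of_mxw (U *m slice_h b *m V))).
have GE : (fun z => G (Vmx_of z) (Umx_of z)) =
    (fun z => k * dual_orbital_integrand hbar n (rv_entry b) 0 phi_hat z).
  apply/funext => z; rewrite /G /dual_orbital_integrand adjacent_sum_fchar.
  congr (_ * (_ * _)); apply: phi_hat_eq_on => p; exact: point_of_mxw_UDL.
have rG := rapid_dual_orbital_integrand hbar (fun i => rv_entry_neq0 tb) rapid_phi_hat.
rewrite (int_NN_change (G := G) y (graded_unip_map_mull NV) (graded_unip_map_invr NU)).
- by rewrite GE int_varsZl ?uniq_offdiag// /k mulrA.
- by move=> u v Nu Nv; rewrite (p_h_integrandE NU NV Nu Nv xE) /G -invmx_Ngroup.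
- by rewrite GE; exact: rapidZ.
Qed.

Lemma transport_sigma_J a : torus a -> transport hbar (leaf_Gh x) x (sigma_J a b) =
  psi (primitive_h tb x - primitive_h tb (sigma_J a b)).
Proof.
move=> ta; have [U0 [V0 [NU0 NV0 xE]]] := ob.
have [U [V [NU NV JE]]] := same_orbit_J ta tb; set z := sigma_J a b.
have zE : z = (slice_v a, mx_J a b) by exact: sigma_JE.
pose u := invmx V *m V0; pose v := U *m invmx U0.
have Nu : Ngroup u by apply: NgroupM => //; exact: NgroupV.
have Nv : Ngroup v by apply: NgroupM => //; exact: NgroupV.
have act2 : (act z (u, v)).2 = x.2.
  have vU : invmx v *m U = U0.
    by rewrite -[U](mulmxKV (Ngroup_unitmx NU0)) -/v mulKmx ?Ngroup_unitmx.
  rewrite zE /act /= JE [RHS]xE /u; move: (slice_h b) => S.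
  by rewrite !mulmxA vU mulmxK ?Ngroup_unitmx.
have actE : ((act z (u, v)).1, x.2) = act z (u, v) by rewrite -act2 -surjective_pairing.
have := transport_Gh hbar (A0 := (act z (u, v)).1) tb ob xM; rewrite actE => transportE.
rewrite -[z](actK z Nu Nv); apply: transportE; [|exact: NgroupV..].
by apply: M_ff_act => //; rewrite zE; exact: M_ff_J.
Qed.

Lemma H_Std_p_v : H_Std hbar (p_v hbar c phi) x = (self_dual hbar ^+ n)%:C *
  int_vars (diagonal n 0) (slice_integrand hbar n (rv_entry b) 0
    (fun y => psi (primitive_h tb x) * (Num.sqrt c)%:C * phi_slots y)) (fun=> 0).
Proof.
rewrite /H_Std /leaf_integral coord_int_torus; congr (_ * int_vars _ _ _); apply/funext => y.
rewrite slice_integrandZ; last exact: rapid_phi.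
rewrite /slice_integrand; case: ifPn => [y0|_]; last by rewrite mulr0.
have ty : torus (diag_row n y) by apply/torus_diag_row.
rewrite transport_sigma_J// primitive_h_sigma_J// p_v_sigma_J// liouville_J// sqrtr1 mulr1 opprK.
by rewrite psiD rmorphM -!mulrA; congr (_ * _); rewrite mulrCA.
Qed.

End OrbitPoint.

End Pushforwards.

Section DualityConstant.
Variables (R : realType) (hbar : R) (n : nat).

Lemma sqr_bin2 m : (m * m = m + 'C(m, 2).*2)%N.
Proof. by elim: m => [//|m IH]; rewrite binS bin1; lia. Qed.

Lemma duality_const_self_dual (b : 'rV[R]_n) :
  (self_dual hbar ^+ n)%:C * duality_const hbar n (rv_entry b) n 0 =
  (\prod_(k < n) `|b 0 k| ^+ k * self_dual hbar ^+ (n * n))%:C.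
Proof.
have self_dual2 : `|hbar| / (2 * pi) = self_dual hbar ^+ 2.
  by rewrite /self_dual sqr_sqrtr// divr_ge0// mulr_ge0// pi_ge0.
rewrite /duality_const -rmorphM self_dual2 -exprM mul2n mulrA -exprD -sqr_bin2 mulrC.
congr (_ * _)%:C; rewrite big_mkord; apply: eq_bigr => k _.
by rewrite rv_entryE subn0.
Qed.

End DualityConstant.

Theorem theorem4p2p4 (R : realType) (n : nat) (hbar c : R)
    (hbar_neq0 : hbar != 0) (c_gt0 : 0 < c)
    (phi : phase_space R n -> R[i]) (phi_D : D_Fv hbar phi)
    (x : phase_space R n) (x_Mff : M_circ_ff x) :
  H_Std hbar (p_v hbar c phi) x = p_h hbar c (fourier hbar phi) x.
Proof.
have [xM _ _] := x_Mff; have [tb ob] := coord_A2P x_Mff.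
have b0 i : (i < n)%N -> rv_entry (coord_A2 x.2) i != 0 by exact: rv_entry_neq0.
have r_phi := fourier_rapid_phi hbar_neq0 phi_D; have r_hat := rapid_phi_hat hbar_neq0 phi_D.
rewrite (H_Std_p_v hbar_neq0 phi_D c_gt0 xM tb ob).
rewrite (p_h_fourier hbar_neq0 phi_D c_gt0 xM tb ob (fun=> 0)).
rewrite (slice_integral_duality hbar_neq0 b0 _ (m := n))//; last first.
  exact: fourier_rapidZ (uniq_block n 0) r_phi.
rewrite fourier_varsZ ?uniq_block//; last exact: fourier_rapid_rapid r_phi.
rewrite dual_orbital_intZ// mulrA duality_const_self_dual.
by rewrite -[(Num.sqrt c * _ * _)%R]mulrA [(Num.sqrt c * _)%:C]rmorphM; ring.
Qed.
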